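(* Let $\mathfrak d=\sum_{i=1}^k Q_i(z)\frac{d^i}{dz^i}$ be a high-order Heun operator with $Q_k(z)=z^{k+1}+a_kz^k+a_{k-1}z^{k-1}+\cdots+a_1z$. Let $K_Q=\operatorname{Conv}\{\zeta\in\mathbb C:Q_k(\zeta)=0\}$, $\Omega_Q=\mathbb C\setminus K_Q$, and $$C_n(t)=\int\frac{d\mu_n(z)}{t-z}=\frac1{n+1}\frac{Sp_n'(t)}{Sp_n(t)},\qquad U_n(t)=\int\log|t-z|\,d\mu_n(z)=\frac1{n+1}\log|Sp_n(t)|.$$ Then the functions $C_n$ converge locally uniformly in $\Omega_Q$ to an analytic function $C_Q$ depending only on $Q_k$. In a neighbourhood of infinity this function is given by $$C_Q(t)=\int_0^1\frac{\partial}{\partial t}\log\Psi(t,\tau)\,d\tau,$$ where, with $\Theta=\tau^k$, $\Psi(t,\tau)$ is the branch of the algebraic equation $$\Psi^k=(t+a_k\Theta)\Psi^{k-1}+\sum_{r=1}^{k-1}\Theta(1-\Theta)^r a_{k-r}\Psi^{k-1-r}$$ satisfying $\Psi(t,\tau)=t+O(1)$ as $t\to\infty$. Moreover $U_n$ converges locally uniformly in $\Omega_Q$ to a harmonic function $U_Q^{\rm ext}$ normalized by $U_Q^{\rm ext}(t)=\log|t|+O(|t|^{-1})$ as $t\to\infty$ and satisfying $2\,\partial U_Q^{\rm ext}/\partial t=C_Q$ in $\Omega_Q$ (Wirtinger derivative). Thus all subsequential weak limits of $\{\mu_n\}$ have the same exterior Cauchy transform and the same exterior logarithmic potential on $\O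mega_Q$.
   Context: Let $k\ge1$. A high-order Heun operator (Fuchs index one) is $\mathfrak d=\sum_{i=1}^kQ_i(z)\frac{d^i}{dz^i}$ with complex polynomials $Q_i$, $\deg Q_i\le i+1$, $\deg Q_k=k+1$. Write $Q_i(z)=\sum_{j=0}^{i+1}q_{i,j}z^j$ and $\lambda_n=\sum_{i=1}^kq_{i,i+1}\,n(n-1)\cdots(n-i+1)$. For given $n$, a Van Vleck polynomial is an at most linear polynomial $V$ such that $(\mathfrak d+V)S=0$ for some polynomial $S$ of degree exactly $n$. For all sufficiently large $n$ these have the form $V_{n,j}(z)=-\lambda_n(z-z_{n,j})$, $j=1,\dots,n+1$, counted with multiplicity, where the multiplicity of a Van Vleck root is its algebraic multiplicity as an eigenvalue of the operator $S\mapsto zS-\lambda_n^{-1}\mathfrak dS$ on the space $\mathrm{Pol}_{\le n}$ of polynomials of degree at most $n$ (this operator preserves $\mathrm{Pol}_{\le n}$). The $n$-th spectral polynomial is $Sp_n(z)=\prod_{j=1}^{n+1}(z-z_{n,j})$ and its root-counting measure is $\mu_n=\frac1{n+1}\sum_{j=1}^{n+1}\delta_{z_{n,j}}$. Assuming $Q_k$ monic with a zero at the origin is the paper's standing normalization (achieved by an affine change of variable). *)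

(* Defs.v *)
(* MathComp-Analysis; the complex numbers are R[i] for R : realType. *)
From HB Require Import structures.
From mathcomp Require Export all_boot all_order all_algebra.
From mathcomp Require Export complex.
From mathcomp Require Export all_classical all_reals all_analysis.
Set Implicit Arguments.
Unset Strict Implicit.
Unset Printing Implicit Defensive.
Import Order.TTheory GRing.Theory Num.Theory.
Export numFieldNormedType.Exports.
Export ComplexField.
Local Open Scope classical_set_scope.
Local Open Scope ring_scope.
Local Open Scope complex_scope.

(* R[i] seen through its numFieldType structure: this is what gives it the
   topology and the normed module structure (over itself) of the library. Its
   norm `|z| takes values in Cnum R; normc z is the same modulus, in R. *)
Definition Cnum (R : realType) : numFieldType := R[i].

Notation normc := Normc.normc.

(* The complex numbers with their Borel sigma-algebra. *)
Definition borelC (R : realType) := g_sigma_algebraType (@open (Cnum R)).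
HB.instance Definition _ (R : realType) := Measurable.on (borelC R).

Section HeunOperator.
Variable R : realType.
Local Notation C := (Cnum R).
Variables (k : nat) (Q : nat -> {poly C}).
Implicit Types (S V : {poly C}) (n : nat).

(* Only Q 1, ..., Q k are relevant. *)
Definition high_order_heun : Prop :=
  (forall i, (1 <= i <= k)%N -> (size (Q i) <= i.+2)%N) /\ size (Q k) = k.+2.

Definition heun_op S : {poly C} := \sum_(1 <= i < k.+1) Q i * S^`(i).

Definition heun_lambda n : C :=
  \sum_(1 <= i < k.+1) (Q i)`_i.+1 * (n ^_ i)%:R.

Definition van_vleck n V : Prop :=
  (size V <= 2)%N /\
  exists S, size S = n.+1 /\ heun_op S + V * S = 0.

Definition pencil_op n S : {poly C} :=
  'X * S - (heun_lambda n)^-1 *: heun_op S.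

(* Matrix of pencil_op n on the polynomials of degree at most n, in the monomial
   basis, acting on row vectors. When heun_lambda n != 0 the space is stable
   under pencil_op n, so poly_rV truncates nothing. *)
Definition pencil_mx n : 'M[C]_n.+1 :=
  lin1_mx (fun v : 'rV[C]_n.+1 => poly_rV (pencil_op n (rVpoly v))).

Definition pencil_eigenvalues n : seq C :=
  sval (closed_field_poly_normal (char_poly (pencil_mx n) : {poly R[i]})).

(* Those z for which - heun_lambda n * (X - z) is a Van Vleck polynomial, each
   repeated according to its algebraic multiplicity as an eigenvalue. *)
Definition van_vleck_roots n : seq C :=
  [seq z <- pencil_eigenvalues n
     | `[< van_vleck n (- heun_lambda n *: ('X - z%:P)) >]].

Definition spectral_poly n : {poly C} :=
  \prod_(z <- van_vleck_roots n) ('X - z%:P).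

Definition root_counting_measure n : {measure set borelC R -> \bar R} :=
  mscale ((n.+1%:R : R)^-1)%:nng
    (msum (fun j => dirac ((van_vleck_roots n)`_j : borelC R))
          (size (van_vleck_roots n))).

End HeunOperator.

Section ComplexIntegral.
Context (d : measure_display) (T : measurableType d) (R : realType).
Local Notation C := (Cnum R).
Variables (mu : {measure set T -> \bar R}) (D : set T).

Definition cintegral (f : T -> C) : C :=
  Rintegral mu D (fun x => complex.Re (f x)) +i*
  Rintegral mu D (fun x => complex.Im (f x)).

Definition cintegrable (f : T -> C) : Prop :=
  mu.-integrable D (fun x => (complex.Re (f x))%:E) /\
  mu.-integrable D (fun x => (complex.Im (f x))%:E).

End ComplexIntegral.

Section Potentials.
Variable R : realType.
Local Notation C := (Cnum R).
Variable mu : {measure set borelC R -> \bar R}.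

Definition cauchy_transform (t : C) : C :=
  cintegral mu setT (fun z : borelC R => (t - z)^-1).

Definition log_potential (t : C) : R :=
  Rintegral mu setT (fun z : borelC R => ln (normc (t - z))).

End Potentials.

Section Analysis.
Variable R : realType.
Local Notation C := (Cnum R).
Implicit Types (O : set C) (u : C -> R).

Definition convex_hull (A : set C) : set C :=
  [set z | exists (m : nat) (w : 'I_m -> R) (p : 'I_m -> C),
     [/\ forall i, 0 <= w i, \sum_i w i = 1, forall i, A (p i)
       & z = \sum_i (w i)%:C * p i]].

Definition locally_uniform_cvg (V : uniformType) O
    (F : nat -> C -> V) (f : C -> V) : Prop :=
  forall t, O t -> exists2 U, nbhs t U & {uniform U, F @ \oo --> f}.

Definition analytic_on O (f : C -> C) : Prop :=
  forall t0, O t0 -> exists (c : nat -> C) (r : R), 0 < r /\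
    forall t, normc (t - t0) < r ->
      [series c m * (t - t0) ^+ m]_m @ \oo --> f t.

Definition xline u (t : C) : R -> R := fun h => u (t + (h +i* 0)).
Definition yline u (t : C) : R -> R := fun h => u (t + (0 +i* h)).

Definition dx u : C -> R := fun t => derive1 (xline u t) 0.
Definition dy u : C -> R := fun t => derive1 (yline u t) 0.

Definition C1_on O u : Prop := forall t, O t ->
  [/\ derivable (xline u t) 0 1, derivable (yline u t) 0 1,
      {for t, continuous (dx u)} & {for t, continuous (dy u)}].

Definition harmonic_on O u : Prop :=
  [/\ C1_on O u, C1_on O (dx u), C1_on O (dy u)
    & forall t, O t -> dx (dx u) t + dy (dy u) t = 0].

Definition wirtinger u (t : C) : C :=
  2^-1 * ((dx u t)%:C - 'i * (dy u t)%:C).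

Definition weak_cvg (mu : nat -> {measure set borelC R -> \bar R})
    (nu : {measure set borelC R -> \bar R}) : Prop :=
  forall u, continuous u -> (exists M : R, forall z, `|u z| <= M) ->
    (fun n => Rintegral (mu n) setT (u : borelC R -> R)) @ \oo -->
    Rintegral nu setT (u : borelC R -> R).

(* The derivative of any local branch of log f: it does not depend on it. *)
Definition log_derivative (f : C -> C) (t : C) : C :=
  derive1 f t / f t.

End Analysis.

Section Branch.
Variable R : realType.
Local Notation C := (Cnum R).
Variables (k : nat) (a : nat -> C).

Definition monic_zero_at_origin : {poly C} :=
  'X^(k.+1) + \sum_(1 <= j < k.+1) a j *: 'X^j.

Definition zero_hull : set C :=
  convex_hull [set z | root monic_zero_at_origin z].

Definition branch_equation (t : C) (tau : R) (psi : C) : Prop :=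
  let Theta := (tau ^+ k)%:C in
  psi ^+ k = (t + a k * Theta) * psi ^+ k.-1 +
    \sum_(1 <= r < k)
      Theta * (1 - Theta) ^+ r * a (k - r)%N * psi ^+ (k.-1 - r).

Definition branch_at_infinity (rho : R) (Psi : C -> R -> C) : Prop :=
  forall tau, 0 <= tau <= 1 ->
  [/\ analytic_on [set t | rho < normc t] (fun t => Psi t tau),
      forall t, rho < normc t -> branch_equation t tau (Psi t tau)
    & exists M r : R, forall t, r < normc t -> normc (Psi t tau - t) <= M].

End Branch.

(* Main.v *)
(* For n large every eigenvector of the pencil has degree n, so that Sp_n is the
   characteristic polynomial of the pencil. In the monomial basis the latter is a
   Hessenberg matrix, whose leading minors satisfy
     D_(m+1) = t D_m + sum_(r < k) w_(n,m,r) D_(m-r),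
   with w_(n,m,r) close to Theta (1 - Theta)^r a_(k-r) for Theta = (m/n)^k, uniformly
   in m <= n. For |t| large the ratios D_(m+1) / D_m therefore follow the branch
   Psi (t, m/n), their logarithmic derivatives add up to Sp_n' / Sp_n, and Riemann
   sums give the limit of C_n (t) near infinity. This determines the limits of all
   moments of the roots.

   A disc containing the zeros of Q_k contains the Van Vleck roots for n large, because
   Q_k S^(k) dominates the equation outside of it. Outside such a disc C_n and U_n
   are limits of series in the moments, uniformly in n, hence they converge uniformly
   there. A point outside K_Q lies outside some disc containing the zeros of Q_k. *)
Require Import Defs.
From mathcomp Require Import ring lra zify measurable_realfun.
Set Implicit Arguments.
Unset Strict Implicit.
Unset Printing Implicit Defensive.
Import Order.TTheory GRing.Theory Num.Theory.
Local Open Scope classical_set_scope.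
Local Open Scope ring_scope.
Local Open Scope complex_scope.

(** * Modulus and limits of complex sequences *)

(** No contour integral, normal family or branch of the logarithm is used. The basic comparison is
    [cauchy2]: for two operators with the same leading coefficient, the moments of one at n and of
    the other at n' become close. Equal operators give convergence, different ones give independence
    of the lower coefficients, so the limits may be defined through one fixed operator, [model].
    Discs come in because (x - c) / (x - z) has real part at least 1/2 as soon as |z - c| <= |x -
    c|; summed over the zeros z of S, this bounds S at x by its derivative. Outside a slightly
    larger disc both kernels are series in (z - c) / (t - c) of ratio at most r / r' < 1, so
    finitely many moments decide. Near infinity everything is written in y = 1 / Psi, the small root
    of y (t + sym y) = 1 and the fixed point of a contraction. The difficulty is that the recurrence
    has about n steps: errors must not accumulate. For |t| beyond [far] the step is so contracting
    that the induction on m reproduces the same error e at every m. Differentiating the recurrence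
    in t gives a relation of the same kind for the logarithmic derivatives, treated in the same
    way. *)

Section Modulus.
Variable R : realType.
Local Notation C := (Cnum R).
Implicit Types (x y z : C) (r : R).

Lemma normc_sqr z : normc z ^+ 2 = complex.Re z ^+ 2 + complex.Im z ^+ 2.
Proof. by case: z => a b; rewrite /= sqr_sqrtr // addr_ge0 ?sqr_ge0. Qed.

Lemma cn0 : normc (0 : C) = 0. Proof. exact: Normc.normc0. Qed.
Lemma cn1 : normc (1 : C) = 1. Proof. exact: Normc.normc1. Qed.
Lemma cnM x y : normc (x * y) = normc x * normc y.
Proof. exact: Normc.normcM. Qed.
Lemma cnV x : normc x^-1 = (normc x)^-1. Proof. exact: Normc.normcV. Qed.
Lemma cnN x : normc (- x) = normc x. Proof. exact: normcN. Qed.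
Lemma cn_ge0 x : 0 <= normc x. Proof. by case: x => a b; apply: sqrtr_ge0. Qed.
Lemma cnD x y : normc (x + y) <= normc x + normc y. Proof. exact: le_normcD. Qed.
Lemma cnB x y : normc (x - y) <= normc x + normc y.
Proof. by rewrite -(cnN y) cnD. Qed.
Lemma cnBC x y : normc (x - y) = normc (y - x).
Proof. by rewrite -cnN opprB. Qed.
Lemma cn_eq0 x : (normc x == 0) = (x == 0).
Proof. by apply/eqP/eqP => [/Normc.eq0_normc|->] //; rewrite cn0. Qed.
Lemma cn_gt0 x : (0 < normc x) = (x != 0).
Proof. by rewrite lt_neqAle cn_ge0 andbT eq_sym cn_eq0. Qed.
Lemma cnX x n : normc (x ^+ n) = normc x ^+ n.
Proof. by elim: n => [|n IH]; rewrite ?expr0 ?cn1 // !exprS cnM IH. Qed.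
Lemma cn_real r : normc (r%:C : C) = `|r|.
Proof. by rewrite /= expr0n /= addr0 sqrtr_sqr. Qed.
Lemma natC n : (n%:R : C) = (n%:R : R)%:C.
Proof. by rewrite -[RHS]/(real_complex R n%:R) rmorph_nat. Qed.
Lemma cn_nat n : normc (n%:R : C) = n%:R.
Proof. by rewrite natC cn_real ger0_norm. Qed.
Lemma cnDB x y z : normc (x - z) <= normc (x - y) + normc (y - z).
Proof. by have := cnD (x - y) (y - z); rewrite addrA subrK. Qed.
Lemma cn_lower x y : normc x - normc y <= normc (x + y).
Proof. by have := cnD (x + y) (- y); rewrite addrK cnN; lra. Qed.
Lemma cn_lowerB x y : normc x - normc y <= normc (x - y).
Proof. by have := cn_lower x (- y); rewrite cnN. Qed.

Lemma cn_sum I (s : seq I) (P : pred I) (F : I -> C) :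
  normc (\sum_(i <- s | P i) F i) <= \sum_(i <- s | P i) normc (F i).
Proof.
elim/big_ind2: _ => [|x r y r' hx hy|//]; first by rewrite cn0.
exact: le_trans (cnD _ _) (lerD hx hy).
Qed.
Lemma cn_sum_le I (s : seq I) (P : pred I) (F : I -> C) (G : I -> R) :
  (forall i, P i -> normc (F i) <= G i) ->
  normc (\sum_(i <- s | P i) F i) <= \sum_(i <- s | P i) G i.
Proof. by move=> h; apply: le_trans (cn_sum _ _ _) _; apply: ler_sum. Qed.

Lemma Re_le_cn z : `|complex.Re z| <= normc z.
Proof.
by rewrite -(@ler_pXn2r _ 2) ?nnegrE ?cn_ge0 // normc_sqr real_normK ?num_real //
  lerDl sqr_ge0.
Qed.
Lemma Im_le_cn z : `|complex.Im z| <= normc z.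
Proof.
by rewrite -(@ler_pXn2r _ 2) ?nnegrE ?cn_ge0 // normc_sqr real_normK ?num_real //
  lerDr sqr_ge0.
Qed.
Lemma cn_le_ReIm z : normc z <= `|complex.Re z| + `|complex.Im z|.
Proof.
rewrite {1}[z]complexE; apply: le_trans (cnD _ _) _.
rewrite cnM !cn_real lerD2l (_ : normc _ = 1) ?mul1r //.
by rewrite /= expr0n /= expr1n add0r sqrtr1.
Qed.

Lemma ReD x y : complex.Re (x + y) = complex.Re x + complex.Re y.
Proof. by case: x; case: y. Qed.
Lemma ImD x y : complex.Im (x + y) = complex.Im x + complex.Im y.
Proof. by case: x; case: y. Qed.
Lemma ReN x : complex.Re (- x) = - complex.Re x. Proof. by case: x. Qed.
Lemma ImN x : complex.Im (- x) = - complex.Im x. Proof. by case: x. Qed.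
Lemma Re_mul x y : complex.Re (x * y) =
  complex.Re x * complex.Re y - complex.Im x * complex.Im y.
Proof. by case: x; case: y. Qed.
Lemma Im_mul x y : complex.Im (x * y) =
  complex.Re x * complex.Im y + complex.Im x * complex.Re y.
Proof. by case: x; case: y. Qed.
Lemma Re_sum I (s : seq I) (P : pred I) (F : I -> C) :
  complex.Re (\sum_(i <- s | P i) F i) = \sum_(i <- s | P i) complex.Re (F i).
Proof. by apply: big_morph; [exact: ReD|]. Qed.
Lemma Im_sum I (s : seq I) (P : pred I) (F : I -> C) :
  complex.Im (\sum_(i <- s | P i) F i) = \sum_(i <- s | P i) complex.Im (F i).
Proof. by apply: big_morph; [exact: ImD|]. Qed.
Lemma complex_eq x y : complex.Re x = complex.Re y -> complex.Im x = complex.Im y -> x = y.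
Proof. by case: x y => [a b] [c d] /= -> ->. Qed.

(** The quotient is 1 / (1 - w) with w = y / x in the closed unit disc, and w |-> 1 / (1 - w) maps
    that disc into the half-plane Re >= 1/2. *)
Lemma Re_div_half x y : normc y <= normc x -> x != y ->
  2^-1 <= complex.Re (x / (x - y)).
Proof.
move=> yx xy.
have d0 : 0 < normc (x - y) ^+ 2 by rewrite exprn_gt0 // cn_gt0 subr_eq0.
have : normc y ^+ 2 <= normc x ^+ 2 by rewrite ler_pXn2r // nnegrE cn_ge0.
move: d0; rewrite !normc_sqr.
case: x {xy} yx => a b; case: y => c d _ /= d0 h.
rewrite !mulrA -!mulNr -!mulrA [X in _ <= X](_ : _ =
  (a * (a - c) + b * (b - d)) / ((a - c) ^+ 2 + (b - d) ^+ 2)); last by ring.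
rewrite ler_pdivlMr //; nra.
Qed.

End Modulus.

Section Limits.
Variable R : realType.
Local Notation C := (Cnum R).
Implicit Types (u v : nat -> C) (l : C).

Lemma real_cauchy_cvg (u : nat -> R) :
  (forall e, 0 < e -> exists N, forall m n, (N <= m)%N -> (N <= n)%N ->
     `|u m - u n| <= e) ->
  exists a, forall e, 0 < e -> exists N, forall n, (N <= n)%N -> `|u n - a| <= e.
Proof.
move=> h.
have cu : cvg (u @ \oo).
  apply/cauchy_cvgP/cauchy_exP => e e0.
  have e2 : 0 < e / 2 by rewrite divr_gt0.
  have [N hN] := h _ e2.
  exists (u N); exists N => // n /= Nn.
  rewrite /ball_ /=; apply: le_lt_trans (hN _ _ (leqnn N) Nn) _; lra.
exists (lim (u @ \oo)) => e e0.
have /cvgrPdist_le /(_ e e0) [N _ hN] := cu.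
by exists N => n Nn; rewrite distrC; apply: hN.
Qed.

(** Convergence with a real epsilon, since the norm of [Cnum R] is itself complex-valued; [cvgC_P]
    translates to filters. *)
Definition cvgC u l := forall e : R, 0 < e -> exists N, forall n, (N <= n)%N ->
  normc (u n - l) <= e.

Lemma cauchyC_cvg u :
  (forall e : R, 0 < e -> exists N, forall m n, (N <= m)%N -> (N <= n)%N ->
     normc (u m - u n) <= e) -> exists l, cvgC u l.
Proof.
move=> h.
have [|a ha] := @real_cauchy_cvg (fun n => complex.Re (u n)).
  move=> e /h[N hN]; exists N => m n Nm Nn.
  apply: le_trans (hN _ _ Nm Nn).
  by rewrite -ReN -ReD Re_le_cn.
have [|b hb] := @real_cauchy_cvg (fun n => complex.Im (u n)).
  move=> e /h[N hN]; exists N => m n Nm Nn.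
  apply: le_trans (hN _ _ Nm Nn).
  by rewrite -ImN -ImD Im_le_cn.
exists (a +i* b) => e e0.
have e2 : 0 < e / 2 by rewrite divr_gt0.
have [N1 h1] := ha _ e2; have [N2 h2] := hb _ e2.
exists (maxn N1 N2) => n; rewrite geq_max => /andP[n1 n2].
apply: le_trans (cn_le_ReIm _) _.
rewrite ReD ImD ReN ImN /=.
have := h1 _ n1; have := h2 _ n2; lra.
Qed.

Lemma cvgC_unique u l (m : C) : cvgC u l -> cvgC u m -> l = m.
Proof.
move=> hl hm; apply/eqP; rewrite -subr_eq0 -cn_eq0 eq_le cn_ge0 andbT.
apply/ler_addgt0Pr => e e0; rewrite add0r.
have e2 : 0 < e / 2 by rewrite divr_gt0.
have [N1 h1] := hl _ e2; have [N2 h2] := hm _ e2.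
have := h1 _ (leq_maxl N1 N2); have := h2 _ (leq_maxr N1 N2).
have := cnDB l (u (maxn N1 N2)) m; rewrite (cnBC l (u _)); lra.
Qed.

Lemma cvgC_cst l : cvgC (fun=> l) l.
Proof. by move=> e e0; exists 0%N => n _; rewrite subrr cn0 ltW. Qed.

Lemma cvgC_near u v l : (exists N, forall n, (N <= n)%N -> u n = v n) ->
  cvgC u l -> cvgC v l.
Proof.
move=> [N1 h1] hu e e0; have [N hN] := hu e e0.
exists (maxn N N1) => n; rewrite geq_max => /andP[n1 n2].
by rewrite -h1 // hN.
Qed.

Lemma cvgCD u v l (m : C) : cvgC u l -> cvgC v m -> cvgC (fun n => u n + v n) (l + m).
Proof.
move=> hl hm e e0.
have e2 : 0 < e / 2 by rewrite divr_gt0.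
have [N1 h1] := hl _ e2; have [N2 h2] := hm _ e2.
exists (maxn N1 N2) => n; rewrite geq_max => /andP[n1 n2].
rewrite opprD addrACA; apply: le_trans (cnD _ _) _.
have := h1 _ n1; have := h2 _ n2; lra.
Qed.

Lemma cvgCMl u l (m : C) : cvgC u l -> cvgC (fun n => m * u n) (m * l).
Proof.
move=> hl e e0.
have m1 : 0 < normc m + 1 by rewrite ltr_wpDl // cn_ge0.
have [N hN] := hl (e / (normc m + 1)) (divr_gt0 e0 m1).
exists N => n /hN; rewrite -mulrBr cnM ler_pdivlMr // mulrC mulrDl mul1r.
have := cn_ge0 (u n - l); lra.
Qed.

Lemma cvgC_bound u l : cvgC u l ->
  exists2 M : R, 0 < M & exists N, forall n, (N <= n)%N -> normc (u n) <= M.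
Proof.
move=> /(_ 1 ltr01)[N hN]; exists (normc l + 1); first by rewrite ltr_wpDl // cn_ge0.
exists N => n /hN h; have := cnD (u n - l) l; rewrite subrK; lra.
Qed.

Lemma cvgCM u v l (m : C) : cvgC u l -> cvgC v m -> cvgC (fun n => u n * v n) (l * m).
Proof.
move=> hl hm; have [M M0 [N hN]] := cvgC_bound hl.
move=> e e0.
have e2 : 0 < e / 2 by rewrite divr_gt0.
have [N1 h1] := hm _ (divr_gt0 e2 M0).
have m1 : 0 < normc m + 1 by rewrite ltr_wpDl // cn_ge0.
have [N2 h2] := hl _ (divr_gt0 e2 m1).
exists (maxn N (maxn N1 N2)) => n; rewrite !geq_max => /and3P[n0 n1 n2].
rewrite [X in normc X](_ : _ = u n * (v n - m) + (u n - l) * m); last by ring.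
apply: le_trans (cnD _ _) _; rewrite !cnM.
have a1 : normc (u n) * normc (v n - m) <= e / 2.
  apply: le_trans (ler_wpM2r (cn_ge0 _) (hN _ n0)) _.
  by have := h1 _ n1; rewrite ler_pdivlMr // mulrC.
have a2 : normc (u n - l) * normc m <= e / 2.
  have := h2 _ n2; rewrite ler_pdivlMr // mulrDr mulr1.
  have := cn_ge0 (u n - l); lra.
lra.
Qed.

Lemma cvgC_sum I (s : seq I) (F : I -> nat -> C) (G : I -> C) :
  (forall i, cvgC (F i) (G i)) ->
  cvgC (fun n => \sum_(i <- s) F i n) (\sum_(i <- s) G i).
Proof.
move=> h; elim: s => [|i s IH].
  by rewrite big_nil; under eq_fun do rewrite big_nil; apply: cvgC_cst.
by rewrite big_cons; under eq_fun do rewrite big_cons; apply: cvgCD.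
Qed.

Lemma cvgC_le u l (M : R) : cvgC u l ->
  (exists N, forall n, (N <= n)%N -> normc (u n) <= M) -> normc l <= M.
Proof.
move=> hu [N1 h1]; apply/ler_addgt0Pr => e e0.
have [N hN] := hu e e0; set n := maxn N N1.
have := hN n (leq_maxl _ _); have := h1 n (leq_maxr _ _).
have := cnD (l - u n) (u n); rewrite subrK (cnBC l (u _)); lra.
Qed.

Lemma cvgC_lim_le u v l (m : C) (M : R) : cvgC u l -> cvgC v m ->
  (exists N, forall n, (N <= n)%N -> normc (u n - v n) <= M) -> normc (l - m) <= M.
Proof.
move=> hu hv; apply: cvgC_le.
by apply: cvgCD hu _; rewrite -mulN1r; under eq_fun do rewrite -mulN1r; apply: cvgCMl.
Qed.

Lemma cvgC_P u l : cvgC u l <-> u @ \oo --> l.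
Proof.
split=> [h|h e e0].
  apply/cvgrPdist_le => e e0.
  have re : e = (complex.Re e)%:C by rewrite RRe_real // gtr0_real.
  have /h[N hN] : 0 < complex.Re e by move: e0; rewrite re ltcR.
  exists N => // n /= /hN; rewrite cnBC => hn.
  by rewrite re /Num.norm /= -/(normc _) lecR.
have e0' : (0 : C) < e%:C by rewrite ltcR.
have /cvgrPdist_le /(_ _ e0') [N _ hN] := h.
by exists N => n /hN; rewrite cnBC -lecR.
Qed.

Lemma nbhsC_P (t : C) (U : set C) :
  nbhs t U <-> exists2 r : R, 0 < r & forall s, normc (s - t) < r -> U s.
Proof.
split.
  move=> /nbhs_ballP[e /= e0 h].
  have re : e = (complex.Re e)%:C by rewrite RRe_real // gtr0_real.
  exists (complex.Re e); first by move: e0; rewrite re ltcR.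
  by move=> s hs; apply: h; rewrite -ball_normE /= re ltcR cnBC.
move=> [r r0 h]; apply/nbhs_ballP; exists r%:C; first by rewrite /= ltcR.
by move=> s; rewrite -ball_normE /= ltcR cnBC; exact: h.
Qed.

End Limits.

(** * Localization of the Van Vleck roots *)

Section RootGeometry.
Variable R : realType.
Local Notation C := (Cnum R).
Implicit Types (p q S : {poly C}) (x z c : C).

Lemma poly_rootsE p : exists rs : seq C,
  p = lead_coef p *: \prod_(z <- rs) ('X - z%:P).
Proof. by have [rs] := closed_field_poly_normal (p : {poly R[i]}); exists rs. Qed.

Lemma horner_prod_XsubC (rs : seq C) x :
  (\prod_(z <- rs) ('X - z%:P)).[x] = \prod_(z <- rs) (x - z).
Proof.
elim: rs => [|a r IH]; first by rewrite !big_nil hornerC.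
by rewrite !big_cons hornerM IH !hornerE.
Qed.

Lemma horner_deriv_prod_XsubC (rs : seq C) x : x \notin rs ->
  (\prod_(z <- rs) ('X - z%:P))^`().[x]
    = (\prod_(z <- rs) ('X - z%:P)).[x] * \sum_(z <- rs) (x - z)^-1.
Proof.
elim: rs => [|a r IH]; first by rewrite !big_nil derivC mulr0 horner0.
rewrite inE negb_or => /andP[xa xr].
rewrite !big_cons derivM derivXsubC mul1r hornerD !hornerM IH // hornerXsubC.
have xa0 : x - a != 0 by rewrite subr_eq0.
by field.
Qed.

Lemma size_deriv_char0 p : size p^`() = (size p).-1.
Proof.
have [->|p0] := eqVneq p 0; first by rewrite deriv0 size_poly0.
have [p1|p1] := leqP (size p) 1.
  by rewrite (size1_polyC p1) derivC size_poly0; case: (_ != 0) (size_polyC (p`_0)) => ->.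
rewrite size_poly_eq // prednK ?(leq_trans _ p1) //; last by rewrite -subn1 subn_gt0.
by rewrite mulrn_eq0 -lead_coefE lead_coef_eq0 (negPf p0) orbF -lt0n -subn1 subn_gt0.
Qed.

Lemma size_derivn_char0 p i : size p^`(i) = (size p - i)%N.
Proof.
elim: i => [|i IH]; first by rewrite derivn0 subn0.
by rewrite derivnS size_deriv_char0 IH subnS.
Qed.


Definition roots_within c (r : R) p := forall z, root p z -> normc (z - c) <= r.

(** (x - c) S'(x) / S(x) is the sum of (x - c) / (x - z) over the n zeros z of S, and each term has
    real part at least 1/2 by [Re_div_half]. *)
Lemma deriv_lower_bound S n x c : size S = n.+1 ->
  roots_within c (normc (x - c)) S ->
  n%:R / 2 * normc S.[x] <= normc (x - c) * normc S^`().[x].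
Proof.
move=> sS hS; have [Sx0|Sx0] := eqVneq S.[x] 0.
  by rewrite Sx0 cn0 mulr0 mulr_ge0 ?cn_ge0.
have [rs Srs] := poly_rootsE S.
have l0 : lead_coef S != 0 by rewrite lead_coef_eq0 -size_poly_eq0 sS.
have szrs : size rs = n.
  by move: sS; rewrite Srs size_scale // size_prod_XsubC => -[].
have rootE z : root S z = (z \in rs) by rewrite Srs rootZ // root_prod_XsubC.
have xrs : x \notin rs by rewrite -rootE.
have dE : (x - c) * S^`().[x] = S.[x] * \sum_(z <- rs) (x - c) / (x - z).
  rewrite [in LHS]Srs [in RHS]Srs derivZ !hornerZ horner_deriv_prod_XsubC //.
  rewrite -mulr_sumr; ring.
rewrite -cnM dE cnM mulrC ler_wpM2l ?cn_ge0 //.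
apply: le_trans (le_trans (ler_norm _) (Re_le_cn _)).
rewrite Re_sum -szrs -sum1_size natr_sum mulr_suml.
rewrite big_seq [leRHS]big_seq; apply: ler_sum => z zrs.
rewrite mul1r (_ : x - z = (x - c) - (z - c)); last by ring.
apply: Re_div_half; first by apply: hS; rewrite rootE.
by apply: contraNneq xrs => /addIr ->.
Qed.

(** The Gauss-Lucas theorem for a disc: at a point x outside it [deriv_lower_bound] applies and
    keeps S'(x) away from 0. *)
Lemma roots_within_deriv S n c (r : R) : size S = n.+2 ->
  roots_within c r S -> roots_within c r S^`().
Proof.
move=> sS hS x /rootP dx; rewrite leNgt; apply/negP => xr.
have hSx : roots_within c (normc (x - c)) S.
  by move=> z /hS zr; apply: le_trans zr (ltW xr).
have Sx : ~~ root S x by apply/negP => /hS; rewrite leNgt xr.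
have := deriv_lower_bound sS hSx.
rewrite dx cn0 mulr0 leNgt mulr_gt0 ?divr_gt0 ?ltr0n //.
by rewrite cn_gt0.
Qed.

Lemma roots_within_derivn S n i c (r : R) : size S = n.+1 -> (i <= n)%N ->
  roots_within c r S -> roots_within c r S^`(i).
Proof.
move=> sS; elim: i => [|i IH] lin hS; first by rewrite derivn0.
rewrite derivnS; apply: (@roots_within_deriv _ (n - i.+1)); last first.
  by apply: IH hS; apply: ltnW.
by rewrite size_derivn_char0 sS subSn ?(ltnW lin) // subnSK.
Qed.

(** [deriv_lower_bound] is iterated from S^(i) to S^(k). Gauss-Lucas keeps the zeros in the disc,
    and every derivative met has degree at least n - k. *)
Lemma derivn_lower_bound S n k i x c : size S = n.+1 ->
  roots_within c (normc (x - c)) S -> (i <= k)%N -> (k < n)%N ->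
  ((n - k)%:R / 2) ^+ (k - i) * normc S^`(i).[x]
    <= normc (x - c) ^+ (k - i) * normc S^`(k).[x].
Proof.
move=> sS hS ik kn; have [d] : exists d, d = (k - i)%N by eexists.
elim: d i ik => [|d IH] i ik dE.
  have -> : i = k by apply/eqP; rewrite eqn_leq ik -subn_eq0 -dE.
  by rewrite subnn !expr0.
have ltik : (i < k)%N by rewrite -subn_gt0 -dE.
have dE' : d = (k - i.+1)%N by rewrite subnS -dE.
rewrite -dE !exprS; have := IH _ ltik dE'; rewrite -dE' => {}IH.
have h1 : (n - k)%:R / 2 * normc S^`(i).[x] <= normc (x - c) * normc S^`(i.+1).[x].
  have lin : (i <= n)%N := leq_trans ik (ltnW kn).
  have sSi : size S^`(i) = (n - i).+1 by rewrite size_derivn_char0 sS subSn.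
  have := deriv_lower_bound sSi (roots_within_derivn sS lin hS).
  rewrite derivnS; apply: le_trans.
  apply: ler_wpM2r; first exact: cn_ge0.
  by rewrite ler_pM2r ?invr_gt0 // ler_nat leq_sub2l.
apply: (@le_trans _ _ (((n - k)%:R / 2) ^+ d * (normc (x - c) * normc S^`(i.+1).[x]))).
  rewrite [leLHS](_ : _ = ((n - k)%:R / 2) ^+ d * ((n - k)%:R / 2 * normc S^`(i).[x])); last by ring.
  by apply: ler_wpM2l h1; rewrite exprn_ge0 // divr_ge0.
rewrite mulrCA -mulrA; apply: ler_wpM2l => //; exact: cn_ge0.
Qed.

Lemma poly_growth p d c (r : R) : 0 < r -> (size p <= d.+1)%N ->
  exists2 M : R, 0 <= M & forall x, r <= normc (x - c) ->
    normc p.[x] <= M * normc (x - c) ^+ d.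
Proof.
move=> r0 sp; pose q := p \Po ('X + c%:P).
have qE x : p.[x] = q.[x - c] by rewrite horner_comp !hornerE subrK.
have sq : (size q <= d.+1)%N by rewrite size_comp_poly2 // size_XaddC.
(* In powers of x - c, a term of degree j <= d is compared with degree d through |x - c| ^ j <= r ^
   j / r ^ d * |x - c| ^ d, valid for |x - c| >= r. *)
exists (\sum_(j < d.+1) normc q`_j * r ^+ j / r ^+ d).
  by apply: sumr_ge0 => j _; rewrite divr_ge0 ?mulr_ge0 ?cn_ge0 ?exprn_ge0 ?ltW.
move=> x hx; rewrite qE (horner_coef_wide _ sq) mulr_suml.
apply: cn_sum_le => j _; rewrite cnM cnX.
set y := normc (x - c) in hx *.
have jd : (j <= d)%N by rewrite -ltnS.
have y0 : 0 < y by apply: lt_le_trans hx.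
rewrite -!mulrA ler_wpM2l ?cn_ge0 //.
move: (nat_of_ord j) jd => i id.
rewrite mulrA mulrAC ler_pdivlMr ?exprn_gt0 //.
rewrite -(subnKC id) !exprD mulrA [leRHS]mulrCA [leRHS]mulrA.
apply: ler_wpM2l; first by rewrite mulr_ge0 ?exprn_ge0 ?ltW.
by rewrite lerXn2r // nnegrE ltW.
Qed.

End RootGeometry.

Section Localization.
Variable R : realType.
Local Notation C := (Cnum R).
Variables (k : nat) (Q : nat -> {poly C}).
Hypothesis k_gt0 : (0 < k)%N.
Hypothesis hQ : high_order_heun k Q.
Implicit Types (S V : {poly C}) (x z c : C).

Lemma heun_op_top S : heun_op k Q S =
  Q k * S^`(k) + \sum_(1 <= i < k) Q i * S^`(i).
Proof. by rewrite /heun_op big_nat_recr //= addrC. Qed.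

(** A zero a at distance less than r from c satisfies |x - a| >= (1 - |a - c| / r) |x - c| for |x -
    c| >= r; the factors are multiplied. *)
Lemma lead_lower_bound c (r : R) : 0 < r ->
  (forall z, root (Q k) z -> normc (z - c) < r) ->
  exists2 d : R, 0 < d & forall x, r <= normc (x - c) ->
    d * normc (x - c) ^+ k.+1 <= normc (Q k).[x].
Proof.
move=> r0 hr; have [rs Qrs] := poly_rootsE (Q k).
have Qk0 : Q k != 0 by rewrite -size_poly_eq0 hQ.2.
have l0 : lead_coef (Q k) != 0 by rewrite lead_coef_eq0.
have szrs : size rs = k.+1.
  by have := hQ.2; rewrite Qrs size_scale // size_prod_XsubC => -[].
have inrs z : z \in rs -> normc (z - c) < r.
  by move=> zrs; apply: hr; rewrite Qrs rootZ // root_prod_XsubC.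
have [d d0 hd] : exists2 d : R, 0 < d &
    forall x, r <= normc (x - c) ->
      d * normc (x - c) ^+ size rs <= normc (\prod_(z <- rs) ('X - z%:P)).[x].
  elim: rs inrs {Qrs szrs} => [|a s IH] ins.
    by exists 1 => // x _; rewrite big_nil hornerC cn1 mulr1.
  have [|d d0 hd] := IH; first by move=> z zs; apply: ins; rewrite inE zs orbT.
  have ar := ins a (mem_head _ _).
  exists ((1 - normc (a - c) / r) * d).
    by rewrite mulr_gt0 // subr_gt0 ltr_pdivrMr // mul1r.
  move=> x hx; rewrite big_cons hornerM hornerXsubC cnM /= exprS mulrACA.
  apply: ler_pM (hd x hx).
  - by rewrite mulr_ge0 ?cn_ge0 // subr_ge0 ler_pdivrMr // mul1r ltW.
  - by rewrite mulr_ge0 ?exprn_ge0 ?cn_ge0 // ltW.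
  - have := cn_lowerB (x - c) (a - c); rewrite opprB addrA subrK.
    apply: le_trans; rewrite mulrBl mul1r lerB // mulrAC ler_pdivlMr //.
    by rewrite ler_wpM2l // cn_ge0.
exists (normc (lead_coef (Q k)) * d); first by rewrite mulr_gt0 // cn_gt0.
move=> x hx; rewrite [in leRHS]Qrs hornerZ cnM -mulrA ler_wpM2l ?cn_ge0 //.
by rewrite -szrs hd.
Qed.

(** The condition deg Q_i <= i + 1 turns |x - c| ^ (i + 1) from Q_i and |x - c| ^ (k - i) from
    [derivn_lower_bound] into |x - c| ^ (k + 1), the exact growth of Q_k. Hence the comparison is
    uniform in unbounded x, and each term with i < k loses at least a factor n - k. *)
Lemma heun_op_neq0 c (r : R) : 0 < r ->
  (forall z, root (Q k) z -> normc (z - c) < r) ->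
  exists N, forall n S x, (N <= n)%N -> size S = n.+1 ->
    roots_within c (normc (x - c)) S -> r <= normc (x - c) ->
    S^`(k).[x] != 0 -> (heun_op k Q S).[x] != 0.
Proof.
move=> r0 hr; have [d d0 hd] := lead_lower_bound r0 hr.
have hM (i : nat) : exists M : R, 0 <= M /\ ((1 <= i < k)%N -> forall x, r <= normc (x - c) ->
    normc (Q i).[x] <= M * normc (x - c) ^+ i.+1).
  have [ik|] := boolP (1 <= i < k)%N; last by exists 0.
  have [|M M0 hM] := @poly_growth R (Q i) i.+1 c r r0.
    by apply: hQ.1; case/andP: ik => -> /ltnW ->.
  by exists M.
have [M /all_and2[M0 hMb]] := choice hM.
pose B := \sum_(1 <= i < k) M i * 2 ^+ k.
have B0 : 0 <= B by apply: sumr_ge0 => i _; rewrite mulr_ge0 // exprn_ge0.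
(* The lower terms amount to at most B / (n - k) against d, and n - k will exceed N. *)
have [N hN] : exists N, B / d < N%:R.
  by exists (Num.bound (B / d)); apply: archi_boundP; rewrite divr_ge0 // ltW.
exists (k + N).+1 => n S x Nn sS hS hx Skx.
have kn : (k < n)%N by apply: leq_trans Nn; rewrite ltnS leq_addr.
set y := normc (x - c) in hS hx *.
have y0 : 0 < y by apply: lt_le_trans hx.
have nk0 : 0 < (n - k)%:R :> R by rewrite ltr0n subn_gt0.
have nk1 : 1 <= (n - k)%:R :> R by rewrite ler1n subn_gt0.
set A := normc S^`(k).[x].
have A0 : 0 < A by rewrite cn_gt0.
have hi i : (1 <= i < k)%N ->
    normc ((Q i).[x] * S^`(i).[x]) <= M i * 2 ^+ k * (y ^+ k.+1 * A / (n - k)%:R).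
  move=> /[dup] ik /andP[i1 ltik]; rewrite cnM.
  have h := derivn_lower_bound sS hS (ltnW ltik) kn.
  have {h} h : normc S^`(i).[x] <= 2 ^+ k * (y ^+ (k - i) * A) / (n - k)%:R.
    rewrite ler_pdivlMr //.
    have p0 : 0 < ((n - k)%:R / 2 : R) ^+ (k - i) by rewrite exprn_gt0 // divr_gt0.
    apply: le_trans (_ : 2 ^+ k * (((n - k)%:R / 2) ^+ (k - i) * normc S^`(i).[x]) <= _); last first.
      by apply: ler_wpM2l; rewrite ?exprn_ge0.
    rewrite mulrA mulrC ler_wpM2r ?cn_ge0 // expr_div_n mulrCA.
    have {1}-> : (n - k)%:R = (n - k)%:R * 1 :> R by rewrite mulr1.
    apply: ler_pM => //.
      by rewrite -[leLHS]expr1 ler_weXn2l // subn_gt0.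
    rewrite ler_pdivlMr ?exprn_gt0 // mul1r ler_weXn2l //; first by lra.
    exact: leq_subr.
  apply: le_trans (ler_pM (cn_ge0 _) (cn_ge0 _) (hMb i ik x hx) h) _.
  rewrite -/y [y ^+ k.+1](_ : _ = y ^+ i.+1 * y ^+ (k - i)); last first.
    by rewrite -exprD addSn subnKC // ltnW.
  by rewrite le_eqVlt; apply/orP; left; apply/eqP; ring.
rewrite heun_op_top hornerD hornerM horner_sum.
rewrite -cn_gt0; apply: lt_le_trans (cn_lower _ _).
rewrite subr_gt0 cnM.
apply: (@le_lt_trans _ _ (B * (y ^+ k.+1 * A / (n - k)%:R))).
  rewrite /B mulr_suml; apply: le_trans (cn_sum _ _ _) _.
  rewrite big_nat_cond [leRHS]big_nat_cond; apply: ler_sum => i; rewrite andbT => ik.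
  by rewrite hornerM hi.
apply: (@lt_le_trans _ _ (d * y ^+ k.+1 * A)); last first.
  by rewrite ler_wpM2r ?(ltW A0) // hd.
have hB : B < d * (n - k)%:R.
  rewrite mulrC -ltr_pdivrMr //; apply: lt_le_trans hN _.
  by rewrite ler_nat; lia.
rewrite !mulrA ltr_pdivrMr //.
rewrite [ltRHS](_ : _ = d * (n - k)%:R * y ^+ k.+1 * A); last by ring.
by rewrite !ltr_pM2r // exprn_gt0.
Qed.

End Localization.

Section VanVleckLocalization.
Variable R : realType.
Local Notation C := (Cnum R).
Implicit Types (S V : {poly C}) (x z c : C).

Lemma derivn_XsubC_exp (xi : C) p (g : {poly C}) i : (i <= p)%N ->
  exists2 h : {poly C}, ((('X - xi%:P) ^+ p * g)^`(i) = ('X - xi%:P) ^+ (p - i) * h) &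
    h.[xi] = (p ^_ i)%:R * g.[xi].
Proof.
elim: i => [_|i IH ip]; first by exists g; rewrite ?subn0 // ffactn0 mul1r.
have [h hE hxi] := IH (ltnW ip).
exists ((p - i)%:R *: h + ('X - xi%:P) * h^`()).
  rewrite derivnS hE derivM deriv_exp derivXsubC mul1r -[(p - i).-1]/((p - i).-1).
  have -> : (p - i = (p - i.+1).+1)%N by lia.
  by rewrite /= mulrnAl scaler_nat mulrDr mulrnAr exprSr mulrA.
by rewrite !hornerE hxi subrr mul0r addr0 ffactnSr natrM mulrA [_ * (p ^_ i)%:R]mulrC.
Qed.

Lemma max_modulus_mem (s : seq C) c : (0 < size s)%N ->
  exists2 z, z \in s & forall w, w \in s -> normc (w - c) <= normc (z - c).
Proof.
elim: s => // a s IH _; have [->|s0] := eqVneq s [::].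
  by exists a; rewrite ?mem_head // => w; rewrite inE => /eqP ->.
have [|z zs hz] := IH; first by rewrite lt0n size_eq0.
have [az|za] := leP (normc (a - c)) (normc (z - c)).
  by exists z; rewrite ?inE ?zs ?orbT // => w /orP[/eqP ->|/hz].
exists a; rewrite ?mem_head // => w; rewrite inE => /orP[/eqP ->//|/hz h].
exact: le_trans h (ltW za).
Qed.

Variables (k : nat) (Q : nat -> {poly C}).
Hypothesis k_gt0 : (0 < k)%N.
Hypothesis hQ : high_order_heun k Q.

(* xi is a regular point of the differential equation, so a solution vanishing to
   order at least k there would be zero. *)
Lemma heun_solution_regular S V xi : S != 0 -> heun_op k Q S = V * S ->
  (Q k).[xi] != 0 -> exists2 i, (i < k)%N & S^`(i).[xi] != 0.
Proof.
move=> S0 hS Qxi; apply: contrapT => hno.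
have Sz i : (i < k)%N -> S^`(i).[xi] = 0.
  by move=> ik; apply/eqP/negPn/negP => h; apply: hno; exists i.
have [p [g hg SE]] := multiplicity_XsubC S xi.
rewrite S0 /= in hg; rewrite mulrC in SE.
have kp : (k <= p)%N.
  rewrite leqNgt; apply/negP => pk.
  have [h hE hxi] := derivn_XsubC_exp xi g (leqnn p).
  have := Sz p pk; rewrite SE hE subnn expr0 mul1r hxi ffactnn => /eqP.
  by rewrite mulf_eq0 pnatr_eq0 gtn_eqF ?fact_gt0 //= -/(root g xi) (negPf hg).
have [h hE hxi] := derivn_XsubC_exp xi g kp.
have [s hs] : exists s : {poly C}, \sum_(1 <= i < k) Q i * S^`(i) =
    ('X - xi%:P) ^+ (p - k) * (('X - xi%:P) * s).
  rewrite big_nat_cond; elim/big_ind: _ => [|x y [s1 ->] [s2 ->]|i].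
  - by exists 0; rewrite !mulr0.
  - by exists (s1 + s2); rewrite !mulrDr.
  rewrite andbT => /andP[_ ik].
  have [hi hiE _] := derivn_XsubC_exp xi g (ltnW (leq_trans ik kp)).
  exists (Q i * (('X - xi%:P) ^+ (k - i.+1) * hi)).
  rewrite SE hiE (_ : p - i = (p - k) + (k - i.+1).+1)%N; last by lia.
  rewrite exprD exprS; ring.
have X0 : ('X - xi%:P) ^+ (p - k) != 0 :> {poly C} by rewrite expf_neq0 // polyXsubC_eq0.
(* After division by ('X - xi) ^ (p - k) only the leading term survives at xi, giving Q_k(xi) * p (p
   - 1) ... (p - k + 1) * g(xi) = 0, where no factor vanishes. *)
have := hS; rewrite (heun_op_top Q k_gt0) hs SE hE -[p in RHS](subnK kp) exprD.
rewrite [LHS](_ : _ = ('X - xi%:P) ^+ (p - k) * (Q k * h + ('X - xi%:P) * s)); last by ring.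
rewrite [RHS](_ : _ = ('X - xi%:P) ^+ (p - k) * (V * ('X - xi%:P) ^+ k * g)); last by ring.
move=> /(mulfI X0) /(congr1 (fun q => q.[xi])).
rewrite hornerD !hornerM !(horner_exp, hornerXsubC) subrr mul0r addr0.
rewrite expr0n gtn_eqF // mulr0 mul0r hxi => /eqP.
rewrite !mulf_eq0 (negPf Qxi) -/(root g xi) (negPf hg) orbF /=.
by rewrite pnatr_eq0 -leqn0 leqNgt ffact_gt0 kp.
Qed.

(* At a point x such that all zeros of S satisfy |z - c| <= |x - c|, the bounds
   |S^(i)(x)| <= (2 |x - c| / (n - k)) ^ (k - i) * |S^(k)(x)| make the term Q_k S^(k)
   dominate heun_op S for n large. This is applied at a zero of S of largest
   distance to c, and then at the Van Vleck root itself. *)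
Lemma van_vleck_roots_localized c (r : R) : 0 < r ->
  (forall z, root (Q k) z -> normc (z - c) < r) ->
  exists N, forall n z, (N <= n)%N -> z \in van_vleck_roots k Q n ->
    normc (z - c) < r.
Proof.
move=> r0 hr; have [N hN] := heun_op_neq0 k_gt0 hQ r0 hr.
exists (maxn N k.+1) => n z; rewrite geq_max => /andP[Nn kn].
rewrite mem_filter => /andP[/asboolP[_ [S [sS hS]]] _].
set V := _ *: _ in hS.
have {}hS : heun_op k Q S = - V * S by rewrite mulNr; apply/eqP; rewrite -addr_eq0 hS.
have S0 : S != 0 by rewrite -size_poly_eq0 sS.
(* A derivative of order below k that does not vanish at x forces S^(k)(x) != 0, as [heun_op_neq0]
   requires. *)
have chain x : roots_within c (normc (x - c)) S ->
    (exists2 i, (i < k)%N & S^`(i).[x] != 0) -> S^`(k).[x] != 0.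
  move=> hx [i ik Six]; have := derivn_lower_bound sS hx (ltnW ik) kn.
  apply: contraTneq => ->; rewrite cn0 mulr0 -ltNge mulr_gt0 ?cn_gt0 //.
  by rewrite exprn_gt0 // divr_gt0 // ltr0n subn_gt0.
have [rs Srs] := poly_rootsE S.
have l0 : lead_coef S != 0 by rewrite lead_coef_eq0.
have szrs : size rs = n.
  by move: sS; rewrite Srs size_scale // size_prod_XsubC => -[].
have rootE x : root S x = (x \in rs) by rewrite Srs rootZ // root_prod_XsubC.
have [|xi xirs hxi] := @max_modulus_mem rs c; first by rewrite szrs (leq_trans _ kn).
have hSxi : roots_within c (normc (xi - c)) S by move=> x; rewrite rootE => /hxi.
have xir : normc (xi - c) < r.
  rewrite ltNge; apply/negP => rxi.
  have Qxi : (Q k).[xi] != 0.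
    by apply: contraTneq rxi => /rootP/hr; rewrite -ltNge.
  (* At a zero of S the equation gives [heun_op] S = - V S = 0, against [heun_op_neq0]. *)
  have := hN n S xi Nn sS hSxi rxi (chain _ hSxi (heun_solution_regular S0 hS Qxi)).
  have /rootP Sxi : root S xi by rewrite rootE.
  by rewrite hS hornerM Sxi mulr0 eqxx.
rewrite ltNge; apply/negP => rz.
have hSz : roots_within c (normc (z - c)) S.
  by move=> x /hSxi h; apply: le_trans h (le_trans (ltW xir) rz).
have Sz : S.[z] != 0.
  by apply/negP => /eqP/rootP/hSxi; rewrite leNgt (lt_le_trans xir rz).
(* At the Van Vleck root z it is V that vanishes, with the same contradiction. *)
have := hN n S z Nn sS hSz rz (chain _ hSz (ex_intro2 _ _ 0%N k_gt0 Sz)).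
by rewrite hS hornerM /V !hornerE subrr mulr0 oppr0 mul0r eqxx.
Qed.

End VanVleckLocalization.

(** * A recurrence for the characteristic polynomials *)

Section Hessenberg.
Variable A : comNzRingType.
Variable h : nat -> nat -> A.
Hypothesis hessenberg : forall i j, (i.+1 < j)%N -> h i j = 0.

Definition leading_minor m : A := \det (\matrix_(i < m, j < m) h i j).

(** A leading minor with arbitrary last row x. Expansion along the last column removes the row
    before x and keeps x, so the induction needs this row to be free. *)
Let bordered m (x : nat -> A) : A :=
  \det (\matrix_(i < m.+1, j < m.+1) (if (i < m)%N then h i j else x j)).

Let borderedS m x : bordered m.+1 x =
  x m.+1 * leading_minor m.+1 - h m m.+1 * bordered m x.
Proof.
rewrite /bordered (expand_det_col _ ord_max).
rewrite !big_ord_recr /= big1 ?add0r => [|i _]; last first.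
  by rewrite !mxE /= ltnS ifT ?hessenberg ?mul0r // ?ltnS ?ltn_ord // ltnW.
rewrite !mxE /= ltnn leqnn addrC; congr (_ + _).
  rewrite /cofactor -signr_odd addnn odd_double expr0 mul1r; congr (_ * \det _).
  apply/matrixP => i j; rewrite !mxE /= /bump [(_ <= i)%N]leqNgt [(_ <= j)%N]leqNgt !ltn_ord.
  by rewrite !add0n.
rewrite -mulrN; congr (_ * _).
rewrite /cofactor -signr_odd /= addnS addnn /= odd_double expr1 mulN1r; congr (- \det _).
apply/matrixP => i j; rewrite !mxE /= /bump [(m.+1 <= j)%N]leqNgt ltn_ord add0n.
have [mi|im] := leqP m i; last by rewrite add0n ltnS (ltnW im).
by rewrite add1n ltnS ltnNge mi.
Qed.

(** In the last column of a Hessenberg matrix only the last two entries can be nonzero; this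
    two-term expansion, [borderedS], is unrolled down to size 1. *)
Lemma leading_minorS m : leading_minor m.+1 = \sum_(r < m.+1)
  (-1) ^+ r * h m (m - r) * \prod_(m - r <= l < m) h l l.+1 * leading_minor (m - r).
Proof.
have main x : bordered m x = \sum_(r < m.+1)
  (-1) ^+ r * x (m - r)%N * \prod_(m - r <= l < m) h l l.+1 * leading_minor (m - r).
  elim: m x => [|m IH] x.
    rewrite /bordered big_ord1 expr0 mul1r subnn big_geq // mulr1.
    by rewrite /leading_minor det_mx00 mulr1 (mx11_scalar (matrix_of_fun _ _)) det_scalar1 mxE.
  rewrite borderedS IH [RHS]big_ord_recl expr0 mul1r subn0 big_geq // mulr1.
  apply: (congr2 +%R) => //.
  rewrite mulr_sumr -sumrN; apply: eq_bigr => r _.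
  rewrite /= subSS exprS; have rm : (m - r <= m)%N by apply: leq_subr.
  by rewrite big_nat_recr //=; ring.
rewrite -main /leading_minor /bordered; congr (\det _); apply/matrixP => i j.
rewrite !mxE; case: ltnP => // mi; congr (h _ _).
by apply/eqP; rewrite eqn_leq mi -ltnS ltn_ord.
Qed.
End Hessenberg.

Section Pencil.
Variable R : realType.
Local Notation C := (Cnum R).
Variables (k : nat) (Q : nat -> {poly C}).
Hypothesis hQ : high_order_heun k Q.
Implicit Types (S V : {poly C}) (x z c : C).
Local Notation lam := (heun_lambda k Q).

(** For r <= m this is the coefficient of X^(m - r) in [heun_op] X^m. The test i < r guards against
    truncated subtraction, where Q_i has no coefficient of index i - r. *)
Definition lower_coef m r : C :=
  \sum_(1 <= i < k.+1) (if (i < r)%N then 0 else (Q i)`_(i - r)) * (m ^_ i)%:R.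

Lemma coef_heun_op_Xn m j : (heun_op k Q 'X^m)`_j =
  \sum_(1 <= i < k.+1) (if (j < m - i)%N then 0 else (Q i)`_(j - (m - i))) * (m ^_ i)%:R.
Proof.
rewrite /heun_op coef_sum; apply: eq_bigr => i _.
by rewrite derivnXn -scaler_nat -scalerAr coefZ coefMXn mulrC.
Qed.

Lemma coef_heun_op_Xn_gt m j : (m.+1 < j)%N -> (heun_op k Q 'X^m)`_j = 0.
Proof.
move=> mj; rewrite coef_heun_op_Xn big_nat_cond big1 // => i.
rewrite andbT => /andP[i1 ik]; have [mi|im] := ltnP m i.
  by rewrite ffact_small // mulr0.
rewrite ifF ?nth_default ?mul0r //; last by lia.
have := hQ.1 i; rewrite i1 -ltnS ik => /(_ isT) h; apply: leq_trans h _; lia.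
Qed.

Lemma coef_heun_op_XnS m : (heun_op k Q 'X^m)`_m.+1 = lam m.
Proof.
rewrite coef_heun_op_Xn; apply: eq_bigr => i _; have [mi|im] := ltnP m i.
  by rewrite ffact_small // !mulr0.
by rewrite ifF; [congr (_`_ _ * _)|]; lia.
Qed.

Lemma coef_heun_op_Xn_lower m r : (r <= m)%N ->
  (heun_op k Q 'X^m)`_(m - r) = lower_coef m r.
Proof.
move=> rm; rewrite coef_heun_op_Xn; apply: eq_bigr => i _; have [mi|im] := ltnP m i.
  by rewrite ffact_small // !mulr0.
have [ir|ri] := ltnP i r; first by rewrite ifT //; lia.
by rewrite ifF; [congr (_`_ _ * _)|]; lia.
Qed.

Lemma heun_op_linear (I : Type) (s : seq I) (a : I -> C) (F : I -> {poly C}) :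
  heun_op k Q (\sum_(i <- s) a i *: F i) = \sum_(i <- s) a i *: heun_op k Q (F i).
Proof.
elim: s => [|x s IH].
  by rewrite !big_nil /heun_op big1 // => i _; rewrite linear0 mulr0.
rewrite !big_cons -IH /heun_op scaler_sumr -big_split /=.
by apply: eq_bigr => i _; rewrite linearD linearZ /= mulrDr scalerAr.
Qed.

Lemma heun_opE S n : (size S <= n)%N ->
  heun_op k Q S = \sum_(m < n) S`_m *: heun_op k Q 'X^m.
Proof.
move=> sS; have {1}-> : S = \poly_(i < n) S`_i.
  apply/polyP => i; rewrite coef_poly; case: ltnP => // ni.
  by rewrite nth_default // (leq_trans sS ni).
by rewrite poly_def heun_op_linear.
Qed.

Lemma coef_heun_op_lead S m : (size S <= m.+1)%N ->
  (heun_op k Q S)`_m.+1 = lam m * S`_m.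
Proof.
move=> sS; rewrite (heun_opE sS) coef_sum big_ord_recr /= big1 ?add0r.
  by rewrite coefZ coef_heun_op_XnS mulrC.
by move=> i _; rewrite coefZ coef_heun_op_Xn_gt ?mulr0 // ltnS.
Qed.

Lemma coef_heun_op_gt S m j : (size S <= m.+1)%N -> (m.+1 < j)%N ->
  (heun_op k Q S)`_j = 0.
Proof.
move=> sS mj; rewrite (heun_opE sS) coef_sum big1 // => i _.
rewrite coefZ coef_heun_op_Xn_gt ?mulr0 //.
by apply: leq_ltn_trans mj; exact: ltn_ord.
Qed.

Section Degree.
Variable n : nat.
Hypothesis lam_neq0 : lam n != 0.

Lemma coef_pencil_op_lead S m : (size S <= m.+1)%N ->
  (pencil_op k Q n S)`_m.+1 = (1 - lam m / lam n) * S`_m.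
Proof.
move=> sS; rewrite coefB coefXM coefZ coef_heun_op_lead //=; ring.
Qed.

(** The factor 1 / [lam n] is chosen to cancel degree n + 1: by [coef_pencil_op_lead] that
    coefficient carries 1 - lam n / lam n. *)
Lemma size_pencil_op S : (size S <= n.+1)%N -> (size (pencil_op k Q n S) <= n.+1)%N.
Proof.
move=> sS; apply/leq_sizeP => j; rewrite leq_eqVlt => /orP[/eqP <-|nj].
  by rewrite coef_pencil_op_lead // divff // subrr mul0r.
rewrite coefB coefXM coefZ (coef_heun_op_gt sS nj) mulr0 subr0.
case: j nj => // j nj /=; rewrite nth_default //; exact: leq_trans sS nj.
Qed.

Lemma pencil_mxE (i j : 'I_n.+1) :
  pencil_mx k Q n i j = (pencil_op k Q n 'X^i)`_j.
Proof.
rewrite /pencil_mx mxE /= mxE; congr (pencil_op k Q n _)`_ _.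
by rewrite rVpoly_delta.
Qed.

Lemma pencil_op_linear (I : Type) (s : seq I) (a : I -> C) (F : I -> {poly C}) :
  pencil_op k Q n (\sum_(i <- s) a i *: F i)
    = \sum_(i <- s) a i *: pencil_op k Q n (F i).
Proof.
rewrite /pencil_op heun_op_linear mulr_sumr scaler_sumr -sumrB.
by apply: eq_bigr => i _; rewrite scalerBr -scalerAr !scalerA [_ * a i]mulrC.
Qed.

Lemma rVpoly_sum (v : 'rV[C]_n.+1) : rVpoly v = \sum_i v 0 i *: 'X^i.
Proof.
rewrite {1}(row_sum_delta v) linear_sum; apply: eq_bigr => i _.
by rewrite linearZ /= rVpoly_delta.
Qed.

Lemma rVpoly_mul_pencil_mx (v : 'rV[C]_n.+1) :
  rVpoly (v *m pencil_mx k Q n) = pencil_op k Q n (rVpoly v).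
Proof.
have sv : (size (rVpoly v) <= n.+1)%N by apply: size_poly.
apply/polyP => j; rewrite coef_rVpoly; case: insubP => [i _ <-|]; last first.
  by rewrite -leqNgt => nj; rewrite nth_default // (leq_trans (size_pencil_op sv)).
rewrite mxE rVpoly_sum pencil_op_linear coef_sum; apply: eq_bigr => l _.
by rewrite pencil_mxE coefZ.
Qed.

Hypothesis lam_inj : forall m, (m < n)%N -> lam m != lam n.

(** An eigenvector S of degree m < n would give, in degree m + 1 of the eigenvalue equation, (1 -
    lam m / lam n) S_m = 0, against [lam_inj]. *)
Lemma pencil_eigenvalue_van_vleck z : root (char_poly (pencil_mx k Q n)) z ->
  van_vleck k Q n (- lam n *: ('X - z%:P)).
Proof.
rewrite -eigenvalue_root_char => /eigenvalueP[v vz v0]; split.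
  by rewrite (leq_trans (size_scale_leq _ _)) // size_XsubC.
pose S := rVpoly v.
have S0 : S != 0.
  by apply: contraNneq v0 => h; rewrite -(rVpolyK v) -/S h linear0.
have hS : pencil_op k Q n S = z *: S by rewrite -rVpoly_mul_pencil_mx vz linearZ.
have sS : (size S <= n.+1)%N by apply: size_poly.
exists S; split.
  apply/eqP; rewrite eqn_leq sS /= ltnNge; apply/negP => sn.
  have [m mE] : exists m, size S = m.+1.
    by exists (size S).-1; rewrite prednK // size_poly_gt0.
  have mn : (m < n)%N by rewrite -mE.
  have sm : (size S <= m.+1)%N by rewrite mE.
  have := coef_pencil_op_lead sm; rewrite hS coefZ [S`_m.+1]nth_default // mulr0.
  move/esym/eqP; rewrite mulf_eq0 => /orP[|].
    rewrite subr_eq0 eq_sym -(divff lam_neq0) => /eqP /(mulIf (invr_neq0 lam_neq0))/eqP.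
    by rewrite (negPf (lam_inj mn)).
  by rewrite (_ : S`_m = lead_coef S) ?lead_coef_eq0 ?(negPf S0) // lead_coefE mE.
apply: (scalerI (invr_neq0 lam_neq0)); rewrite scaler0 scalerDr -scalerAl scalerA.
rewrite mulrN mulVf // scaleN1r mulrBl -mul_polyC; move: hS.
rewrite /pencil_op => /eqP; rewrite subr_eq => /eqP ->; rewrite -!mul_polyC; ring.
Qed.

Lemma char_poly_prod : char_poly (pencil_mx k Q n) =
  \prod_(z <- pencil_eigenvalues k Q n) ('X - z%:P).
Proof.
rewrite /pencil_eigenvalues; case: closed_field_poly_normal => rs /= {1}->.
rewrite (_ : lead_coef _ = 1) ?scale1r //.
exact: (eqP (char_poly_monic _)).
Qed.

Lemma van_vleck_roots_full : van_vleck_roots k Q n = pencil_eigenvalues k Q n.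
Proof.
apply/all_filterP/allP => z zrs; apply/asboolP/pencil_eigenvalue_van_vleck.
by rewrite char_poly_prod root_prod_XsubC.
Qed.

Lemma spectral_poly_char_poly : spectral_poly k Q n = char_poly (pencil_mx k Q n).
Proof. by rewrite char_poly_prod /spectral_poly van_vleck_roots_full. Qed.

Lemma size_van_vleck_roots : size (van_vleck_roots k Q n) = n.+1.
Proof.
have := size_char_poly (pencil_mx k Q n).
by rewrite -spectral_poly_char_poly size_prod_XsubC => -[].
Qed.

(** All sizes m are cut from one array indexed by nat; size n + 1 is the characteristic polynomial
    of the pencil. *)
Definition pencil_minor m : {poly C} :=
  leading_minor (fun i j => (if i == j then 'X else 0) - ((pencil_op k Q n 'X^i)`_j)%:P) m.

(** Minus the entry r places left of the diagonal in row m of the pencil, times the superdiagonal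
    entries of rows m - r, ..., m - 1, as [leading_minorS] combines them. *)
Definition pencil_weight m r : C := (lam n)^-1 * lower_coef m r *
  \prod_(m - r <= l < m) (1 - lam l / lam n).

Lemma char_poly_pencil_minor : char_poly (pencil_mx k Q n) = pencil_minor n.+1.
Proof.
congr (\det _); apply/matrixP => i j; rewrite !mxE /= rVpoly_delta; congr (_ - _).
by rewrite -val_eqE /=; case: eqP.
Qed.

Lemma pencil_minorS m : pencil_minor m.+1 = 'X * pencil_minor m +
  \sum_(r < m.+1) (pencil_weight m r)%:P * pencil_minor (m - r).
Proof.
have sX i : (size ('X^i : {poly C}) <= i.+1)%N by rewrite size_polyXn.
have cS i : (pencil_op k Q n 'X^i)`_i.+1 = 1 - lam i / lam n.
  by rewrite coef_pencil_op_lead // coefXn eqxx mulr1.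
have cl i r : (r <= i)%N ->
    (pencil_op k Q n 'X^i)`_(i - r) = - ((lam n)^-1 * lower_coef i r).
  move=> ri; rewrite coefB coefXM coefZ coef_heun_op_Xn_lower // coefXn.
  case: ifP => h; first by rewrite sub0r.
  by rewrite (_ : _ == _ = false) ?sub0r //; lia.
rewrite /pencil_minor leading_minorS => [|i j ij]; last first.
  rewrite ifF; last by lia.
  rewrite coefB coefXM coefZ coef_heun_op_Xn_gt // mulr0 subr0 coefXn.
  case: ifP => h; first by rewrite subrr.
  by rewrite (_ : _ == _ = false) ?subrr //; lia.
set D := leading_minor _.
rewrite !big_ord_recl /= subn0 !big_geq // expr0 mul1r mulr1 eqxx.
rewrite addrA; congr (_ + _).
  by rewrite -[X in _`_X]subn0 cl // /pencil_weight subn0 big_geq // mulr1 polyCN opprK mulrDl.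
apply: eq_bigr => i _; rewrite /bump /= add1n.
have im : (i.+1 <= m)%N by exact: ltn_ord.
rewrite ifF; last by lia.
rewrite cl // sub0r polyCN opprK /pencil_weight; congr (_ * _).
rewrite (eq_big_nat _ _ (F2 := fun l => -1 * (1 - lam l / lam n)%:P)); last first.
  by move=> l _; rewrite ifF ?cS ?sub0r ?mulN1r //; lia.
rewrite big_split /= prodr_const_nat subKn // [in RHS]polyCM (rmorph_prod (polyC : C -> {poly C})) /=.
(* One sign comes from the Hessenberg expansion, the other from the i + 1 superdiagonal entries of X
   - pencil; they cancel. *)
rewrite [LHS](_ : _ = ((-1) ^+ i.+1 * (-1) ^+ i.+1) *
  (((lam n)^-1 * lower_coef m i.+1)%:P * \prod_(m - i.+1 <= l < m) (1 - lam l / lam n)%:P)).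
  by rewrite -exprD addnn -signr_odd odd_double expr0 mul1r.
by ring.
Qed.

End Degree.
End Pencil.

(** * Distinctness of the values of [heun_lambda] *)

Lemma ffact_sub_le m n i : (m <= n)%N ->
  (n ^_ i <= m ^_ i + (n - m) * (i * n ^ i.-1))%N.
Proof.
move=> mn; elim: i => [|i IH]; first by rewrite !ffactn0.
rewrite !ffactnSr /=.
have h1 : (n ^_ i * (n - i) <= (m ^_ i + (n - m) * (i * n ^ i.-1)) * (n - i))%N.
  by rewrite leq_mul2r IH orbT.
apply: leq_trans h1 _; rewrite mulnDl.
have h2 : (m ^_ i * (n - i) <= m ^_ i * (m - i) + (n - m) * n ^ i)%N.
  have : (m ^_ i * (n - i) <= m ^_ i * (m - i + (n - m)))%N by rewrite leq_mul2l; lia.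
  move=> h; apply: leq_trans h _; rewrite mulnDr leq_add2l mulnC leq_mul2l.
  apply/orP; right; rewrite ffact_prod; apply: leq_trans (_ : \prod_(j < i) n <= _)%N; last first.
    by rewrite prod_nat_const card_ord.
  by apply: leq_prod => j _; apply: leq_trans (leq_subr _ _) mn.
have h3 : ((n - m) * (i * n ^ i.-1) * (n - i) <= (n - m) * (i * n ^ i))%N.
  case: i {IH h2} => [|i]; first by rewrite !mul0n muln0.
  rewrite -!mulnA !leq_mul2l /= expnSr; apply/orP; right.
  by rewrite leq_mul2l leq_subr !orbT.
rewrite mulSn mulnDr; lia.
Qed.

(** With [ffact_sub_le], a discrete mean value theorem: both bounds keep the factor n - m, which
    makes the comparison of lam m and lam n uniform in m < n. *)
Lemma ffact_sub_ge m n k : (m <= n)%N ->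
  (m ^_ k.+1 + (n - m) * n.-1 ^_ k <= n ^_ k.+1)%N.
Proof.
move=> mn; rewrite !ffactnS.
have : (m.-1 ^_ k <= n.-1 ^_ k)%N.
  rewrite !ffact_prod; apply: leq_prod => j _; lia.
have -> : (n * n.-1 ^_ k = m * n.-1 ^_ k + (n - m) * n.-1 ^_ k)%N.
  by rewrite -mulnDl subnKC.
by move=> h; rewrite leq_add2r leq_mul2l h orbT.
Qed.

Section EigenvalueSeparation.
Variable R : realType.
Local Notation C := (Cnum R).
Variables (k : nat) (Q : nat -> {poly C}).
Hypothesis k_gt0 : (0 < k)%N.
Hypothesis Qk_lead : (Q k)`_k.+1 = 1.
Local Notation lam := (heun_lambda k Q).

Lemma heun_lambda_top n : lam n = (n ^_ k)%:R +
  \sum_(1 <= i < k) (Q i)`_i.+1 * (n ^_ i)%:R.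
Proof. by rewrite /heun_lambda big_nat_recr //= Qk_lead mul1r addrC. Qed.

Lemma heun_lambda0 : lam 0%N = 0.
Proof.
rewrite /heun_lambda big_nat_cond big1 // => i; rewrite andbT => /andP[i1 _].
by rewrite ffact_small // mulr0.
Qed.

(** In lam n - lam m the falling factorials of order k contribute at least (n - m) (n / 2) ^ (k -
    1), those of lower order at most (n - m) B n ^ (k - 1) / n. The case m = 0 gives lam n != 0, as
    lam 0 = 0. *)
Lemma heun_lambda_separated : exists N, forall n, (N <= n)%N ->
  lam n != 0 /\ forall m, (m < n)%N -> lam m != lam n.
Proof.
pose B : R := \sum_(1 <= i < k) normc (Q i)`_i.+1 * i%:R.
have B0 : 0 <= B by apply: sumr_ge0 => i _; rewrite mulr_ge0 ?cn_ge0.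
have [N hN] : exists N, B * 2 ^+ k.-1 < N%:R.
  by exists (Num.bound (B * 2 ^+ k.-1)); apply: archi_boundP; rewrite mulr_ge0 ?exprn_ge0.
(* N beats B * 2 ^ (k - 1); the other summand makes each factor n - 1 - j with j < k - 1 at least n
   / 2. *)
exists (N + (2 * k).+1)%N => n Nn.
suff h : forall m, (m < n)%N -> lam m != lam n.
  split=> //; have := h 0%N; rewrite heun_lambda0 eq_sym; apply; lia.
move=> m mn; rewrite eq_sym -subr_eq0 -cn_gt0.
have n0 : 0 < n%:R :> R by rewrite ltr0n; lia.
have nm0 : 0 < (n - m)%:R :> R by rewrite ltr0n subn_gt0.
have ge_top : (n - m)%:R * (n%:R / 2) ^+ k.-1 <= (n ^_ k)%:R - (m ^_ k)%:R :> R.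
  rewrite -natrB; last by rewrite !ffact_prod; apply: leq_prod => j _; lia.
  apply: (@le_trans _ _ ((n - m) * n.-1 ^_ k.-1)%:R); last first.
    by rewrite ler_nat; have := @ffact_sub_ge m n k.-1 (ltnW mn); rewrite prednK //; lia.
  rewrite natrM ler_wpM2l // ffact_prod natr_prod.
  rewrite -[X in _ ^+ X]card_ord -prodr_const; apply: ler_prod => j _.
  rewrite divr_ge0 // ler_pdivrMr // -natrM ler_nat; have := ltn_ord j; lia.
have le_low : normc (\sum_(1 <= i < k) (Q i)`_i.+1 * ((n ^_ i)%:R - (m ^_ i)%:R))
    <= (n - m)%:R * (B * (n%:R ^+ k.-1 / n%:R)).
  apply: le_trans (cn_sum _ _ _) _.
  rewrite mulr_suml mulr_sumr big_nat_cond [leRHS]big_nat_cond.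
  apply: ler_sum => i; rewrite andbT => /andP[i1 ik].
  rewrite cnM -natrB; last by rewrite !ffact_prod; apply: leq_prod => j _; lia.
  rewrite cn_nat.
  rewrite [leRHS](_ : _ = normc (Q i)`_i.+1 *
    ((n - m)%:R * (i%:R * (n%:R ^+ k.-1 / n%:R)))); last by ring.
  rewrite ler_wpM2l ?cn_ge0 //.
  apply: (@le_trans _ _ ((n - m) * (i * n ^ i.-1))%:R).
    by rewrite ler_nat leq_subLR ffact_sub_le // ltnW.
  rewrite !natrM !ler_wpM2l // natrX ler_pdivlMr // -exprSr prednK //.
  by rewrite ler_weXn2l // ?ler1n; lia.
have -> : lam n - lam m = ((n ^_ k)%:R - (m ^_ k)%:R) +
    \sum_(1 <= i < k) (Q i)`_i.+1 * ((n ^_ i)%:R - (m ^_ i)%:R).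
  rewrite !heun_lambda_top; under [in RHS]eq_bigr do rewrite mulrBr.
  by rewrite sumrB; ring.
apply: lt_le_trans (cn_lower _ _); rewrite subr_gt0.
apply: le_lt_trans le_low _.
have hk : (m ^_ k <= n ^_ k)%N by rewrite !ffact_prod; apply: leq_prod => j _; lia.
rewrite -(natrB _ hk) cn_nat (natrB _ hk).
apply: lt_le_trans ge_top; rewrite ltr_pM2l // expr_div_n.
rewrite ltr_pdivlMr ?exprn_gt0 //.
rewrite [ltLHS](_ : _ = B * 2 ^+ k.-1 / n%:R * n%:R ^+ k.-1); last by ring.
rewrite -[ltRHS]mul1r ltr_pM2r ?exprn_gt0 // ltr_pdivrMr // mul1r.
apply: lt_le_trans hN _; rewrite ler_nat; lia.
Qed.

End EigenvalueSeparation.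

(** * Approximation of double arrays, uniform in m <= n *)

Section UniformApprox.
Variable R : realType.
Local Notation C := (Cnum R).
Implicit Types x y : nat -> nat -> C.

(** Here n is the degree that defines the pencil, m the index along the recurrence; the uniformity
    in m <= n is what a recurrence with n + 1 steps requires. *)
Definition uapp x y := forall e : R, 0 < e -> exists N, forall n m,
  (N <= n)%N -> (m <= n)%N -> normc (x n m - y n m) <= e.

Definition ubnd y := exists2 M : R, 0 < M & forall n m, (m <= n)%N -> normc (y n m) <= M.

Lemma uapp_refl y : uapp y y.
Proof. by move=> e e0; exists 0%N => n m _ _; rewrite subrr cn0 ltW. Qed.

Lemma uapp_near x x' y : (exists N, forall n m, (N <= n)%N -> (m <= n)%N -> x n m = x' n m) ->
  uapp x y -> uapp x' y.
Proof.
move=> [N1 h1] h e /h[N hN]; exists (maxn N N1) => n m.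
by rewrite geq_max => /andP[a b] mn; rewrite -h1 // hN.
Qed.

Lemma uapp_eq x x' y : (forall n m, (m <= n)%N -> x n m = x' n m) -> uapp x y -> uapp x' y.
Proof. by move=> h; apply: uapp_near; exists 0%N => n m _; apply: h. Qed.

Lemma uapp_eq2 x x' y y' : (forall n m, (m <= n)%N -> x n m = x' n m) ->
  (forall n m, (m <= n)%N -> y n m = y' n m) -> uapp x y -> uapp x' y'.
Proof.
move=> hx hy h e /h[N hN]; exists N => n m Nn mn.
by rewrite -hx // -hy // hN.
Qed.

Lemma ubnd_eq y y' : (forall n m, (m <= n)%N -> y n m = y' n m) -> ubnd y -> ubnd y'.
Proof. by move=> hy [M M0 h]; exists M => // n m mn; rewrite -hy // h. Qed.

Lemma uappD x y x' y' : uapp x y -> uapp x' y' ->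
  uapp (fun n m => x n m + x' n m) (fun n m => y n m + y' n m).
Proof.
move=> h h' e e0; have e2 : 0 < e / 2 by rewrite divr_gt0.
have [N hN] := h _ e2; have [N' hN'] := h' _ e2.
exists (maxn N N') => n m; rewrite geq_max => /andP[a b] mn.
rewrite opprD addrACA; apply: le_trans (cnD _ _) _.
have := hN _ _ a mn; have := hN' _ _ b mn; lra.
Qed.

Lemma ubndD y y' : ubnd y -> ubnd y' -> ubnd (fun n m => y n m + y' n m).
Proof.
move=> [M M0 h] [M' M0' h']; exists (M + M'); first exact: addr_gt0.
by move=> n m mn; apply: le_trans (cnD _ _) (lerD (h _ _ mn) (h' _ _ mn)).
Qed.

Lemma ubndM y y' : ubnd y -> ubnd y' -> ubnd (fun n m => y n m * y' n m).
Proof.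
move=> [M M0 h] [M' M0' h']; exists (M * M'); first exact: mulr_gt0.
by move=> n m mn; rewrite cnM ler_pM ?cn_ge0 ?h ?h'.
Qed.

Lemma ubnd_cst (c : C) : ubnd (fun _ _ => c).
Proof.
by exists (normc c + 1) => [|n m _]; [rewrite ltr_wpDl ?cn_ge0 | rewrite lerDl].
Qed.

Lemma uappM x y x' y' : uapp x y -> uapp x' y' -> ubnd y -> ubnd y' ->
  uapp (fun n m => x n m * x' n m) (fun n m => y n m * y' n m).
Proof.
move=> h h' [M M0 hM] [M' M0' hM'] e e0.
have e2 : 0 < e / 2 by rewrite divr_gt0.
have M1 : 0 < M + 1 by rewrite addr_gt0.
have [N1 h1] := h _ ltr01.
have [N hN] := h _ (divr_gt0 e2 M0'); have [N' hN'] := h' _ (divr_gt0 e2 M1).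
exists (maxn N1 (maxn N N')) => n m; rewrite !geq_max => /and3P[n1 a b] mn.
rewrite [X in normc X](_ : _ = x n m * (x' n m - y' n m) + (x n m - y n m) * y' n m); last by ring.
apply: le_trans (cnD _ _) _; rewrite !cnM.
have a1 : normc (x n m) * normc (x' n m - y' n m) <= e / 2.
  have xM : normc (x n m) <= M + 1.
    have := cnD (x n m - y n m) (y n m); rewrite subrK.
    have := h1 _ _ n1 mn; have := hM _ _ mn; lra.
  apply: le_trans (ler_pM (cn_ge0 _) (cn_ge0 _) xM (hN' _ _ b mn)) _.
  by rewrite mulrC divfK // gt_eqF.
have a2 : normc (x n m - y n m) * normc (y' n m) <= e / 2.
  apply: le_trans (ler_pM (cn_ge0 _) (cn_ge0 _) (hN _ _ a mn) (hM' _ _ mn)) _.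
  by rewrite divfK // gt_eqF.
lra.
Qed.

Lemma uappMl (c : C) x y : uapp x y -> uapp (fun n m => c * x n m) (fun n m => c * y n m).
Proof.
move=> h e e0; have c1 : 0 < normc c + 1 by rewrite ltr_wpDl ?cn_ge0.
have [N hN] := h _ (divr_gt0 e0 c1); exists N => n m Nn mn.
rewrite -mulrBr cnM; have := hN _ _ Nn mn; rewrite ler_pdivlMr //.
have := cn_ge0 (x n m - y n m); lra.
Qed.

Lemma uapp_prod (I : Type) (s : seq I) (x y : I -> nat -> nat -> C) :
  (forall i, uapp (x i) (y i) /\ ubnd (y i)) ->
  uapp (fun n m => \prod_(i <- s) x i n m) (fun n m => \prod_(i <- s) y i n m) /\
  ubnd (fun n m => \prod_(i <- s) y i n m).
Proof.
move=> h; elim: s => [|i s [IH1 IH2]].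
  split; last by apply: ubnd_eq (ubnd_cst 1) => n m _; rewrite big_nil.
  by apply: uapp_eq (uapp_refl _) => n m _; rewrite !big_nil.
have [h1 h2] := h i.
split.
  by apply: uapp_eq2 (uappM h1 IH1 h2 IH2) => n m _; rewrite big_cons.
by apply: ubnd_eq (ubndM h2 IH2) => n m _; rewrite big_cons.
Qed.

Lemma uapp_sum (I : Type) (s : seq I) (x y : I -> nat -> nat -> C) :
  (forall i, uapp (x i) (y i)) ->
  uapp (fun n m => \sum_(i <- s) x i n m) (fun n m => \sum_(i <- s) y i n m).
Proof.
move=> h; elim: s => [|i s IH].
  by apply: uapp_eq (uapp_refl _) => n m _; rewrite !big_nil.
by apply: uapp_eq2 (uappD (h i) IH) => n m _; rewrite big_cons.
Qed.

Lemma uapp_exp x y i : uapp x y -> ubnd y ->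
  uapp (fun n m => x n m ^+ i) (fun n m => y n m ^+ i) /\ ubnd (fun n m => y n m ^+ i).
Proof.
move=> h hb; have [] := @uapp_prod _ (index_enum 'I_i) (fun=> x) (fun=> y) (fun=> conj h hb).
move=> h1 h2; split; last by apply: ubnd_eq h2 => n m _; rewrite prodr_const card_ord.
by apply: uapp_eq2 h1 => n m _; rewrite prodr_const card_ord.
Qed.

Definition grid : nat -> nat -> C := fun n m => m%:R / n%:R.

Lemma ubnd_grid : ubnd grid.
Proof.
exists 1 => // n m mn; rewrite cnM cnV !cn_nat.
case: n mn => [|n] mn; first by rewrite invr0 mulr0.
by rewrite ler_pdivrMr ?ltr0n // mul1r ler_nat.
Qed.

Lemma uapp_cst_div (c : nat -> nat -> C) (M : R) : 0 < M ->
  (forall n m, (m <= n)%N -> normc (c n m) <= M) -> uapp (fun n m => c n m / n%:R) (fun _ _ => 0).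
Proof.
move=> M0 hc e e0.
have [N hN] : exists N, M / e < N%:R.
  by exists (Num.bound (M / e)); apply: archi_boundP; rewrite divr_ge0 // ltW.
exists N.+1 => n m Nn mn; rewrite subr0 cnM cnV cn_nat ler_pdivrMr ?ltr0n; last by lia.
apply: le_trans (hc _ _ mn) _; rewrite mulrC -ler_pdivrMr // ltW //.
by apply: lt_le_trans hN _; rewrite ler_nat ltnW.
Qed.

Lemma uapp_grid_shift j : uapp (fun n m => (m - j)%:R / n%:R) grid.
Proof.
have h : uapp (fun n m => ((m - j)%:R - m%:R) / n%:R : C) (fun _ _ => 0).
  apply: (@uapp_cst_div (fun n m => (m - j)%:R - m%:R) (j%:R + 1)) => [|n m _]; first by rewrite ltr_wpDl.
  rewrite cnBC; have [jm|mj] := leqP j m.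
    by rewrite natrB // opprB addrC subrK cn_nat lerDl.
  rewrite (eqP (ltnW mj : m - j == 0)%N) subr0 cn_nat ler_wpDr // ler_nat ltnW //.
apply: uapp_eq2 (uappD h (uapp_refl grid)) => n m _; last by rewrite add0r.
by rewrite /grid -mulrDl subrK.
Qed.

(** Each of the i factors m - l - j differs from m by a bounded amount, even when the subtraction is
    truncated, hence by O(1 / n) after division by n. The shift l serves the products of lam (m -
    l). *)
Lemma uapp_ffact l i :
  uapp (fun n m => ((m - l) ^_ i)%:R / n%:R ^+ i) (fun n m => grid n m ^+ i).
Proof.
have [h _] := @uapp_prod _ (index_enum 'I_i) (fun (j : 'I_i) n m => (m - (l + j))%:R / n%:R)
  (fun=> grid) (fun j => conj (@uapp_grid_shift (l + j)) ubnd_grid).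
apply: uapp_eq2 h => n m _; last by rewrite prodr_const card_ord.
rewrite ffact_prod natr_prod big_split /= prodr_const card_ord exprVn.
by congr (_ / _); apply: eq_bigr => j _; rewrite subnDA.
Qed.

Lemma uapp_ffact_low l i k : (i < k)%N ->
  uapp (fun n m => ((m - l) ^_ i)%:R / n%:R ^+ k) (fun _ _ => 0).
Proof.
move=> ik; have : uapp (fun n m => (((m - l) ^_ i)%:R / n%:R ^+ k.-1) / n%:R) (fun _ _ => 0).
  apply: (@uapp_cst_div (fun n m => ((m - l) ^_ i)%:R / n%:R ^+ k.-1) 1) => // n m mn.
  rewrite cnM cnV cnX !cn_nat; case: n mn => [|n] mn.
    rewrite (_ : m = 0)%N; last by lia.
    case: (k.-1) (i) => [|k'] [|i'];
      by rewrite ?ffactn0 ?ffact_small ?expr0 ?invr1 ?mul1r ?mul0r ?expr0n ?invr0.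
  rewrite ler_pdivrMr ?exprn_gt0 ?ltr0n // mul1r -natrX ler_nat.
  apply: (@leq_trans (n.+1 ^ i)%N); last by rewrite leq_pexp2l; lia.
  rewrite ffact_prod; apply: leq_trans (_ : \prod_(j < i) n.+1 <= _)%N; last first.
    by rewrite prod_nat_const card_ord.
  by apply: leq_prod => j _; lia.
apply: uapp_eq => n m _; rewrite -mulrA -invfM -exprSr prednK //; lia.
Qed.

End UniformApprox.

(** * Limits of the recurrence weights *)

Section WeightAsymptotics.
Variable R : realType.
Local Notation C := (Cnum R).
Variables (k : nat) (Q : nat -> {poly C}).
Hypothesis k_gt0 : (0 < k)%N.
Hypothesis Qk_lead : (Q k)`_k.+1 = 1.
Local Notation lam := (heun_lambda k Q).
Local Notation T := (fun n m => grid R n m ^+ k).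

Let ubndT : ubnd T. Proof. exact: (uapp_exp k (uapp_refl _) (ubnd_grid R)).2. Qed.

Lemma uapp_lambda_pow l : uapp (fun n m => lam (m - l) / n%:R ^+ k) T.
Proof.
have h : uapp (fun n m => \sum_(i <- index_iota 1 k)
    (if (i < k)%N then (Q i)`_i.+1 * (((m - l) ^_ i)%:R / n%:R ^+ k) else 0)) (fun _ _ => 0).
  have : uapp (fun n m => \sum_(i <- index_iota 1 k)
    (if (i < k)%N then (Q i)`_i.+1 * (((m - l) ^_ i)%:R / n%:R ^+ k) else 0))
     (fun _ _ => \sum_(i <- index_iota 1 k) 0).
    apply: uapp_sum => i; case ik: (i < k)%N; last exact: uapp_refl.
    have := uappMl ((Q i)`_i.+1) (uapp_ffact_low l ik).
    by apply: uapp_eq2 => // n m _; rewrite mulr0.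
  by apply: uapp_eq2 => // n m _; rewrite big1.
apply: uapp_eq2 (uappD (uapp_ffact l k) h) => n m _; last by rewrite addr0.
rewrite heun_lambda_top // mulrDl; congr (_ + _).
rewrite big_nat_cond mulr_suml -big_nat_cond [LHS]big_nat_cond [RHS]big_nat_cond.
by apply: eq_bigr => i /andP[/andP[_ ik] _]; rewrite ik mulrA.
Qed.

Lemma uapp_pow_lambda : uapp (fun n m => n%:R ^+ k / lam n) (fun _ _ => 1).
Proof.
move=> e e0; have e2 : 0 < e / 2 by rewrite divr_gt0.
have h2 : (0 : R) < 2^-1 by rewrite invr_gt0.
have [N3 h3] := uapp_lambda_pow 0 e2; have [N4 h4] := uapp_lambda_pow 0 h2.
exists (maxn N3 (maxn N4 1)) => n m.
rewrite !geq_max => /and3P[n3 n4 n0] mn.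
have nn0 : n%:R != 0 :> C by rewrite pnatr_eq0 -lt0n.
(* On the diagonal m = n the grid value is 1, so g = lam n / n ^ k tends to 1; the tolerance 1/2
   keeps it away from 0. *)
have := h4 n n n4 (leqnn n); have := h3 n n n3 (leqnn n).
rewrite subn0 {h3 h4} [grid R n n]/grid divff // expr1n.
set g := lam n / _ => hg hg2.
have gl : 2^-1 <= normc g.
  have := cnD (1 - g) g; rewrite !subrK cn1 (cnBC 1); lra.
have g0 : g != 0 by rewrite -cn_gt0; lra.
have l0 : lam n != 0 by apply: contraNneq g0 => h; rewrite /g h mul0r.
have -> : n%:R ^+ k / lam n - 1 = (1 - g) / g.
  by rewrite mulrBl divff // mul1r; congr (_ - _); rewrite /g invf_div.
rewrite cnM cnV ler_pdivrMr; last by lra.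
by rewrite cnBC; have := ler_wpM2l (ltW e0) gl; lra.
Qed.

Lemma uapp_div_lambda x y : uapp (fun n m => x n m / n%:R ^+ k) y -> ubnd y ->
  uapp (fun n m => x n m / lam n) y.
Proof.
move=> h hb; apply: uapp_near (_ : uapp (fun n m => x n m / n%:R ^+ k * (n%:R ^+ k / lam n)) y).
  exists 1%N => n m n1 _; rewrite mulrA divfK // expf_neq0 // pnatr_eq0; lia.
have := uappM h uapp_pow_lambda hb (ubnd_cst 1).
by apply: uapp_eq2 => // n m _; rewrite mulr1.
Qed.

Lemma uapp_lambda_ratio l : uapp (fun n m => lam (m - l) / lam n) T.
Proof. exact: uapp_div_lambda (uapp_lambda_pow l) ubndT. Qed.

(* Limit of pencil_weight n m r as n tends to infinity, Th being (m / n) ^ k. *)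
Definition weight_limit (r : nat) (Th : C) : C :=
  (if (r <= k)%N then (Q k)`_(k - r) else 0) * Th * (1 - Th) ^+ r.

Lemma uapp_lower_coef r : uapp (fun n m => (lam n)^-1 * lower_coef k Q m r)
  (fun n m => (if (r <= k)%N then (Q k)`_(k - r) else 0) * T n m).
Proof.
pose a i := if (i < r)%N then 0 else (Q i)`_(i - r).
have h : uapp (fun n m => \sum_(i <- index_iota 1 k)
    (if (i < k)%N then a i * (((m - 0) ^_ i)%:R / n%:R ^+ k) else 0)) (fun _ _ => 0).
  have : uapp (fun n m => \sum_(i <- index_iota 1 k)
    (if (i < k)%N then a i * (((m - 0) ^_ i)%:R / n%:R ^+ k) else 0))
     (fun _ _ => \sum_(i <- index_iota 1 k) 0).
    apply: uapp_sum => i; case ik: (i < k)%N; last exact: uapp_refl.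
    have := uappMl (a i) (uapp_ffact_low 0 ik).
    by apply: uapp_eq2 => // n m _; rewrite mulr0.
  by apply: uapp_eq2 => // n m _; rewrite big1.
have h' : uapp (fun n m => lower_coef k Q m r / n%:R ^+ k) (fun n m => a k * T n m).
  apply: uapp_eq2 (uappD (uappMl (a k) (uapp_ffact 0 k)) h) => n m _; last by rewrite addr0.
  rewrite /lower_coef big_nat_recr //= addrC [RHS]mulrDl -mulrA subn0; congr (_ + _).
  rewrite mulr_suml big_nat_cond [RHS]big_nat_cond.
  by apply: eq_bigr => i /andP[/andP[_ ik] _]; rewrite ik mulrA.
have := uapp_div_lambda h' (ubndM (ubnd_cst _) ubndT).
apply: uapp_eq2 => n m _; first by rewrite mulrC.
by rewrite /a; case: (ltnP k r).
Qed.

Lemma lower_coef_small m r : (m < r)%N -> lower_coef k Q m r = 0.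
Proof.
move=> mr; rewrite /lower_coef big1 // => i _; case: ltnP => [_|ri]; first by rewrite mul0r.
by rewrite ffact_small ?mulr0 //; apply: leq_trans ri.
Qed.

(** The lower coefficient contributes Theta, and each of the r superdiagonal factors 1 - lam (m - l
    - 1) / lam n contributes 1 - Theta. *)
Lemma uapp_pencil_weight r : uapp (fun n m => pencil_weight k Q n m r)
  (fun n m => weight_limit r (T n m)).
Proof.
have h1 : uapp (fun n m => \prod_(l < r) (1 - lam (m - l.+1) / lam n))
    (fun n m => \prod_(l < r) (1 - T n m)) /\ ubnd (fun n m => \prod_(l < r) (1 - T n m)).
  apply: (@uapp_prod _ _ _ (fun (l : 'I_r) n m => 1 - lam (m - l.+1) / lam n) (fun=> fun n m => 1 - T n m)) => l; split.
    have := uappD (uapp_refl (fun _ _ => 1)) (uappMl (-1) (uapp_lambda_ratio l.+1)).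
    by apply: uapp_eq2 => n m _; rewrite mulN1r.
  have := ubndD (ubnd_cst 1) (ubndM (ubnd_cst (-1)) ubndT).
  by apply: ubnd_eq => n m _; rewrite mulN1r.
have [h2 h3] := h1.
have := uappM (uapp_lower_coef r) h2 (ubndM (ubnd_cst _) ubndT) h3.
apply: uapp_eq2 => n m _; last by rewrite prodr_const card_ord.
rewrite /pencil_weight; have [rm|mr] := leqP r m; last by rewrite lower_coef_small // !mulr0 !mul0r.
congr (_ * _); elim: r rm {h1 h2 h3} => [|r IH] rm; first by rewrite subn0 big_geq // big_ord0.
rewrite big_ord_recr /= IH; last exact: ltnW.
by rewrite [RHS]big_ltn ?subnSK //; [exact: mulrC | lia].
Qed.

End WeightAsymptotics.

(** * Limits of coefficients *)

Section CoefficientExtraction.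
Variable R : realType.
Local Notation C := (Cnum R).
Implicit Types (p q : {poly C}) (s : C).

Lemma sum_geo_le (th : R) J n : 0 <= th -> th < 1 ->
  \sum_(J <= i < n) th ^+ i <= th ^+ J / (1 - th).
Proof.
move=> t0 t1; have d0 : 0 < 1 - th by rewrite subr_gt0.
have [nJ|Jn] := leqP n J; first by rewrite big_geq // divr_ge0 ?exprn_ge0 // ltW.
rewrite ler_pdivlMr // mulrBr mulr1.
have -> : (\sum_(J <= i < n) th ^+ i) * th = \sum_(J.+1 <= i < n.+1) th ^+ i.
  rewrite mulr_suml big_add1 /=; apply: eq_bigr => i _; exact: esym (exprSr _ _).
rewrite big_ltn // [X in _ + _ - X]big_nat_recr //= opprD addrACA.
have := exprn_ge0 n t0; lra.
Qed.

Lemma poly_tail p (M B : R) s (th : R) J : 0 <= M -> 0 <= B ->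
  (forall j, normc p`_j <= M * B ^+ j) -> B * normc s <= th -> th < 1 ->
  normc (p.[s] - \sum_(i < J) p`_i * s ^+ i) <= M * th ^+ J / (1 - th).
Proof.
move=> M0 B0 hp hs th1; have th0 : 0 <= th by apply: le_trans hs; rewrite mulr_ge0 ?cn_ge0.
pose N := maxn J (size p).
have -> : p.[s] - \sum_(i < J) p`_i * s ^+ i = \sum_(J <= i < N) p`_i * s ^+ i.
  rewrite (@horner_coef_wide _ N) ?leq_maxr // -!(big_mkord xpredT (fun i => p`_i * s ^+ i)).
  by apply/eqP; rewrite subr_eq addrC -big_cat_nat ?leq_maxl.
apply: le_trans (_ : \sum_(J <= i < N) M * th ^+ i <= _).
  apply: cn_sum_le => i _; rewrite cnM cnX.
  apply: le_trans (ler_wpM2r _ (hp i)) _; first by rewrite exprn_ge0 ?cn_ge0.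
  rewrite -mulrA -exprMn ler_wpM2l // lerXn2r // nnegrE ?mulr_ge0 ?cn_ge0 //.
by rewrite -mulr_sumr -mulrA ler_wpM2l // sum_geo_le.
Qed.

(** For f = g this is the Cauchy property; for two sequences it also makes their limits agree. *)
Definition cauchy2 (f g : nat -> C) := forall e : R, 0 < e -> exists N, forall n n',
  (N <= n)%N -> (N <= n')%N -> normc (f n - g n') <= e.

(** By induction on j: at a small s the coefficient j of f n - g n' is the value at s, minus the
    lower terms, minus a tail that is O(|s|) relative to s ^ j, all divided by s ^ j. One s is fixed
    first, then n and n' grow. The point 0 is excluded because s will be 1 / t. *)
Lemma cauchy2_coef (f g : nat -> {poly C}) (M B r : R) N0 : 0 <= M -> 0 <= B -> 0 < r ->
  (forall n j, (N0 <= n)%N -> normc (f n)`_j <= M * B ^+ j) ->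
  (forall n j, (N0 <= n)%N -> normc (g n)`_j <= M * B ^+ j) ->
  (forall s, s != 0 -> normc s < r -> cauchy2 (fun n => (f n).[s]) (fun n => (g n).[s])) ->
  forall j, cauchy2 (fun n => (f n)`_j) (fun n => (g n)`_j).
Proof.
move=> M0 B0 r0 hf hg hs; elim/ltn_ind => j IH e e0.
pose K := 4 * M * B ^+ j.+1.
have K0 : 0 <= K by rewrite !mulr_ge0 ?exprn_ge0.
(* The three bounds give x < r, B x <= 1/2 and K x <= e / 2. With K = 4 M B ^ (j + 1), the second
   bounds the tail 2 M (B x) ^ (j + 1) / (1 - B x) by K x * x ^ j, the third by e / 2 * x ^ j. The
   value and the lower terms get e / 4 each. *)
pose x : R := Num.min (r / 2) (Num.min (2^-1 / (B + 1)) (e / 2 / (K + 1))).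
have x0 : 0 < x.
  by rewrite !lt_min !divr_gt0 ?invr_gt0 ?ltr_wpDl.
have xr : x < r by apply: le_lt_trans (_ : r / 2 < r); [rewrite ge_min lexx | lra].
have xB : B * x <= 2^-1.
  have : x <= 2^-1 / (B + 1) by rewrite !ge_min lexx orbT.
  by rewrite ler_pdivlMr ?ltr_wpDl //; lra.
have xK : K * x <= e / 2.
  have : x <= e / 2 / (K + 1) by rewrite !ge_min lexx !orbT.
  by rewrite ler_pdivlMr ?ltr_wpDl //; lra.
pose s : C := x%:C.
have ns : normc s = x by rewrite cn_real gtr0_norm.
have s0 : s != 0 by rewrite -cn_gt0 ns.
have e1 : 0 < e / 4 * x ^+ j by rewrite mulr_gt0 ?exprn_gt0 ?divr_gt0.
have [N1 h1] := hs s s0 (eq_ind_r (fun z => z < r) xr ns) _ e1.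
have e2 : 0 < e / 4 * x ^+ j / j.+1%:R by rewrite divr_gt0.
have [N2 h2] : exists N2, forall i n n', (i < j)%N -> (N2 <= n)%N -> (N2 <= n')%N ->
    normc ((f n)`_i - (g n')`_i) * x ^+ i <= e / 4 * x ^+ j / j.+1%:R.
  have /choice[N2 hN2] : forall i, exists N2, (i < j)%N -> forall n n', (N2 <= n)%N -> (N2 <= n')%N ->
      normc ((f n)`_i - (g n')`_i) * x ^+ i <= e / 4 * x ^+ j / j.+1%:R.
    move=> i; have [ij|_] := ltnP i j; last by exists 0%N.
    have [N2 h] := IH i ij _ (divr_gt0 e2 (exprn_gt0 i x0)).
    by exists N2 => _ n n' a b; rewrite -ler_pdivlMr ?exprn_gt0 // h.
  exists (\max_(i < j) N2 i)%N => i n n' ij a b.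
  have Ni : (N2 i <= \max_(i < j) N2 i)%N by rewrite (@leq_bigmax _ (fun i : 'I_j => N2 i) (Ordinal ij)).
  by apply: hN2 => //; [apply: leq_trans a | apply: leq_trans b].
exists (maxn N0 (maxn N1 N2)) => n n'; rewrite !geq_max => /and3P[a0 a1 a2] /and3P[b0 b1 b2].
pose h := f n - g n'.
have hh i : normc h`_i <= 2 * M * B ^+ i.
  rewrite coefB; apply: le_trans (cnB _ _) _; have := hf n i a0; have := hg n' i b0; lra.
have tail : normc (h.[s] - \sum_(i < j.+1) h`_i * s ^+ i) <= e / 2 * x ^+ j.
  have := @poly_tail h (2 * M) B s (B * x) j.+1 (mulr_ge0 (ler0n _ 2) M0) B0 hh.
  rewrite ns lexx => /(_ isT); rewrite (le_lt_trans xB) => [/(_ isT) h0|]; last by lra.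
  apply: le_trans h0 _; apply: (@le_trans _ _ (K * x * x ^+ j)); last first.
    by rewrite ler_wpM2r // exprn_ge0 // ltW.
  rewrite ler_pdivrMr; last by lra.
  rewrite exprMn -subr_ge0 [X in 0 <= X](_ : _ = M * B ^+ j.+1 * x ^+ j.+1 * (2 - 4 * (B * x))).
    by rewrite mulr_ge0 ?mulr_ge0 ?exprn_ge0 //; [exact: ltW | lra].
  by rewrite /K exprS [x ^+ j.+1]exprS; ring.
have hval : normc h.[s] <= e / 4 * x ^+ j by rewrite hornerD hornerN h1.
have hlow : normc (\sum_(i < j) h`_i * s ^+ i) <= e / 4 * x ^+ j.
  apply: le_trans (_ : \sum_(i < j) e / 4 * x ^+ j / j.+1%:R <= _).
    by apply: cn_sum_le => i _; rewrite cnM cnX ns coefB h2.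
  move: (e / 4 * x ^+ j) e1 => E E0.
  rewrite sumr_const card_ord -[_ *+ j]mulr_natr mulrAC ler_pdivrMr ?ltr0n //.
  by rewrite ler_wpM2l ?(ltW E0) // ler_nat.
have key : normc h`_j * x ^+ j <= e * x ^+ j.
  rewrite big_ord_recr /= in tail.
  have -> : normc h`_j * x ^+ j = normc (h`_j * s ^+ j) by rewrite cnM cnX ns.
  have := cnD (h.[s] - \sum_(i < j) h`_i * s ^+ i)
    (- (h.[s] - (\sum_(i < j) h`_i * s ^+ i + h`_j * s ^+ j))).
  rewrite cnN [X in normc X <= _](_ : _ = h`_j * s ^+ j); last by ring.
  have := cnB h.[s] (\sum_(i < j) h`_i * s ^+ i).
  lra.
by rewrite ler_pM2r ?exprn_gt0 // coefB in key.
Qed.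

(** A substitute for Vitali's theorem: the coefficients converge by [cauchy2_coef], and the tail
    bound, uniform in n, lets n tend to infinity at a fixed truncation J before J does. *)
Lemma poly_limit_series (f : nat -> {poly C}) (F : C -> C) (M B : R) N0 : 0 <= M -> 0 < B ->
  (forall n j, (N0 <= n)%N -> normc (f n)`_j <= M * B ^+ j) ->
  (forall s, normc s < B^-1 -> cvgC (fun n => (f n).[s]) (F s)) ->
  exists c : nat -> C, (forall j, cvgC (fun n => (f n)`_j) (c j)) /\
    forall s, normc s < B^-1 -> cvgC (fun J => \sum_(i < J) c i * s ^+ i) (F s).
Proof.
move=> M0 B0 hf hs; have r0 : 0 < B^-1 by rewrite invr_gt0.
have cau j : cauchy2 (fun n => (f n)`_j) (fun n => (f n)`_j).
  apply: (cauchy2_coef M0 (ltW B0) r0 hf hf) => s _ sr e e0.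
  have e2 : 0 < e / 2 by rewrite divr_gt0.
  have [N hN] := hs s sr _ e2; exists N => n n' a b.
  apply: le_trans (cnDB _ (F s) _) _; rewrite (cnBC (F s)).
  have := hN _ a; have := hN _ b; lra.
have /choice[c hc] : forall j, exists c, cvgC (fun n => (f n)`_j) c.
  by move=> j; apply: cauchyC_cvg => e /(cau j)[N h]; exists N => n n'; apply: h.
exists c; split=> // s sr; set th := B * normc s.
have th1 : th < 1 by rewrite /th mulrC -ltr_pdivlMr // mul1r.
have th0 : 0 <= th by rewrite mulr_ge0 ?cn_ge0 // ltW.
have bound J : normc (\sum_(i < J) c i * s ^+ i - F s) <= M * th ^+ J / (1 - th).
  have h1 : cvgC (fun n => \sum_(i < J) (f n)`_i * s ^+ i) (\sum_(i < J) c i * s ^+ i).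
    apply: cvgC_sum => i; under eq_fun do rewrite mulrC.
    by rewrite mulrC; apply: cvgCMl.
  apply: cvgC_lim_le h1 (hs s sr) _; exists N0 => n Nn; rewrite cnBC.
  exact: (poly_tail J M0 (ltW B0) (fun j => hf n j Nn) (lexx _) th1).
move=> e e0.
have /cvgrPdist_le : (fun J => M * th ^+ J / (1 - th)) @ \oo --> M * 0 / (1 - th).
  apply: cvgMl; apply: cvgMr; apply: cvg_expr; rewrite ger0_norm //.
move=> /(_ e e0)[N _ hN]; exists N => J NJ.
apply: le_trans (bound J) _; have := hN J NJ; rewrite mulr0 mul0r sub0r normrN.
by apply: le_trans; apply: ler_norm.
Qed.

End CoefficientExtraction.

(** * The l1 norm of the coefficients *)

Section CoefficientNorm.
Variable R : realType.
Local Notation C := (Cnum R).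
Implicit Types (p q : {poly C}).

Definition pnorm p : R := \sum_(x <- polyseq p) normc x.

Lemma pnormE p n : (size p <= n)%N -> pnorm p = \sum_(i < n) normc p`_i.
Proof.
move=> sp; rewrite /pnorm (big_nth 0) big_mkord (big_ord_widen n (fun i => normc p`_i) sp).
rewrite [RHS](bigID (fun i : 'I_n => (i < size p)%N)) /= [X in _ + X]big1 ?addr0 // => i.
by rewrite -leqNgt => h; rewrite nth_default // cn0.
Qed.

Lemma pnorm_ge0 p : 0 <= pnorm p.
Proof. by apply: sumr_ge0 => i _; apply: cn_ge0. Qed.

Lemma coef_le_pnorm p i : normc p`_i <= pnorm p.
Proof.
rewrite (pnormE (leq_maxl (size p) i.+1)) (bigD1 (Ordinal (leq_maxr (size p) i.+1))) //=.
by rewrite lerDl sumr_ge0 // => j _; apply: cn_ge0.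
Qed.

Lemma pnormD p q : pnorm (p + q) <= pnorm p + pnorm q.
Proof.
have s1 : (size p <= maxn (size p) (size q))%N by rewrite leq_maxl.
have s2 : (size q <= maxn (size p) (size q))%N by rewrite leq_maxr.
rewrite (pnormE (size_polyD p q)) (pnormE s1) (pnormE s2) -big_split /=.
by apply: ler_sum => i _; rewrite coefD cnD.
Qed.

Lemma pnormZ c p : pnorm (c *: p) = normc c * pnorm p.
Proof.
rewrite (pnormE (size_scale_leq c p)) (pnormE (leqnn _)) mulr_sumr.
by apply: eq_bigr => i _; rewrite coefZ cnM.
Qed.

Lemma pnormN p : pnorm (- p) = pnorm p.
Proof. by rewrite -scaleN1r pnormZ cnN cn1 mul1r. Qed.

Lemma pnormC c : pnorm c%:P = normc c.
Proof. by rewrite (@pnormE _ 1) ?size_polyC_leq1 // big_ord1 coefC. Qed.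

Lemma pnorm_mulX_addC p c : pnorm (p * 'X + c%:P) = pnorm p + normc c.
Proof.
rewrite (@pnormE _ (size p).+1); last by rewrite size_MXaddC; case: ifP.
rewrite big_ord_recl coefD coefMX coefC /= add0r addrC (pnormE (leqnn _)); congr (_ + _).
by apply: eq_bigr => i _; rewrite coefD coefMX coefC /= addr0.
Qed.

Lemma pnorm_mulX p : pnorm (p * 'X) = pnorm p.
Proof. by have := pnorm_mulX_addC p 0; rewrite addr0 cn0 addr0. Qed.

Lemma pnormX : pnorm 'X = 1.
Proof. by rewrite -[in LHS](mul1r 'X) pnorm_mulX -[1]/(1%:P) pnormC cn1. Qed.

Lemma pnormM p q : pnorm (p * q) <= pnorm p * pnorm q.
Proof.
elim/poly_ind: p => [|p c IH]; first by rewrite mul0r /pnorm polyseq0 big_nil mul0r.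
rewrite pnorm_mulX_addC mulrDl mulrAC; apply: le_trans (pnormD _ _) _.
by rewrite pnorm_mulX mul_polyC pnormZ mulrDl lerD2r.
Qed.

Lemma pnormXn p n : pnorm p <= 1 -> pnorm (p ^+ n) <= 1.
Proof.
move=> p1; elim: n => [|n IH]; first by rewrite expr0 -[1]/(1%:P) pnormC cn1.
rewrite exprS; apply: le_trans (pnormM _ _) _.
by rewrite -[leRHS]mulr1; apply: ler_pM; rewrite ?pnorm_ge0.
Qed.

Lemma pnorm_sum (I : Type) (s : seq I) (F : I -> {poly C}) :
  pnorm (\sum_(i <- s) F i) <= \sum_(i <- s) pnorm (F i).
Proof.
elim: s => [|i s IH]; first by rewrite !big_nil /pnorm polyseq0 big_nil.
rewrite !big_cons; apply: le_trans (pnormD _ _) _; by rewrite lerD2l.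
Qed.
End CoefficientNorm.

Lemma cvgCB (R : realType) (u v : nat -> Cnum R) l l' : cvgC u l -> cvgC v l' ->
  cvgC (fun n => u n - v n) (l - l').
Proof.
move=> hu hv; apply: cvgCD hu _; rewrite -mulN1r.
by under eq_fun do rewrite -mulN1r; apply: cvgCMl.
Qed.

(** * The limiting algebraic equation *)

Section SymbolInverse.
Variable R : realType.
Local Notation C := (Cnum R).
Variables (k : nat) (B : R).
Hypothesis B0 : 0 <= B.
Implicit Types (b : nat -> C) (t y z s : C).

Definition sym b y : C := \sum_(r < k) b r * y ^+ r.
Definition bnd b := forall r, normc (b r) <= B.
Let W : R := k%:R * B.
Let L : R := k%:R * (k%:R * B).
(** W bounds [sym b] on the unit disc and L is a Lipschitz constant there; the factor 8 leaves room
    for the approximate recurrences. *)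
Definition far : R := 8 * (1 + W + L).

Let W0 : 0 <= W. Proof. by rewrite mulr_ge0. Qed.
Let L0 : 0 <= L. Proof. by rewrite !mulr_ge0. Qed.

Lemma exp_le1 y r : normc y <= 1 -> normc (y ^+ r) <= 1.
Proof. by move=> y1; rewrite cnX exprn_ile1 // cn_ge0. Qed.

Lemma sym_le b y : bnd b -> normc y <= 1 -> normc (sym b y) <= W.
Proof.
move=> hb y1; apply: le_trans (_ : \sum_(r < k) B <= _); last first.
  by rewrite sumr_const card_ord -[_ *+ k]mulr_natl.
apply: cn_sum_le => r _; rewrite cnM -[leRHS]mulr1.
by apply: ler_pM; rewrite ?cn_ge0 ?exp_le1.
Qed.

Lemma exp_lip y z r : normc y <= 1 -> normc z <= 1 ->
  normc (y ^+ r - z ^+ r) <= r%:R * normc (y - z).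
Proof.
move=> y1 z1; rewrite subrXX cnM mulrC ler_wpM2r ?cn_ge0 //.
apply: le_trans (_ : \sum_(i < r) 1 <= _); last by rewrite sumr_const card_ord.
apply: cn_sum_le => i _; rewrite cnM -[leRHS]mulr1.
by apply: ler_pM; rewrite ?cn_ge0 ?exp_le1.
Qed.

Lemma sym_lip b y z : bnd b -> normc y <= 1 -> normc z <= 1 ->
  normc (sym b y - sym b z) <= L * normc (y - z).
Proof.
move=> hb y1 z1; rewrite /sym -sumrB.
apply: le_trans (_ : \sum_(r < k) k%:R * B * normc (y - z) <= _); last first.
  by rewrite sumr_const card_ord -[_ *+ k]mulr_natl mulrA.
apply: cn_sum_le => r _; rewrite -mulrBr cnM mulrC.
rewrite [leRHS]mulrAC; apply: ler_pM; rewrite ?cn_ge0 //.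
apply: le_trans (exp_lip r y1 z1) _; rewrite ler_wpM2r ?cn_ge0 // ler_nat ltnW //.
Qed.

Lemma sym_diff b b' y (d : R) : (forall r, normc (b r - b' r) <= d) -> normc y <= 1 ->
  normc (sym b y - sym b' y) <= k%:R * d.
Proof.
move=> hb y1; rewrite /sym -sumrB; apply: le_trans (_ : \sum_(r < k) d <= _); last first.
  by rewrite sumr_const card_ord -[_ *+ k]mulr_natl.
apply: cn_sum_le => r _; rewrite -mulrBl cnM -[leRHS]mulr1.
by apply: ler_pM; rewrite ?cn_ge0 ?exp_le1.
Qed.

(** With y = 1 / Psi this is Psi = t + sym b (1 / Psi), and |y| <= 1 selects the branch near t among
    the roots. *)
Definition small_root b t y := normc y <= 1 /\ y * (t + sym b y) = 1.

Lemma far_ge8 : 8 <= far. Proof. by rewrite /far; move: W0 L0; lra. Qed.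

Lemma small_root_le b t y : bnd b -> far < normc t -> small_root b t y ->
  y != 0 /\ normc y * normc t <= 2.
Proof.
move=> hb ht [y1 hy]; split.
  by apply/eqP => h; move/eqP: hy; rewrite h mul0r eq_sym oner_eq0.
have := congr1 (@normc R) hy; rewrite cnM cn1 => h.
have := cn_lower t (sym b y); have := sym_le hb y1; rewrite -/W => hs hl.
have := ler_wpM2l (cn_ge0 y) hl; rewrite h mulrBr.
have : normc y * normc (sym b y) <= 1 * W by apply: ler_pM; rewrite ?cn_ge0.
have : 8 * W * normc y <= normc y * normc t.
  by rewrite mulrC ler_wpM2l ?cn_ge0 //; move: ht W0 L0; rewrite /far; lra.
have := ler_wpM2l (cn_ge0 y) hs.
lra.
Qed.

Lemma mulsym_lip b y z : bnd b -> normc y <= 1 -> normc z <= 1 ->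
  normc (y * sym b y - z * sym b z) <= (W + L) * normc (y - z).
Proof.
move=> hb y1 z1.
rewrite [X in normc X](_ : _ = (y - z) * sym b y + z * (sym b y - sym b z)); last by ring.
apply: le_trans (cnD _ _) _; rewrite !cnM mulrDl; apply: lerD.
  by rewrite mulrC ler_wpM2r ?cn_ge0 // sym_le.
rewrite -[leRHS]mul1r; apply: ler_pM; rewrite ?cn_ge0 //; exact: sym_lip.
Qed.

(** Subtracting the equations gives t (y - z) = - (y sym y - z sym z), whose right side is Lipschitz
    with constant W + L, less than |t|. *)
Lemma small_root_unique b t y z : bnd b -> far < normc t ->
  small_root b t y -> small_root b t z -> y = z.
Proof.
move=> hb ht [y1 hy] [z1 hz]; apply/eqP; rewrite -subr_eq0 -cn_eq0.
have : normc t * normc (y - z) <= (W + L) * normc (y - z).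
  rewrite -cnM (_ : t * (y - z) = - (y * sym b y - z * sym b z)) ?cnN ?mulsym_lip //.
  have -> : y * sym b y = 1 - y * t by rewrite -hy; ring.
  have -> : z * sym b z = 1 - z * t by rewrite -hz; ring.
  by ring.
move=> h; rewrite eq_le cn_ge0 andbT.
have : 0 <= (normc t - (W + L) - 1) * normc (y - z).
  by rewrite mulr_ge0 ?cn_ge0 //; move: ht W0 L0; rewrite /far; lra.
lra.
Qed.

Section Iteration.
Variables (b : nat -> C) (t0 : C).
Hypotheses (hb : bnd b) (ht0 : far < normc t0).

(* The iterates are polynomials in s = t - t0; their coefficient norm stays bounded,
   so that the root of y * (t + sym b y) = 1 is analytic in t. *)
Definition psym (p : {poly C}) : {poly C} := \sum_(r < k) b r *: p ^+ r.

Fixpoint root_iter n : {poly C} := if n is n'.+1 then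
  t0^-1 *: (1 - root_iter n' * ('X + psym (root_iter n'))) else 0.

Lemma pnorm_psym p : pnorm p <= 1 -> pnorm (psym p) <= W.
Proof.
move=> p1; apply: le_trans (pnorm_sum _ _) _.
apply: le_trans (_ : \sum_(r < k) B <= _); last first.
  by rewrite sumr_const card_ord -[_ *+ k]mulr_natl.
apply: ler_sum => r _; rewrite pnormZ -[leRHS]mulr1.
by apply: ler_pM; rewrite ?cn_ge0 ?pnorm_ge0 ?pnormXn.
Qed.

Lemma pnorm_root_iter n : pnorm (root_iter n) <= 1.
Proof.
have t00 : 0 < normc t0 by apply: lt_trans ht0; have := far_ge8; lra.
elim: n => [|n IH] /=; first by rewrite /pnorm polyseq0 big_nil.
rewrite pnormZ cnV mulrC ler_pdivrMr // mul1r.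
apply: le_trans (pnormD _ _) _; rewrite pnormN -[1]/(1%:P) pnormC cn1.
have h : pnorm ('X + psym (root_iter n)) <= 1 + W.
  by apply: le_trans (pnormD _ _) _; rewrite pnormX lerD2l pnorm_psym.
have : pnorm (root_iter n * ('X + psym (root_iter n))) <= 1 * (1 + W).
  by apply: le_trans (pnormM _ _) _; apply: ler_pM; rewrite ?pnorm_ge0.
by move: ht0 W0 L0; rewrite /far; lra.
Qed.

Lemma horner_psym p s : (psym p).[s] = sym b p.[s].
Proof.
by rewrite horner_sum; apply: eq_bigr => r _; rewrite hornerZ horner_exp.
Qed.

Lemma horner_le_pnorm p s : normc s <= 1 -> normc p.[s] <= pnorm p.
Proof.
move=> s1; rewrite horner_coef (pnormE (leqnn _)).
apply: cn_sum_le => i _; rewrite cnM -[leRHS]mulr1.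
by apply: ler_pM; rewrite ?cn_ge0 ?exp_le1.
Qed.

(** The iteration is y |-> (1 - y (s + sym b y)) / t0, a rewriting of y (t0 + s + sym b y) = 1. On
    the unit disc its Lipschitz constant is at most (1 + W + L) / |t0|, below 1/2. *)
Lemma root_iter_cvg s : normc s <= 1 ->
  exists y, cvgC (fun n => (root_iter n).[s]) y /\ small_root b (t0 + s) y.
Proof.
move=> s1; pose u n := (root_iter n).[s].
have u1 n : normc (u n) <= 1.
  exact: le_trans (horner_le_pnorm _ s1) (pnorm_root_iter n).
have t00 : 0 < normc t0 by apply: lt_trans ht0; have := far_ge8; lra.
have t0n : t0 != 0 by rewrite -cn_gt0.
have uS n : u n.+1 = t0^-1 * (1 - u n * (s + sym b (u n))).
  by rewrite /u /= hornerZ hornerD hornerN hornerM hornerD hornerX horner_psym hornerC.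
have contr n m : normc (u n.+1 - u m.+1) <= 2^-1 * normc (u n - u m).
  rewrite !uS -mulrBr cnM cnV mulrC ler_pdivrMr //.
  rewrite [X in normc X](_ : _ = - ((u n - u m) * s +
    (u n * sym b (u n) - u m * sym b (u m)))); last by ring.
  rewrite cnN; apply: le_trans (cnD _ _) _; rewrite cnM.
  have := mulsym_lip hb (u1 n) (u1 m).
  have : normc (u n - u m) * normc s <= normc (u n - u m) * 1.
    by rewrite ler_wpM2l ?cn_ge0.
  have : 0 <= (normc t0 - far) * normc (u n - u m).
    by rewrite mulr_ge0 ?cn_ge0 // subr_ge0 ltW.
  have : 0 <= (W + L) * normc (u n - u m) by rewrite mulr_ge0 ?cn_ge0 // addr_ge0.
  by rewrite /far; have := cn_ge0 (u n - u m); move: W0 L0; lra.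
have geo N : forall n m, (N <= n)%N -> (N <= m)%N -> normc (u n - u m) <= 2 * 2^-1 ^+ N.
  elim: N => [|N IH] n m nN mN.
    by rewrite expr0; apply: le_trans (cnB _ _) _; have := u1 n; have := u1 m; lra.
  case: n m nN mN => // n [//|m] nN mN; rewrite exprS.
  by apply: le_trans (contr n m) _; have := IH n m nN mN; lra.
have small (e : R) : 0 < e -> exists N, 2 * 2^-1 ^+ N <= e.
  move=> e0; have /cvgrPdist_le : (fun J : nat => (2^-1 : R) ^+ J) @ \oo --> 0.
    by apply: cvg_expr; rewrite ger0_norm //; lra.
  move=> /(_ (e / 2)) [|N _ /(_ N (leqnn N))]; first by lra.
  by rewrite /= sub0r normrN ger0_norm ?exprn_ge0 // => h; exists N; lra.
have [y hy] : exists y, cvgC u y.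
  by apply: cauchyC_cvg => e /small[N hN]; exists N => n m a c; apply: le_trans (geo N _ _ a c) _.
have y1 : normc y <= 1 by apply: cvgC_le hy _; exists 0%N.
exists y; split=> //; split=> //.
have h1 : cvgC (fun n => u n.+1) y.
  by move=> e /hy[N hN]; exists N => n Nn; apply: hN; apply: leqW.
have hsym : cvgC (fun n => sym b (u n)) (sym b y).
  move=> e e0; have L1 : 0 < L + 1 by rewrite ltr_wpDl.
  have [N hN] := hy _ (divr_gt0 e0 L1); exists N => n /hN.
  rewrite ler_pdivlMr // => h; apply: le_trans (sym_lip hb (u1 n) y1) _.
  by have := cn_ge0 (u n - y); lra.
have h2 : cvgC (fun n => u n.+1) (t0^-1 * (1 - y * (s + sym b y))).
  under eq_fun do rewrite uS.
  apply: cvgCMl; apply: cvgCB; first exact: cvgC_cst.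
  apply: cvgCM hy _; apply: cvgCD hsym; exact: cvgC_cst.
have := cvgC_unique h1 h2 => /(congr1 (fun z => t0 * z)); rewrite mulVKf // => h.
by rewrite -addrA mulrDr [y * t0]mulrC h subrK.
Qed.
End Iteration.

Lemma small_root_exists b t : bnd b -> far < normc t -> exists y, small_root b t y.
Proof.
move=> hb ht; have s0 : normc (0 : C) <= 1 by rewrite cn0.
by have [y []] := root_iter_cvg hb ht s0; rewrite addr0; exists y.
Qed.

End SymbolInverse.

(** * Lipschitz functions on [0, 1] *)

Section LipschitzUnit.
Variable R : realType.
Local Notation C := (Cnum R).
Implicit Types (f g : R -> C).

(** The only regularity in tau that is needed: it controls the shift from m / n to (m - r) / n and
    gives an explicit error for Riemann sums. *)
Definition lip01 f := exists2 K : R, 0 <= K &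
  forall x y : R, 0 <= x <= 1 -> 0 <= y <= 1 -> normc (f x - f y) <= K * `|x - y|.

Lemma lip01_bound f : lip01 f -> exists2 M : R, 0 < M & forall x, 0 <= x <= 1 -> normc (f x) <= M.
Proof.
move=> [K K0 h]; exists (normc (f 0) + K + 1); first by have := cn_ge0 (f 0); lra.
move=> x x01; have := h x 0 x01; rewrite lexx ler01 subr0 => /(_ isT).
have := cnD (f x - f 0) (f 0); rewrite subrK.
have : K * `|x| <= K * 1.
  by case/andP: x01 => x0 x1; rewrite ler_wpM2l // ger0_norm.
lra.
Qed.

Lemma lip01_eq f g : (forall x, 0 <= x <= 1 -> f x = g x) -> lip01 f -> lip01 g.
Proof. by move=> h [K K0 hK]; exists K => // x y hx hy; rewrite -!h // hK. Qed.

Lemma lip01_cst (c : C) : lip01 (fun=> c).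
Proof. by exists 0 => // x y _ _; rewrite subrr cn0 mul0r. Qed.

Lemma lip01_real : lip01 (fun x => x%:C).
Proof. by exists 1 => // x y _ _; rewrite mul1r -cn_real rmorphB. Qed.

Lemma lip01D f g : lip01 f -> lip01 g -> lip01 (fun x => f x + g x).
Proof.
move=> [K K0 h] [K' K0' h']; exists (K + K'); first exact: addr_ge0.
move=> x y hx hy; rewrite opprD addrACA mulrDl.
by apply: le_trans (cnD _ _) (lerD (h _ _ hx hy) (h' _ _ hx hy)).
Qed.

Lemma lip01M f g : lip01 f -> lip01 g -> lip01 (fun x => f x * g x).
Proof.
move=> lf lg; have [M M0 hM] := lip01_bound lf; have [M' M0' hM'] := lip01_bound lg.
case: lf lg => [K K0 h] [K' K0' h'].
exists (M * K' + K * M'); first by rewrite addr_ge0 ?mulr_ge0 // ltW.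
move=> x y hx hy.
rewrite [X in normc X](_ : _ = f x * (g x - g y) + (f x - f y) * g y); last by ring.
apply: le_trans (cnD _ _) _; rewrite [leRHS]mulrDl !cnM; apply: lerD.
  by rewrite -mulrA; apply: ler_pM; rewrite ?cn_ge0 ?hM ?h'.
by rewrite mulrAC; apply: ler_pM; rewrite ?cn_ge0 ?hM' ?h.
Qed.

Lemma lip01_exp f n : lip01 f -> lip01 (fun x => f x ^+ n).
Proof.
move=> h; elim: n => [|n IH]; first by apply: lip01_eq (lip01_cst 1) => x _; rewrite expr0.
by apply: lip01_eq (lip01M h IH) => x _; rewrite exprS.
Qed.

Lemma lip01_sum (I : Type) (s : seq I) (F : I -> R -> C) :
  (forall i, lip01 (F i)) -> lip01 (fun x => \sum_(i <- s) F i x).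
Proof.
move=> h; elim: s => [|i s IH]; first by apply: lip01_eq (lip01_cst 0) => x _; rewrite big_nil.
by apply: lip01_eq (lip01D (h i) IH) => x _; rewrite big_cons.
Qed.

Lemma lip01V f (d : R) : 0 < d -> (forall x, 0 <= x <= 1 -> d <= normc (f x)) ->
  lip01 f -> lip01 (fun x => (f x)^-1).
Proof.
move=> d0 hd [K K0 h]; exists (K / d ^+ 2); first by rewrite divr_ge0 ?exprn_ge0 // ltW.
move=> x y hx hy.
have fx : f x != 0 by rewrite -cn_gt0 (lt_le_trans d0 (hd _ hx)).
have fy : f y != 0 by rewrite -cn_gt0 (lt_le_trans d0 (hd _ hy)).
have -> : (f x)^-1 - (f y)^-1 = (f y - f x) / (f x * f y) by field; rewrite fx fy.
rewrite cnM cnV cnM mulrAC cnBC; apply: ler_pM; rewrite ?cn_ge0 ?invr_ge0 ?mulr_ge0 ?cn_ge0 ?h //.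
rewrite lef_pV2 ?posrE ?mulr_gt0 ?cn_gt0 ?exprn_gt0 // expr2.
by apply: ler_pM; rewrite ?(ltW d0) ?hd.
Qed.
End LipschitzUnit.

Section SymbolComparison.
Variable R : realType.
Local Notation C := (Cnum R).

(** As for uniqueness, with an extra term v (sym b v - sym b' v) of size at most k d; the margin |t|
    - (W + L) >= 1 absorbs the rest. *)
Lemma small_root_lip (k : nat) (B : R) (b b' : nat -> C) (t u v : C) (d : R) :
  0 <= B -> bnd B b -> far k B < normc t -> small_root k b t u -> small_root k b' t v ->
  (forall r, normc (b r - b' r) <= d) -> normc (u - v) <= k%:R * d.
Proof.
move=> B0 hb ht [Y1 Y] [Z1 Z] hd.
have hs : normc (sym k b v - sym k b' v) <= k%:R * d by apply: sym_diff.
have h2 := mulsym_lip k hb Y1 Z1.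
set WL : R := k%:R * B + _ in h2.
have WL0 : 0 <= WL by rewrite /WL addr_ge0 // !mulr_ge0.
have key : normc t * normc (u - v) <= WL * normc (u - v) + k%:R * d.
  rewrite -cnM (_ : t * (u - v) = - ((u * sym k b u - v * sym k b v) +
     v * (sym k b v - sym k b' v))); last first.
    have eu : u * sym k b u = 1 - u * t by rewrite -Y mulrDr [u * t + _]addrC addrK.
    have ev : v * sym k b' v = 1 - v * t by rewrite -Z mulrDr [v * t + _]addrC addrK.
    by rewrite eu [v * (_ - _)]mulrBr ev; ring.
  rewrite cnN; apply: le_trans (cnD _ _) _; apply: lerD => //.
  by rewrite cnM -[leRHS]mul1r; apply: ler_pM; rewrite ?cn_ge0.
have : 1 * normc (u - v) <= (normc t - WL) * normc (u - v).
  rewrite ler_wpM2r ?cn_ge0 //; move: ht WL0; rewrite /far /WL; lra.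
lra.
Qed.

End SymbolComparison.

(** * The reciprocal of the branch at infinity *)

Section Branch.
Variable R : realType.
Local Notation C := (Cnum R).
Variables (k : nat) (a : nat -> C).
Hypothesis k_gt0 : (0 < k)%N.
Implicit Types (t y z s : C) (tau : R).

(** Division of the branch equation by psi ^ (k - 1) gives psi = t + sum of [symb tau r] / psi ^ r;
    the term a_k Theta is the case r = 0. *)
Definition symb (tau : R) (r : nat) : C :=
  if (r < k)%N then (tau ^+ k)%:C * (1 - (tau ^+ k)%:C) ^+ r * a (k - r)%N else 0.

(* The slack 1 leaves room for the approximate weights at finite n. *)
Definition symb_bound : R := \sum_(j < k.+1) normc (a j) + 1.

Definition branch_radius : R := far k symb_bound.

Lemma symb_bound_ge0 : 0 <= symb_bound.
Proof. by rewrite addr_ge0 // sumr_ge0 // => j _; apply: cn_ge0. Qed.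

Lemma symb_le tau r : 0 <= tau <= 1 -> normc (symb tau r) <= symb_bound - 1.
Proof.
move=> /andP[t0 t1]; rewrite addrK /symb; case: ltnP => rk; last first.
  by rewrite cn0 sumr_ge0 // => j _; apply: cn_ge0.
have T0 : 0 <= tau ^+ k by rewrite exprn_ge0.
have T1 : tau ^+ k <= 1 by rewrite exprn_ile1.
have -> : 1 - (tau ^+ k)%:C = (1 - tau ^+ k)%:C :> C by rewrite rmorphB.
rewrite !cnM cnX !cn_real.
have lt : (k - r < k.+1)%N by rewrite ltnS leq_subr.
rewrite (bigD1 (Ordinal lt)) //= -[leLHS]addr0; apply: lerD; last first.
  by apply: sumr_ge0 => j _; apply: cn_ge0.
rewrite -[leRHS]mul1r; apply: ler_pM; rewrite ?mulr_ge0 ?exprn_ge0 ?cn_ge0 //.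
rewrite -[leRHS]mul1r; apply: ler_pM; rewrite ?exprn_ge0 //.
  by rewrite ger0_norm.
by rewrite exprn_ile1 // ger0_norm; lra.
Qed.

Lemma symb_bnd tau : 0 <= tau <= 1 -> bnd symb_bound (symb tau).
Proof. by move=> h r; have := symb_le r h; lra. Qed.

Lemma lip01_symb r : lip01 (symb^~ r).
Proof.
rewrite /symb; case: ltnP => _; last exact: lip01_cst.
have hT : lip01 (fun tau : R => (tau ^+ k)%:C : C).
  by apply: lip01_eq (lip01_exp k (lip01_real R)) => x _; rewrite -rmorphXn.
apply: lip01M (lip01_cst _); apply: (lip01M hT); apply: lip01_exp.
apply: lip01D; first exact: lip01_cst.
by apply: lip01_eq (lip01M (lip01_cst (-1)) hT) => x _; rewrite mulN1r.
Qed.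

(** The reciprocal of the branch Psi. The default 0 is never taken for tau in [0, 1] and |t| beyond
    [branch_radius]. *)
Definition ystar (t : C) (tau : R) : C := xget 0 [set y | small_root k (symb tau) t y].

Lemma ystarP t tau : 0 <= tau <= 1 -> branch_radius < normc t ->
  small_root k (symb tau) t (ystar t tau).
Proof.
move=> htau ht; rewrite /ystar; case: xgetP => [y _ //|no].
have [y hy] := small_root_exists symb_bound_ge0 (symb_bnd htau) ht.
by have := no y.
Qed.

Lemma ystar_unique t tau y : 0 <= tau <= 1 -> branch_radius < normc t ->
  small_root k (symb tau) t y -> y = ystar t tau.
Proof.
move=> htau ht hy.
exact: (small_root_unique symb_bound_ge0 (symb_bnd htau) ht hy (ystarP htau ht)).
Qed.

Lemma lip01_ystar t : branch_radius < normc t -> lip01 (ystar t).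
Proof.
move=> ht.
have /choice[K hK] : forall r, exists K : R, 0 <= K /\ forall x y : R, 0 <= x <= 1 -> 0 <= y <= 1 ->
    normc (symb x r - symb y r) <= K * `|x - y|.
  by move=> r; have [K K0 hK] := lip01_symb r; exists K.
pose K1 := \sum_(r < k) K r.
have K10 : 0 <= K1 by apply: sumr_ge0 => r _; have [] := hK r.
exists (k%:R * K1) => [|x y hx hy]; first by rewrite mulr_ge0.
rewrite -mulrA.
apply: small_root_lip symb_bound_ge0 (symb_bnd hx) ht (ystarP hx ht) (ystarP hy ht) _ => r.
case: (ltnP r k) => rk; last first.
  have h0 sg : symb sg r = 0 by rewrite /symb ltnNge rk.
  by rewrite !h0 subrr cn0 mulr_ge0.
apply: le_trans ((hK r).2 x y hx hy) _; rewrite ler_wpM2r //.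
by rewrite /K1 (bigD1 (Ordinal rk)) //= lerDl sumr_ge0 // => j _; have [] := hK j.
Qed.

End Branch.

Section AnalyticFacts.
Variable R : realType.
Local Notation C := (Cnum R).
Implicit Types (f : C -> C) (t s h : C).

Lemma series_cvgC (c : nat -> C) s (l : C) :
  cvgC (fun J => \sum_(i < J) c i * s ^+ i) l <->
  [series c m * s ^+ m]_m @ \oo --> l.
Proof.
rewrite cvgC_P /series /=.
suff -> : (fun J : nat => \sum_(i < J) c i * s ^+ i) =
  (fun n : nat => \sum_(0 <= i < n) c i * s ^+ i) by [].
by apply/funext => J; rewrite big_mkord.
Qed.

(** Convergence of the power series at distance r / 2 bounds its terms there; the series without its
    constant term is then dominated by a geometric one of ratio 2 |s| / r. *)
Lemma analytic_continuous O f t : analytic_on O f -> O t ->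
  forall e : R, 0 < e -> exists2 d : R, 0 < d & forall s, normc (s - t) < d -> normc (f s - f t) <= e.
Proof.
move=> hf Ot; have [c [r [r0 hc]]] := hf t Ot.
have {}hc s : normc s < r -> cvgC (fun J => \sum_(i < J) c i * s ^+ i) (f (t + s)).
  by move=> hs; have := hc (t + s); rewrite addrC addKr => /(_ hs) /series_cvgC; rewrite addrC.
have ft : f t = c 0%N.
  have := hc 0; rewrite cn0 addr0 => /(_ r0) h; apply: cvgC_unique h _.
  apply: cvgC_near (cvgC_cst (c 0%N)); exists 1%N => -[//|n] _.
  rewrite big_ord_recl expr0 mulr1 big1 ?addr0 // => i _.
  by rewrite expr0n /= mulr0.
(* Each term is a difference of consecutive partial sums, bounded from some rank on; M1 covers the
   finitely many earlier terms. *)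
have [M M0 hM] : exists2 M : R, 0 < M & forall m, normc (c m) * (r / 2) ^+ m <= M.
  pose s : C := (r / 2)%:C.
  have ns : normc s = r / 2 by rewrite cn_real ger0_norm //; lra.
  have hs := hc s (ltac:(rewrite ns; lra)).
  have [M M0 [N hN]] := cvgC_bound hs.
  pose M1 := \sum_(m < N) normc (c m) * (r / 2) ^+ m.
  have M10 : 0 <= M1 by apply: sumr_ge0 => i _; rewrite mulr_ge0 ?cn_ge0 ?exprn_ge0 //; lra.
  exists (2 * M + M1); first by lra.
  move=> m; have [mN|Nm] := ltnP m N.
    have : normc (c m) * (r / 2) ^+ m <= M1.
      rewrite /M1 (bigD1 (Ordinal mN)) //= lerDl; apply: sumr_ge0 => i _.
      by rewrite mulr_ge0 ?cn_ge0 ?exprn_ge0 //; lra.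
    lra.
  have h1 := hN m Nm; have h2 := hN m.+1 (leqW Nm).
  have -> : normc (c m) * (r / 2) ^+ m = normc (c m * s ^+ m) by rewrite cnM cnX ns.
  have := cnB (\sum_(i < m.+1) c i * s ^+ i) (\sum_(i < m) c i * s ^+ i).
  rewrite {1}big_ord_recr /= addrAC subrr add0r; lra.
have est s : normc s <= r / 4 -> normc (f (t + s) - f t) <= 4 * M / r * normc s.
  move=> hs; have sr : normc s < r by lra.
  rewrite ft; apply: cvgC_lim_le (hc s sr) (cvgC_cst (c 0%N)) _.
  exists 1%N => -[//|n] _; rewrite big_ord_recl expr0 mulr1 addrC addKr.
  set th := normc s / (r / 2).
  have th0 : 0 <= th by rewrite divr_ge0 ?cn_ge0 //; lra.
  have th1 : th <= 2^-1 by rewrite ler_pdivrMr; lra.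
  apply: le_trans (_ : \sum_(i < n) M * th ^+ i.+1 <= _).
    apply: cn_sum_le => i _; rewrite cnM cnX /= /bump /= add1n.
    rewrite expr_div_n mulrA ler_pdivlMr ?exprn_gt0 //; last by lra.
    by rewrite mulrAC ler_wpM2r ?hM // exprn_ge0 ?cn_ge0.
  rewrite -mulr_sumr.
  have -> : \sum_(i < n) th ^+ i.+1 = \sum_(1 <= i < n.+1) th ^+ i.
    by rewrite big_add1 big_mkord.
  have th1' : th < 1 by lra.
  apply: le_trans (ler_wpM2l (ltW M0) (sum_geo_le 1 n.+1 th0 th1')) _.
  rewrite expr1; have -> : 4 * M / r * normc s = M * (2 * th).
    by rewrite /th; field; rewrite gt_eqF.
  rewrite ler_wpM2l ?(ltW M0) // ler_pdivrMr; last by lra.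
  have : 0 <= th * (1 - 2 * th) by rewrite mulr_ge0 //; lra.
  lra.
move=> e e0; exists (Num.min (r / 4) (e / (4 * M / r))).
  by rewrite lt_min !divr_gt0 ?mulr_gt0.
move=> s; rewrite lt_min => /andP[s1 s2].
have := est (s - t) (ltW s1); rewrite [t + _]addrC subrK => h; apply: le_trans h _.
by move: s2; rewrite ltr_pdivlMr ?divr_gt0 ?mulr_gt0 // mulrC => /ltW.
Qed.

Lemma derive1C f t (D : C) (K r : R) : 0 <= K -> 0 < r ->
  (forall h, h != 0 -> normc h < r -> normc (h^-1 * (f (h + t) - f t) - D) <= K * normc h) ->
  derive1 f t = D.
Proof.
move=> K0 r0 hK; rewrite /derive1; apply: cvg_lim; first exact: norm_hausdorff.
apply/cvgrPdist_le => e e0.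
have re : e = (complex.Re e)%:C by rewrite RRe_real // gtr0_real.
have e0' : 0 < complex.Re e by move: e0; rewrite re ltcR.
have K1 : 0 < K + 1 by rewrite ltr_wpDl.
apply/nbhsC_P; exists (Num.min r (complex.Re e / (K + 1))).
  by rewrite lt_min r0 divr_gt0.
move=> h; rewrite subr0 lt_min => /andP[h1 h2] h0.
rewrite re -[X in X <= _]/((normc _)%:C) lecR cnBC; apply: le_trans (hK h h0 h1) _.
move: h2; rewrite ltr_pdivlMr //; have := cn_ge0 h; lra.
Qed.
End AnalyticFacts.

Section BranchExistence.
Variable R : realType.
Local Notation C := (Cnum R).
Variables (k : nat) (a : nat -> C).
Hypothesis k_gt0 : (0 < k)%N.
Implicit Types (t y z s psi : C) (tau : R).
Local Notation symb := (symb k a).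
Local Notation ystar := (ystar k a).
Local Notation rho := (branch_radius k a).
Local Notation B := (symb_bound k a).

Lemma sym_symb tau psi : psi != 0 -> sym k (symb tau) psi^-1 * psi ^+ k.-1 =
  a k * (tau ^+ k)%:C * psi ^+ k.-1 + \sum_(1 <= r < k)
    (tau ^+ k)%:C * (1 - (tau ^+ k)%:C) ^+ r * a (k - r)%N * psi ^+ (k.-1 - r).
Proof.
move=> p0; rewrite /sym -(big_mkord xpredT (fun r => symb tau r * psi^-1 ^+ r)) big_ltn //.
rewrite mulrDl expr0 mulr1 {1}/symb k_gt0 expr0 mulr1 subn0 [_ * a k]mulrC; congr (_ + _).
rewrite mulr_suml big_nat_cond [RHS]big_nat_cond; apply: eq_bigr => r /andP[/andP[r1 rk] _].
rewrite /symb rk -mulrA; congr (_ * _).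
have -> : (k.-1 = r + (k.-1 - r))%N by lia.
by rewrite addKn exprD mulrA exprVn mulVf ?mul1r // expf_neq0.
Qed.

Lemma branch_equationE t tau psi : psi != 0 ->
  branch_equation k a t tau psi <-> psi = t + sym k (symb tau) psi^-1.
Proof.
move=> p0; have pk : psi ^+ k.-1 != 0 by rewrite expf_neq0.
rewrite /branch_equation mulrDl -addrA -sym_symb // -mulrDl.
rewrite -[X in psi ^+ X](prednK k_gt0) exprS; split; first by move/(mulIf pk).
by move=> {1}->.
Qed.

Lemma small_rootV t tau psi : 1 <= normc psi -> branch_equation k a t tau psi ->
  small_root k (symb tau) t psi^-1.
Proof.
move=> p1; have p0 : psi != 0 by rewrite -cn_gt0; lra.
move/(branch_equationE _ _ p0) => h; split; last by rewrite -h mulVf.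
by rewrite cnV invf_le1 //; lra.
Qed.

Lemma ystar_neq0 t tau : 0 <= tau <= 1 -> rho < normc t -> ystar t tau != 0.
Proof.
by move=> h ht; have [] := small_root_le (symb_bound_ge0 k a) (symb_bnd k a h) ht (ystarP h ht).
Qed.

Lemma ystarV t tau : 0 <= tau <= 1 -> rho < normc t ->
  (ystar t tau)^-1 = t + sym k (symb tau) (ystar t tau).
Proof.
move=> h ht; have [_ e] := ystarP h ht; have y0 := ystar_neq0 h ht.
by apply: (mulfI y0); rewrite e mulfV.
Qed.

Lemma cvgCX (u : nat -> C) l i : cvgC u l -> cvgC (fun n => u n ^+ i) (l ^+ i).
Proof.
move=> h; elim: i => [|i IH].
  by under eq_fun do rewrite expr0; rewrite expr0; apply: cvgC_cst.
by under eq_fun do rewrite exprS; rewrite exprS; apply: cvgCM.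
Qed.

Lemma cvgC_sym (b : nat -> C) (u : nat -> C) l : cvgC u l ->
  cvgC (fun n => sym k b (u n)) (sym k b l).
Proof. by move=> h; apply: cvgC_sum => i; apply: cvgCMl; apply: cvgCX. Qed.

(** Near t0 the branch is t + sym applied to the limit of the polynomials [root_iter]. Their l1
    norms are bounded, so [poly_limit_series] yields a power series in t - t0. *)
Lemma branch_at_infinity_ystar :
  branch_at_infinity k a rho (fun t tau => (ystar t tau)^-1).
Proof.
move=> tau htau; have hb := symb_bnd k a htau.
have B0 := symb_bound_ge0 k a.
split.
- move=> t0 /= ht0.
  have /choice[yl hyl] : forall s, exists y, normc s <= 1 ->
      cvgC (fun n => (root_iter k (symb tau) t0 n).[s]) y /\ small_root k (symb tau) (t0 + s) y.
    move=> s; have [s1|_] := boolP (normc s <= 1); last by exists 0.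
    by have [y hy] := root_iter_cvg B0 hb ht0 s1; exists y.
  pose f n := t0%:P + 'X + psym k (symb tau) (root_iter k (symb tau) t0 n).
  pose F s := t0 + s + sym k (symb tau) (yl s).
  have hf n j : (0 <= n)%N -> normc (f n)`_j <= (normc t0 + 1 + k%:R * B) * 1 ^+ j.
    move=> _; rewrite expr1n mulr1; apply: le_trans (coef_le_pnorm _ _) _.
    apply: le_trans (pnormD _ _) _; apply: lerD.
      by apply: le_trans (pnormD _ _) _; rewrite pnormC pnormX.
    by apply: pnorm_psym => //; apply: (pnorm_root_iter B0 hb ht0).
  have hF s : normc s < 1^-1 -> cvgC (fun n => (f n).[s]) (F s).
    rewrite invr1 => s1; have [h1 h2] := hyl s (ltW s1).
    rewrite /f /F; under eq_fun do rewrite hornerD horner_psym hornerD hornerC hornerX.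
    by apply: cvgCD; [apply: cvgC_cst | apply: cvgC_sym].
  have M0 : 0 <= normc t0 + 1 + k%:R * B.
    by rewrite !addr_ge0 ?cn_ge0 // mulr_ge0.
  have [c [_ hc]] := poly_limit_series M0 ltr01 hf hF.
  (* 1 is the radius provided by the bound on l1 norms; |t0| - rho keeps t in the region where the
     small root is known to be unique. *)
  exists c, (Num.min 1 (normc t0 - rho)); split.
    by rewrite lt_min ltr01 subr_gt0.
  move=> t; rewrite lt_min => /andP[t1 t2]; apply/series_cvgC.
  have ht : rho < normc t.
    by have := cnD (t0 - t) t; rewrite subrK cnBC; lra.
  have [_ h2] := hyl (t - t0) (ltW t1); rewrite addrC subrK in h2.
  rewrite (_ : (ystar t tau)^-1 = F (t - t0)); first by apply: hc; rewrite invr1.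
  by rewrite ystarV // /F addrC [t0 + _]addrC subrK addrC (ystar_unique htau ht h2).
- move=> t ht; have y0 := ystar_neq0 htau ht.
  apply/branch_equationE; first by rewrite invr_eq0.
  by rewrite invrK ystarV.
- exists (k%:R * B), rho => t ht.
  rewrite ystarV // addrC addKr; apply: sym_le => //.
  by have [] := ystarP htau ht.
Qed.

(** A gap in the possible moduli: y = 1 / psi is a small root, so |y| |t| <= 2 while |t| > 8. *)
Lemma branch_avoids t tau psi : 0 <= tau <= 1 -> rho < normc t ->
  branch_equation k a t tau psi -> 1 <= normc psi -> 4 < normc psi.
Proof.
move=> htau ht h p1; have hs := small_rootV p1 h.
have [y0 hy] := small_root_le (symb_bound_ge0 k a) (symb_bnd k a htau) ht hs.
have := far_ge8 k (symb_bound_ge0 k a); rewrite -/rho => r8.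
move: hy; rewrite cnV mulrC ler_pdivrMr; lra.
Qed.

(* Along the ray from t to infinity |Psi| is continuous and finally large, and it
   never takes the value 1 by branch_avoids. *)
Lemma branch_unique Psi : branch_at_infinity k a rho Psi ->
  forall t tau, 0 <= tau <= 1 -> rho < normc t ->
  Psi t tau != 0 /\ Psi t tau = (ystar t tau)^-1.
Proof.
move=> hPsi t tau htau ht; have [han heq [M [r hM]]] := hPsi tau htau.
have r8 := far_ge8 k (symb_bound_ge0 k a); rewrite -[far _ _]/rho in r8.
have t8 : 8 < normc t by lra.
suff p1 : 1 <= normc (Psi t tau).
  have p0 : Psi t tau != 0 by rewrite -cn_gt0; lra.
  split=> //; rewrite -(ystar_unique htau ht (small_rootV p1 (heq t ht))) invrK //.
rewrite leNgt; apply/negP => p1.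
pose g (x : R) := normc (Psi (x%:C * t) tau).
have gt x : 1 <= x -> rho < normc (x%:C * t).
  move=> x1; rewrite cnM cn_real ger0_norm; last by lra.
  have : 1 * normc t <= x * normc t by rewrite ler_wpM2r ?cn_ge0.
  lra.
(* At X t the bound |Psi - t| <= M is available, and |X t| is large enough for it to force |Psi| >=
   1. *)
pose X : R := 1 + `|r| + `|M|.
have X1 : 1 <= X by rewrite /X -addrA lerDl addr_ge0.
have cg : {within `[1, X], continuous g}.
  apply: continuous_in_subspaceT => x; rewrite inE /= in_itv /= => /andP[x1 _].
  apply/cvgrPdist_le => e e0.
  have [d d0 hd] := analytic_continuous han (gt x x1) e0.
  near=> y.
  have hy : normc (y%:C * t - x%:C * t) < d.
    rewrite -mulrBl cnM (_ : y%:C - x%:C = (y - x)%:C); last by rewrite rmorphB.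
    rewrite cn_real distrC -ltr_pdivlMr; last by lra.
    by near: y; apply: cvgr_dist_lt; rewrite ?divr_gt0 //; lra.
  have := hd _ hy; rewrite /g => h.
  have := cnD (Psi (x%:C * t) tau - Psi (y%:C * t) tau) (Psi (y%:C * t) tau).
  have := cnD (Psi (y%:C * t) tau - Psi (x%:C * t) tau) (Psi (x%:C * t) tau).
  rewrite !subrK [normc (_ - Psi (y%:C * t) tau)]cnBC ler_norml; lra.
have gX : 1 <= g X.
  have nX : normc (X%:C * t) = X * normc t by rewrite cnM cn_real ger0_norm //; lra.
  have big : X * 8 <= X * normc t by rewrite ler_wpM2l; lra.
  have rX : r < normc (X%:C * t).
    rewrite nX; have := ler_norm r; have := normr_ge0 M; have := normr_ge0 r; rewrite /X in big *; lra.
  have := hM _ rX; have := cnD (X%:C * t - Psi (X%:C * t) tau) (Psi (X%:C * t) tau).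
  rewrite subrK cnBC nX -/(g X); have := ler_norm M; have := normr_ge0 r; have := normr_ge0 M; rewrite /X in big *; lra.
have g1 : g 1 < 1 by rewrite /g mul1r.
have [|x] := @IVT R g 1 X 1 X1 cg.
  by rewrite ge_min (ltW g1) /= le_max gX orbT.
rewrite in_itv /= => /andP[x1 _] gx.
have := branch_avoids htau (gt x x1) (heq _ (gt x x1)); rewrite -/(g x) gx lexx => /(_ isT); lra.
Unshelve. all: by end_near.
Qed.

End BranchExistence.

(** * Logarithmic derivative of the branch *)

Section BranchLogDerivative.
Variable R : realType.
Local Notation C := (Cnum R).
Variables (k : nat) (a : nat -> C).
Hypothesis k_gt0 : (0 < k)%N.
Implicit Types (t y z s psi h : C) (tau : R).
Local Notation symb := (symb k a).
Local Notation ystar := (ystar k a).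
Local Notation rho := (branch_radius k a).
Local Notation B := (symb_bound k a).

(** Implicit differentiation of Psi = t + sum of b_r Psi ^ (- r) gives dPsi/dt = 1 / [lden];
    therefore [lstar] is Psi' / Psi. *)
Definition lden (b : nat -> C) y : C := 1 + y * \sum_(r < k) r%:R * b r * y ^+ r.
Definition lstar t tau : C := ystar t tau / lden (symb tau) (ystar t tau).

Lemma ystar_le t tau : 0 <= tau <= 1 -> rho < normc t ->
  normc (ystar t tau) * (8 * (1 + k%:R * B + k%:R * (k%:R * B))) <= 2.
Proof.
move=> htau ht.
have [_ h] := small_root_le (symb_bound_ge0 k a) (symb_bnd k a htau) ht (ystarP htau ht).
by apply: le_trans h; rewrite ler_wpM2l ?cn_ge0 // ltW.
Qed.

Lemma ystar_le4 t tau : 0 <= tau <= 1 -> rho < normc t ->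
  normc (ystar t tau) <= 4^-1 /\ normc (ystar t tau) * (k%:R * (k%:R * B)) <= 4^-1.
Proof.
move=> htau ht; have := ystar_le htau ht.
have W0 : 0 <= k%:R * B by rewrite mulr_ge0 // symb_bound_ge0.
have L0 : 0 <= k%:R * (k%:R * B) by rewrite mulr_ge0.
have := mulr_ge0 (cn_ge0 (ystar t tau)) W0.
have := mulr_ge0 (cn_ge0 (ystar t tau)) L0; have := cn_ge0 (ystar t tau).
by move=> h1 h2 h3 h4; split; lra.
Qed.

Lemma sum_wt_le (b : nat -> C) y : bnd B b -> normc y <= 1 ->
  normc (\sum_(r < k) r%:R * b r * y ^+ r) <= k%:R * (k%:R * B).
Proof.
move=> hb y1; apply: le_trans (_ : \sum_(r < k) k%:R * B <= _); last first.
  by rewrite sumr_const card_ord -[_ *+ k]mulr_natl.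
apply: cn_sum_le => r _; rewrite !cnM cn_nat -[leRHS]mulr1.
apply: ler_pM; rewrite ?mulr_ge0 ?cn_ge0 ?exp_le1 //.
by apply: ler_pM; rewrite ?cn_ge0 // ler_nat ltnW.
Qed.

Lemma lden_ge t tau : 0 <= tau <= 1 -> rho < normc t ->
  2^-1 <= normc (lden (symb tau) (ystar t tau)).
Proof.
move=> htau ht; have [y4 yL] := ystar_le4 htau ht.
have y1 : normc (ystar t tau) <= 1 by lra.
have := ler_wpM2l (cn_ge0 (ystar t tau)) (sum_wt_le (symb_bnd k a htau) y1).
rewrite -cnM => h; have := cn_lower 1 (ystar t tau * \sum_(r < k) r%:R * symb tau r * ystar t tau ^+ r).
rewrite -/(lden _ _) cn1; lra.
Qed.

Lemma lip01_lstar t : rho < normc t -> lip01 (lstar t).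
Proof.
move=> ht; have hy := lip01_ystar ht.
apply: (lip01M hy); apply: (@lip01V _ _ 2^-1) => [|tau htau|]; first by rewrite invr_gt0.
  exact: lden_ge.
apply: lip01D (lip01_cst 1) _; apply: (lip01M hy); apply: lip01_sum => r.
by apply: lip01M (lip01_exp r hy); apply: lip01M (lip01_cst _) (lip01_symb k a r).
Qed.

(** With y and z the small roots at t and t + h, the difference quotient of the branch is exactly 1
    / (1 + y z q(z)), q being a divided difference of the symbol. It remains to let z tend to y, at
    a rate O(|h|). *)
Lemma log_derivative_branch (f : C -> C) t tau : 0 <= tau <= 1 -> rho < normc t ->
  (forall s, rho < normc s -> f s = (ystar s tau)^-1) ->
  log_derivative f t = lstar t tau.
Proof.
move=> htau ht hf; set y := ystar t tau; set b := symb tau.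
have hb : bnd B b := symb_bnd k a htau.
have y0 : y != 0 := ystar_neq0 htau ht.
have [y4 yL] := ystar_le4 htau ht; rewrite -/y in y4 yL.
have L0 : 0 <= k%:R * (k%:R * B) by rewrite !mulr_ge0 // symb_bound_ge0.
set L := k%:R * (k%:R * B) in yL L0.
have y1 : normc y <= 1 by lra.
suff hd : derive1 f t = (lden b y)^-1.
  by rewrite /log_derivative hd hf // invrK mulrC.
have ld := lden_ge htau ht; rewrite -/y -/b in ld.
have ld0 : lden b y != 0 by rewrite -cn_gt0; lra.
(* The divided difference of [sym k b] at y, written as a polynomial so that it makes sense at z =
   y, where it is the derivative. *)
pose q z : C := \sum_(r < k) b r * \sum_(i < r) z ^+ (r.-1 - i) * y ^+ i.
have qd z : sym k b z - sym k b y = (z - y) * q z.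
  rewrite /sym -sumrB mulr_sumr; apply: eq_bigr => r _.
  by rewrite -mulrBr subrXX mulrCA.
have qy : lden b y = 1 + y * y * q y.
  rewrite /lden -mulrA; congr (1 + y * _); rewrite mulr_sumr; apply: eq_bigr => r _.
  have -> : \sum_(i < r) y ^+ (r.-1 - i) * y ^+ i = r%:R * y ^+ r.-1.
    rewrite (eq_bigr (fun=> y ^+ r.-1)) => [|i _]; last first.
      by rewrite -exprD subnK // -ltnS (ltn_predK (ltn_ord i)) ltn_ord.
    by rewrite sumr_const card_ord mulr_natl.
  by case: (nat_of_ord r) => [|n]; rewrite /= ?exprS; ring.
have qlip z : normc z <= 1 -> normc (q z - q y) <= k%:R * L * normc (z - y).
  move=> z1; rewrite /q -sumrB.
  apply: le_trans (_ : \sum_(r < k) L * normc (z - y) <= _); last first.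
    by rewrite sumr_const card_ord -[_ *+ k]mulr_natl mulrA.
  apply: cn_sum_le => r _; rewrite -mulrBr cnM /L.
  apply: le_trans (_ : B * (\sum_(i < r) k%:R * normc (z - y)) <= _).
    apply: ler_pM; rewrite ?cn_ge0 // -sumrB; apply: cn_sum_le => i _.
    rewrite -mulrBl cnM -[leRHS]mulr1; apply: ler_pM; rewrite ?cn_ge0 ?exp_le1 //.
    apply: le_trans (exp_lip _ z1 y1) _; rewrite ler_wpM2r ?cn_ge0 // ler_nat.
    by apply: leq_trans (leq_subr _ _) _; apply: leq_trans (leq_pred _) (ltnW (ltn_ord r)).
  rewrite sumr_const card_ord -[_ *+ r]mulr_natl.
  rewrite [leRHS](_ : _ = B * (k%:R * (k%:R * normc (z - y)))); last by ring.
  rewrite ler_wpM2l ?symb_bound_ge0 // ler_wpM2r ?mulr_ge0 ?cn_ge0 // ler_nat ltnW //.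
have qL z : normc z <= 1 -> normc (q z) <= L.
  move=> z1; apply: le_trans (_ : \sum_(r < k) B * k%:R <= _); last first.
    by rewrite sumr_const card_ord -[_ *+ k]mulr_natl /L [B * _]mulrC.
  apply: cn_sum_le => r _; rewrite cnM; apply: ler_pM; rewrite ?cn_ge0 //.
  apply: le_trans (_ : \sum_(i < r) 1 <= _); last first.
    by rewrite sumr_const card_ord ler_nat ltnW.
  apply: cn_sum_le => i _; rewrite cnM -[leRHS]mulr1.
  by apply: ler_pM; rewrite ?cn_ge0 ?exp_le1.
apply: (@derive1C _ _ _ _ (8 * (L + k%:R * L)) (normc t - rho)); rewrite ?subr_gt0 //.
  by rewrite mulr_ge0 // addr_ge0 // mulr_ge0.
move=> h h0 hh; have hth : rho < normc (h + t).
  by have := cn_lower t h; rewrite [h + t]addrC; lra.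
rewrite !hf //; set z := ystar (h + t) tau; rewrite -/y.
have z0 : z != 0 := ystar_neq0 htau hth.
have [z4 zL] := ystar_le4 htau hth; rewrite -/z -/L in z4 zL.
have z1 : normc z <= 1 by lra.
have ey : y^-1 = t + sym k b y := ystarV htau ht.
have ez : z^-1 = h + t + sym k b z := ystarV htau hth.
pose d := 1 + y * z * q z.
have key : (z^-1 - y^-1) * d = h.
  have e1 : z - y = - (y * z) * (z^-1 - y^-1) by field; rewrite y0 z0.
  have e2 : z^-1 - y^-1 = h + (z - y) * q z by rewrite -qd ez ey; ring.
  by rewrite /d mulrDr mulr1 {1}e2 e1; ring.
have dge : 2^-1 <= normc d.
  have := cn_lower 1 (y * z * q z); rewrite cn1 !cnM.
  have : normc y * (normc z * normc (q z)) <= 1 * 4^-1.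
    apply: ler_pM; rewrite ?mulr_ge0 ?cn_ge0 //.
    by apply: le_trans zL; rewrite ler_wpM2l ?cn_ge0 // qL.
  rewrite /d; lra.
have d0 : d != 0 by rewrite -cn_gt0; lra.
have quo : h^-1 * (z^-1 - y^-1) = d^-1.
  by apply: (mulIf d0); rewrite -mulrA key !mulVf.
have zy : normc (z - y) <= 2 * normc h.
  have -> : z - y = - (y * z) * (h / d) by rewrite -key; field; rewrite d0 y0 z0.
  rewrite cnM cnN !cnM cnV.
  have : normc y * normc z <= 1 * 1 by apply: ler_pM; rewrite ?cn_ge0.
  rewrite mulr1 => hyz; apply: le_trans (_ : 1 * (normc h / normc d) <= _).
    by rewrite ler_wpM2r // divr_ge0 ?cn_ge0.
  rewrite mul1r ler_pdivrMr; last by lra.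
  have := ler_wpM2l (cn_ge0 h) dge; lra.
rewrite quo; have -> : d^-1 - (lden b y)^-1 = (lden b y - d) / (d * lden b y).
  by field; rewrite d0 ld0.
rewrite cnM cnV cnM ler_pdivrMr; last by rewrite mulr_gt0 //; lra.
have num : normc (lden b y - d) <= (L + k%:R * L) * normc (z - y).
  rewrite qy /d (_ : 1 + y * y * q y - (1 + y * z * q z) =
     y * (- ((z - y) * q y) - z * (q z - q y))); last by ring.
  rewrite cnM -[leRHS]mul1r; apply: ler_pM; rewrite ?cn_ge0 //.
  apply: le_trans (cnB _ _) _; rewrite cnN !cnM mulrDl; apply: lerD.
    by rewrite mulrC ler_wpM2r ?cn_ge0 // qL.
  by rewrite -[leRHS]mul1r; apply: ler_pM; rewrite ?cn_ge0 ?qlip.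
apply: le_trans num _.
have LK : 0 <= L + k%:R * L by rewrite addr_ge0 // mulr_ge0.
have dd : 4^-1 <= normc d * normc (lden b y).
  have -> : 4^-1 = 2^-1 * 2^-1 :> R by field.
  by apply: ler_pM; rewrite ?invr_ge0.
apply: le_trans (_ : 8 * (L + k%:R * L) * normc h * 4^-1 <= _); last first.
  by rewrite ler_wpM2l // !mulr_ge0 ?cn_ge0.
have := ler_wpM2l LK zy; lra.
Qed.

End BranchLogDerivative.

(** * Asymptotics of the recurrence near infinity *)

Section Recurrence.
Variable R : realType.
Local Notation C := (Cnum R).
Variables (k : nat) (a : nat -> C).
Hypothesis k_gt0 : (0 < k)%N.
Local Notation symb := (symb k a).
Local Notation ystar := (ystar k a).
Local Notation lstar := (lstar k a).
Local Notation rho := (branch_radius k a).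
Local Notation B := (symb_bound k a).
Variable t : C.
Hypothesis ht : rho < normc t.
Variables (w : nat -> nat -> nat -> C) (D D' : nat -> nat -> C) (N0 : nat).

Definition gridR (n m : nat) : R := m%:R / n%:R.

Lemma gridR01 n m : (m <= n)%N -> 0 <= gridR n m <= 1.
Proof.
move=> mn; rewrite /gridR divr_ge0 //=; case: n mn => [|n] mn.
  by rewrite invr0 mulr0.
by rewrite ler_pdivrMr ?ltr0n // mul1r ler_nat.
Qed.

Lemma lip01_shift (f : R -> C) : lip01 f -> forall e : R, 0 < e -> exists N, forall n m r,
  (N <= n)%N -> (m <= n)%N -> (r <= k)%N -> normc (f (gridR n (m - r)) - f (gridR n m)) <= e.
Proof.
move=> [K K0 hK] e e0.
have K1 : 0 <= K * k%:R by rewrite mulr_ge0.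
have [N hN] : exists N, K * k%:R / e < N%:R.
  by exists (Num.bound (K * k%:R / e)); apply: archi_boundP; rewrite divr_ge0 // ltW.
exists N.+1 => n m r Nn mn rk.
have n0 : 0 < n%:R :> R by rewrite ltr0n; apply: leq_trans Nn.
apply: le_trans (hK _ _ (gridR01 (leq_trans (leq_subr r m) mn)) (gridR01 mn)) _.
have h : `|gridR n (m - r) - gridR n m| <= k%:R / n%:R.
  rewrite /gridR -mulrBl normrM [X in _ * X]ger0_norm ?invr_ge0 ?(ltW n0) //.
  rewrite ler_wpM2r ?invr_ge0 ?(ltW n0) // distrC.
  have [rm|mr] := leqP r m; first by rewrite natrB // opprB addrC subrK normr_nat ler_nat.
  by rewrite (eqP (ltnW mr : m - r == 0)%N) subr0 normr_nat ler_nat (leq_trans (ltnW mr)).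
apply: le_trans (ler_wpM2l K0 h) _; rewrite mulrA ler_pdivrMr // [leRHS]mulrC -ler_pdivrMr //.
by rewrite ltW // (lt_trans hN) // ltr_nat.
Qed.

(** For r > m the truncated index m - r would produce spurious copies of D n 0 in the recurrence;
    these weights remove them. *)
Hypothesis w_small : forall n m r, (m < r)%N -> w n m r = 0.
Hypothesis w_app : forall r, (r < k)%N ->
  uapp (fun n m => w n m r) (fun n m => symb (gridR n m) r).
Hypothesis D0 : forall n, (N0 <= n)%N -> D n 0 = 1.
Hypothesis D'0 : forall n, (N0 <= n)%N -> D' n 0 = 0.
Hypothesis DS : forall n m, (N0 <= n)%N ->
  D n m.+1 = t * D n m + \sum_(r < k) w n m r * D n (m - r)%N.
Hypothesis D'S : forall n m, (N0 <= n)%N ->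
  D' n m.+1 = D n m + t * D' n m + \sum_(r < k) w n m r * D' n (m - r)%N.

Let W : R := k%:R * B.
Let L : R := k%:R * (k%:R * B).
Let B0 : 0 <= B. Proof. exact: symb_bound_ge0. Qed.
Let W0 : 0 <= W. Proof. by rewrite mulr_ge0. Qed.
Let L0 : 0 <= L. Proof. by rewrite !mulr_ge0. Qed.
Let tWL : 8 + 8 * W + 8 * L < normc t.
Proof. by move: ht; rewrite /branch_radius /far -/W -/L; lra. Qed.

Lemma w_app_unif (e : R) : 0 < e -> exists N, forall n m r, (N <= n)%N -> (m <= n)%N ->
  (r < k)%N -> normc (w n m r - symb (gridR n m) r) <= e.
Proof.
move=> e0; have /choice[N hN] : forall r, exists N, (r < k)%N -> forall n m, (N <= n)%N -> (m <= n)%N ->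
    normc (w n m r - symb (gridR n m) r) <= e.
  move=> r; case: (ltnP r k) => rk; last by exists 0%N.
  by have [N h] := w_app rk e0; exists N.
exists (\max_(r < k) N r)%N => n m r Nn mn rk; apply: hN => //.
by apply: leq_trans Nn; exact: (leq_bigmax (Ordinal rk)).
Qed.

Lemma w_bounded : exists N, forall n m r, (N <= n)%N -> (m <= n)%N -> (r < k)%N ->
  normc (w n m r) <= B.
Proof.
have [N hN] := w_app_unif ltr01; exists N => n m r Nn mn rk.
have := hN n m r Nn mn rk; have := symb_le k a r (gridR01 mn).
have := cnD (w n m r - symb (gridR n m) r) (symb (gridR n m) r); rewrite subrK; lra.
Qed.

(** As long as |D n j| is largest at j = m, the sum in the recurrence is at most W |D n m|, while
    |t| exceeds 8 + 8 W; thus |D n (m + 1)| >= (8 + 7 W) |D n m| and the maximum moves on. *)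
Lemma D_growth : exists2 N, (N0 <= N)%N & forall n, (N <= n)%N -> forall m, (m <= n.+1)%N ->
  D n m != 0 /\ forall j, (j <= m)%N -> normc (D n j) <= normc (D n m).
Proof.
have [N hN] := w_bounded; exists (maxn N0 N); first exact: leq_maxl.
move=> n; rewrite geq_max => /andP[n0 nN]; elim=> [|m IH] mn.
  by rewrite D0 // oner_eq0; split=> // j; rewrite leqn0 => /eqP ->; rewrite D0.
have [Dm0 hD] := IH (ltnW mn).
have h : normc (D n m) * (8 + 7 * W) <= normc (D n m.+1).
  rewrite DS //; apply: le_trans (cn_lower _ _); rewrite cnM.
  have : normc (\sum_(r < k) w n m r * D n (m - r)%N) <= W * normc (D n m).
    apply: le_trans (_ : \sum_(r < k) B * normc (D n m) <= _); last first.
      by rewrite sumr_const card_ord -[_ *+ k]mulr_natl mulrA.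
    apply: cn_sum_le => r _; rewrite cnM; apply: ler_pM; rewrite ?cn_ge0 ?hN //.
    by apply: hD; apply: leq_subr.
  have : 0 <= (normc t - (8 + 8 * W)) * normc (D n m).
    by rewrite mulr_ge0 ?cn_ge0 // subr_ge0; move: tWL L0; lra.
  lra.
have h1 : normc (D n m) <= normc (D n m.+1).
  apply: le_trans h; rewrite -[leLHS]mulr1 ler_wpM2l ?cn_ge0 //; move: W0; lra.
split; first by rewrite -cn_gt0 (lt_le_trans _ h1) // cn_gt0.
move=> j; rewrite leq_eqVlt => /orP[/eqP ->//|jm].
exact: le_trans (hD j jm) h1.
Qed.

(** The reciprocal ratio, so as to approximate [ystar]; X r is then a product of r consecutive such
    ratios. *)
Let y n m : C := D n m / D n m.+1.
Let X r n m : C := D n (m - r)%N / D n m.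

(** X r is a product of r earlier ratios of modulus at most 1. Each differs from [ystar] at m / n by
    e (induction) plus om (the shift along the grid). *)
Lemma X_approx_step n m (e om : R) : (m <= n)%N -> 0 <= e -> 0 <= om ->
  (forall m, (m <= n.+1)%N -> D n m != 0 /\ forall j, (j <= m)%N -> normc (D n j) <= normc (D n m)) ->
  (forall j, (j < m)%N -> normc (y n j - ystar t (gridR n j)) <= e) ->
  (forall r, (r <= k)%N -> normc (ystar t (gridR n (m - r)) - ystar t (gridR n m)) <= om) ->
  forall r, (r <= m)%N -> (r <= k)%N ->
  normc (X r n m - ystar t (gridR n m) ^+ r) <= r%:R * (e + om).
Proof.
move=> mn e0 om0 hD hy hs; elim=> [|r IH] rm rk.
  by rewrite /X subn0 expr0 divff ?subrr ?cn0 ?mul0r //; apply: (hD m (leqW mn)).1.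
have {}IH := IH (ltnW rm) (ltnW rk).
set z := ystar t _ in IH *.
have z1 : normc z <= 1 by have [] := ystarP (gridR01 mn) ht.
have mr : ((m - r.+1).+1 = m - r)%N by rewrite subnSK.
set y' := y n (m - r.+1).
have mrn : (m - r <= n.+1)%N by apply: leq_trans (leq_subr _ _) (leqW mn).
have XE : X r.+1 n m = X r n m * y'.
  rewrite /X /y' /y mr [RHS]mulrC [RHS]mulrA divfK //; exact: (hD _ mrn).1.
have y'1 : normc y' <= 1.
  rewrite /y' /y mr cnM cnV ler_pdivrMr ?mul1r; last by rewrite cn_gt0 (hD _ mrn).1.
  by apply: (hD _ mrn).2; rewrite leq_sub2l.
have y'z : normc (y' - z) <= e + om.
  have h1 : normc (y' - ystar t (gridR n (m - r.+1))) <= e.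
    by apply: hy; rewrite ltn_subrL /= (leq_ltn_trans (leq0n r) rm).
  apply: le_trans (cnDB _ _ _) (lerD h1 (hs _ rk)).
clearbody y'; rewrite XE exprSr [X in normc X](_ : _ = (X r n m - z ^+ r) * y' + z ^+ r * (y' - z)); last by ring.
apply: le_trans (cnD _ _) _; rewrite !cnM -natr1 mulrDl mul1r; apply: lerD.
  by rewrite -[leRHS]mulr1; apply: ler_pM; rewrite ?cn_ge0.
by rewrite -[leRHS]mul1r; apply: ler_pM; rewrite ?cn_ge0 ?exp_le1.
Qed.

Lemma wX_close n m (e om eta : R) : (m <= n)%N -> 0 <= e -> 0 <= om ->
  (forall m, (m <= n.+1)%N -> D n m != 0 /\ forall j, (j <= m)%N -> normc (D n j) <= normc (D n m)) ->
  (forall j, (j < m)%N -> normc (y n j - ystar t (gridR n j)) <= e) ->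
  (forall r, (r <= k)%N -> normc (ystar t (gridR n (m - r)) - ystar t (gridR n m)) <= om) ->
  (forall r, (r < k)%N -> normc (w n m r) <= B) ->
  (forall r, (r < k)%N -> normc (w n m r - symb (gridR n m) r) <= eta) ->
  forall r, (r < k)%N ->
  normc (w n m r * X r n m - symb (gridR n m) r * ystar t (gridR n m) ^+ r)
    <= eta + B * (k%:R * (e + om)).
Proof.
move=> mn e0 om0 hD hy hs hw heta r rk.
set z := ystar t _; have z1 : normc z <= 1 by have [] := ystarP (gridR01 mn) ht.
rewrite [X in normc X](_ : _ = (w n m r - symb (gridR n m) r) * z ^+ r + w n m r * (X r n m - z ^+ r)); last by ring.
apply: le_trans (cnD _ _) _; rewrite !cnM; apply: lerD.
  by rewrite -[leRHS]mulr1; apply: ler_pM; rewrite ?cn_ge0 ?exp_le1 ?heta.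
have [mr|rm] := ltnP m r.
  by rewrite w_small // cn0 mul0r mulr_ge0 // mulr_ge0 // addr_ge0.
apply: ler_pM; rewrite ?cn_ge0 ?hw //.
apply: le_trans (X_approx_step mn e0 om0 hD hy hs rm (ltnW rk)) _.
by rewrite ler_wpM2r ?addr_ge0 // ler_nat ltnW.
Qed.

Lemma y_eq n m : (N0 <= n)%N -> D n m != 0 -> D n m.+1 != 0 ->
  y n m * (t + \sum_(r < k) w n m r * X r n m) = 1.
Proof.
move=> n0 d0 d1.
have -> : \sum_(r < k) w n m r * X r n m = (\sum_(r < k) w n m r * D n (m - r)%N) / D n m.
  by rewrite mulr_suml; apply: eq_bigr => r _; rewrite mulrA.
have -> : t + (\sum_(r < k) w n m r * D n (m - r)%N) / D n m = D n m.+1 / D n m.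
  by rewrite DS //; field.
by rewrite /y; field; rewrite d0 d1.
Qed.

(** Ratio and limit solve equations of the same form, y (t + S) = 1. An error e in the earlier
    ratios changes S by at most e + 2 L e, and division by |t| - W brings this back below e. *)
Lemma uapp_y : uapp y (fun n m => ystar t (gridR n m)).
Proof.
move=> e e0.
have k0 : 0 < k%:R :> R by rewrite ltr0n.
have [N1 N01 h1] := D_growth; have [N2 h2] := w_bounded.
have [N3 h3] := w_app_unif (divr_gt0 e0 k0).
have [N4 h4] := lip01_shift (lip01_ystar ht) e0.
exists (maxn N1 (maxn N2 (maxn N3 N4))) => n m.
rewrite !geq_max => /and4P[n1 n2 n3 n4].
(* The tolerance e stays the same for all m, so nothing accumulates over the n steps. *)
elim/ltn_ind: m => m IH mn.
have hy j : (j < m)%N -> normc (y n j - ystar t (gridR n j)) <= e.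
  by move=> jm; apply: IH => //; apply: leq_trans (ltnW jm) mn.
have hwX := wX_close mn (ltW e0) (ltW e0) (h1 n n1) hy
  (fun r => h4 n m r n4 mn) (fun r => h2 n m r n2 mn) (fun r => h3 n m r n3 mn).
have [dm _] := h1 n n1 m (leqW mn); have [dm1 hdm1] := h1 n n1 m.+1 mn.
have ey := y_eq (leq_trans N01 n1) dm dm1.
have [z1 ez] := ystarP (gridR01 mn) ht.
set z := ystar t _ in hwX z1 ez *; set u := y n m in ey *.
set S := \sum_(r < k) _ in ey; set S' := sym _ _ _ in ez.
have hSS : normc (S - S') <= e + L * (e + e).
  rewrite /S /S' /sym -sumrB.
  apply: le_trans (_ : \sum_(r < k) (e / k%:R + B * (k%:R * (e + e))) <= _).
    by apply: cn_sum_le => r _; apply: hwX.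
  rewrite sumr_const card_ord -[_ *+ k]mulr_natl mulrDr mulrCA mulfV ?gt_eqF // mulr1.
  by rewrite le_eqVlt; apply/orP; left; apply/eqP; rewrite /L; ring.
have S1 : normc S' <= W by apply: sym_le => //; apply: symb_bnd (gridR01 mn).
have u1 : normc u <= 1.
  rewrite /u /y cnM cnV ler_pdivrMr ?cn_gt0 // mul1r; exact: hdm1.
clearbody S S' u z.
have key : normc t * normc (u - z) <= W * normc (u - z) + (e + L * (e + e)).
  rewrite -cnM (_ : t * (u - z) = - ((u - z) * S' + u * (S - S'))).
    rewrite cnN; apply: le_trans (cnD _ _) _; rewrite !cnM; apply: lerD.
      by rewrite mulrC ler_wpM2r ?cn_ge0.
    by rewrite -[leRHS]mul1r; apply: ler_pM; rewrite ?cn_ge0.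
  have eu : u * S = 1 - u * t by rewrite -ey mulrDr [u * t + _]addrC addrK.
  have ev : z * S' = 1 - z * t by rewrite -ez mulrDr [z * t + _]addrC addrK.
  by rewrite [(u - z) * S']mulrBl [u * (S - S')]mulrBr eu ev; ring.
(* |t| - W exceeds 8 + 8 L by [tWL], whereas the perturbation is only e (1 + 2 L). *)
have c0 : (8 + 8 * L) * normc (u - z) <= (8 + 8 * L) * e.
  have : (8 + 8 * L) * normc (u - z) <= (normc t - W) * normc (u - z).
    by rewrite ler_wpM2r ?cn_ge0 //; move: tWL W0; lra.
  have : 0 <= L * e by rewrite mulr_ge0 // ltW.
  move: e0 key; lra.
by rewrite ler_pM2l in c0 => //; move: L0; lra.
Qed.

Lemma uapp_wX (e : R) : 0 < e -> exists N, forall n m r, (N <= n)%N -> (m <= n)%N -> (r < k)%N ->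
  normc (w n m r * X r n m - symb (gridR n m) r * ystar t (gridR n m) ^+ r) <= e.
Proof.
move=> e0; pose e' := e / (1 + B * (k%:R * 2)).
have d0 : 0 < 1 + B * (k%:R * 2) by rewrite ltr_pwDl // !mulr_ge0.
have e'0 : 0 < e' by rewrite divr_gt0.
have [N1 N01 h1] := D_growth; have [N2 h2] := w_bounded.
have [N3 h3] := w_app_unif e'0.
have [N4 h4] := lip01_shift (lip01_ystar ht) e'0.
have [N5 h5] := uapp_y e'0.
exists (maxn N1 (maxn N2 (maxn N3 (maxn N4 N5)))) => n m r.
rewrite !geq_max => /and5P[n1 n2 n3 n4 n5] mn rk.
have hy j : (j < m)%N -> normc (y n j - ystar t (gridR n j)) <= e'.
  by move=> jm; apply: h5 => //; apply: leq_trans (ltnW jm) mn.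
apply: le_trans (wX_close mn (ltW e'0) (ltW e'0) (h1 n n1) hy
  (fun r => h4 n m r n4 mn) (fun r => h2 n m r n2 mn) (fun r => h3 n m r n3 mn) rk) _.
rewrite le_eqVlt; apply/orP; left; apply/eqP.
by rewrite /e'; field; rewrite gt_eqF.
Qed.

Let g n m : C := D' n m / D n m.
(** D' being the derivative of D in t, this is the logarithmic derivative of the ratio D n (m + 1) /
    D n m. *)
Definition rec_log_ratio n m : C := g n m.+1 - g n m.
Local Notation l := rec_log_ratio.

(** The differentiated recurrence divided by D n (m + 1), with [y_eq] used to write g n m itself as
    y (t + S) g n m. Only differences of g remain, and these are sums of earlier [rec_log_ratio]. *)
Lemma rec_log_ratioE n m : (N0 <= n)%N -> (forall j, (j <= m)%N -> D n j != 0) ->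
  D n m.+1 != 0 ->
  l n m = y n m * (1 - \sum_(r < k) w n m r * X r n m * (g n m - g n (m - r))).
Proof.
move=> n0 hD d1; have d0 := hD m (leqnn m).
have ey := y_eq n0 d0 d1; set S := \sum_(r < k) _ in ey.
have gS : g n m.+1 = y n m * (1 + t * g n m + \sum_(r < k) w n m r * X r n m * g n (m - r)).
  have -> : \sum_(r < k) w n m r * X r n m * g n (m - r) =
      (\sum_(r < k) w n m r * D' n (m - r)%N) / D n m.
    rewrite mulr_suml; apply: eq_bigr => r _; rewrite /X /g.
    by field; rewrite d0 hD ?leq_subr.
  by rewrite /g /y D'S //; field; rewrite d0 d1.
rewrite /l gS -[X in _ - X]mulr1 -ey.
under [in RHS]eq_bigr do rewrite mulrBr.
rewrite sumrB -mulr_suml -/S; ring.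
Qed.

(** The limiting form of [rec_log_ratioE], where g n m - g n (m - r), a sum of r nearly equal terms,
    has become r times [lstar]. *)
Lemma lstar_eq tau : 0 <= tau <= 1 -> lstar t tau = ystar t tau *
  (1 - \sum_(r < k) symb tau r * ystar t tau ^+ r * (r%:R * lstar t tau)).
Proof.
move=> htau; have ld := lden_ge htau ht.
have ld0 : lden k (symb tau) (ystar t tau) != 0 by rewrite -cn_gt0; lra.
set z := ystar t tau in ld ld0 *.
have -> : \sum_(r < k) symb tau r * z ^+ r * (r%:R * lstar t tau) =
    (\sum_(r < k) r%:R * symb tau r * z ^+ r) * lstar t tau.
  by rewrite mulr_suml; apply: eq_bigr => r _; ring.
have e : lstar t tau * lden k (symb tau) z = z by rewrite /lstar divfK.
rewrite -[LHS]mulr1 mulrBr mulr1 -{1}e /lden; ring.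
Qed.

Lemma lstar_le1 tau : 0 <= tau <= 1 -> normc (lstar t tau) <= 1.
Proof.
move=> htau; have ld := lden_ge htau ht; have [z4 _] := ystar_le4 htau ht.
rewrite /lstar cnM cnV ler_pdivrMr; lra.
Qed.

Lemma g_diff n m (e om : R) : 0 <= e -> 0 <= om -> (m <= n)%N ->
  (forall j, (j < m)%N -> normc (l n j - lstar t (gridR n j)) <= e) ->
  (forall r, (r <= k)%N -> normc (lstar t (gridR n (m - r)) - lstar t (gridR n m)) <= om) ->
  forall r, (r <= m)%N -> (r <= k)%N ->
  normc ((g n m - g n (m - r)) - r%:R * lstar t (gridR n m)) <= r%:R * (e + om).
Proof.
move=> e0 om0 mn hl hs; elim=> [|r IH] rm rk.
  by rewrite subn0 subrr !mul0r subr0 cn0.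
have {}IH := IH (ltnW rm) (ltnW rk).
have mr : ((m - r.+1).+1 = m - r)%N by rewrite subnSK.
have h1 : normc (l n (m - r.+1) - lstar t (gridR n m)) <= e + om.
  have h1 : normc (l n (m - r.+1) - lstar t (gridR n (m - r.+1))) <= e.
    by apply: hl; rewrite ltn_subrL /= (leq_ltn_trans (leq0n r) rm).
  exact: le_trans (cnDB _ _ _) (lerD h1 (hs _ rk)).
rewrite [X in normc X](_ : _ = (g n m - g n (m - r) - r%:R * lstar t (gridR n m)) +
   (l n (m - r.+1) - lstar t (gridR n m))).
  by apply: le_trans (cnD _ _) _; rewrite -[r.+1%:R]natr1 mulrDl mul1r; apply: lerD.
by rewrite /l mr -natr1; ring.
Qed.

(** The scheme of [uapp_y] again: errors e in the earlier terms alter the sum by at most e + 2 L e,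
    and the factor |y| <= 1 / (8 + 8 L) restores e. *)
Lemma uapp_rec_log_ratio : uapp l (fun n m => lstar t (gridR n m)).
Proof.
move=> e e0; have k0 : 0 < k%:R :> R by rewrite ltr0n.
have L1 : 0 < 4 * (1 + L) by move: L0; lra.
have [N1 N01 h1] := D_growth; have [N2 h2] := w_bounded.
(* This error gets multiplied by r |lstar| <= k and summed over k indices, for a total of e. *)
have [N3 h3] := uapp_wX (divr_gt0 e0 (mulr_gt0 k0 k0)).
have [N4 h4] := lip01_shift (lip01_lstar ht) e0.
(* The error of the ratio is multiplied by |1 - S'| <= 1 + L, leaving e / 4. *)
have [N5 h5] := uapp_y (divr_gt0 e0 L1).
exists (maxn N1 (maxn N2 (maxn N3 (maxn N4 N5)))) => n m.
rewrite !geq_max => /and5P[n1 n2 n3 n4 n5].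
elim/ltn_ind: m => m IH mn.
have hl j : (j < m)%N -> normc (l n j - lstar t (gridR n j)) <= e.
  by move=> jm; apply: IH => //; apply: leq_trans (ltnW jm) mn.
have hG := g_diff (ltW e0) (ltW e0) mn hl (fun r => h4 n m r n4 mn).
have hc r : (r < k)%N -> normc (w n m r * X r n m - symb (gridR n m) r * ystar t (gridR n m) ^+ r)
   <= e / (k%:R * k%:R) by apply: h3.
have hyz : normc (y n m - ystar t (gridR n m)) <= e / (4 * (1 + L)) by apply: h5.
have h01 := gridR01 mn.
have hD j : (j <= m)%N -> D n j != 0.
  by move=> jm; apply: (h1 n n1 j _).1; apply: leq_trans jm (leqW mn).
have [dm hDm] := h1 n n1 m (leqW mn); have [dm1 _] := h1 n n1 m.+1 mn.
have n0 := leq_trans N01 n1.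
have X1 r : normc (X r n m) <= 1.
  rewrite /X cnM cnV ler_pdivrMr ?cn_gt0 // mul1r; apply: hDm; exact: leq_subr.
have cB r : (r < k)%N -> normc (w n m r * X r n m) <= B.
  by move=> rk; rewrite cnM -[leRHS]mulr1; apply: ler_pM; rewrite ?cn_ge0 ?h2.
have wXW : normc (\sum_(r < k) w n m r * X r n m) <= W.
  apply: le_trans (_ : \sum_(r < k) B <= _); last first.
    by rewrite sumr_const card_ord -[_ *+ k]mulr_natl.
  by apply: cn_sum_le => r _; apply: cB.
have yle : normc (y n m) * (8 + 8 * L) <= 1.
  have := congr1 (@normc R) (y_eq n0 dm dm1); rewrite cnM cn1 => ey1.
  rewrite -[leRHS]ey1 ler_wpM2l ?cn_ge0 //; apply: le_trans (cn_lower _ _).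
  move: tWL W0 wXW; lra.
rewrite (rec_log_ratioE n0 hD dm1) (lstar_eq h01).
have l1 := lstar_le1 h01.
set z := ystar t _ in hc hyz *; set u := y n m in hyz yle *.
have z1 : normc z <= 1 by have [] := ystarP h01 ht.
set ls := lstar t _ in hG l1 *; clearbody ls u z.
set S := \sum_(r < k) _; set S' := \sum_(r < k) _.
have hS' : normc S' <= L.
  apply: le_trans (_ : \sum_(r < k) B * k%:R <= _); last first.
    by rewrite sumr_const card_ord -[_ *+ k]mulr_natl /L [B * _]mulrC.
  apply: cn_sum_le => r _; rewrite !cnM cn_nat.
  apply: ler_pM; rewrite ?mulr_ge0 ?cn_ge0 //.
    rewrite -[leRHS]mulr1; apply: ler_pM; rewrite ?cn_ge0 ?exp_le1 //.
    by have := symb_bnd k a h01 r.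
  by rewrite -[leRHS]mulr1; apply: ler_pM; rewrite ?cn_ge0 // ler_nat ltnW.
have hSS : normc (S - S') <= e + 2 * L * e.
  rewrite /S /S' -sumrB.
  apply: le_trans (_ : \sum_(r < k) (e / (k%:R * k%:R) * k%:R + B * (k%:R * (e + e))) <= _); last first.
    rewrite sumr_const card_ord -[_ *+ k]mulr_natl le_eqVlt; apply/orP; left; apply/eqP.
    by rewrite /L; field; rewrite gt_eqF.
  apply: cn_sum_le => r _.
  have hcr := hc r (ltn_ord r); have cBr := cB r (ltn_ord r).
  have hGr := hG r; have c0 : (m < r)%N -> w n m r * X r n m = 0.
    by move=> mr; rewrite w_small // mul0r.
  move: hcr cBr hGr c0; move: (w n m r * X r n m) (g n m - g n (m - r)) => c G.
  move: (symb _ r * _) => bz hcr cBr hGr c0.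
  rewrite [X in normc X](_ : _ = (c - bz) * (r%:R * ls) + c * (G - r%:R * ls)); last by ring.
  apply: le_trans (cnD _ _) _; rewrite !cnM; apply: lerD.
    apply: ler_pM; rewrite ?cn_ge0 ?mulr_ge0 ?cn_ge0 //.
    by rewrite cn_nat -[leRHS]mulr1; apply: ler_pM; rewrite ?cn_ge0 // ler_nat ltnW.
  have [mr|rm] := ltnP m r.
    by rewrite c0 // cn0 mul0r mulr_ge0 // mulr_ge0 // addr_ge0 ?ltW.
  apply: ler_pM; rewrite ?cn_ge0 //.
  apply: le_trans (hGr rm (ltnW (ltn_ord r))) _.
  by rewrite ler_wpM2r ?addr_ge0 ?(ltW e0) // ler_nat ltnW.
clearbody S S'.
rewrite [X in normc X](_ : _ = (u - z) * (1 - S') - u * (S - S')); last by ring.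
apply: le_trans (cnB _ _) _; rewrite !cnM.
have p1 : normc (u - z) * normc (1 - S') <= e / 4.
  have s1 : normc (1 - S') <= 1 + L by apply: le_trans (cnB _ _) _; rewrite cn1 lerD2l.
  apply: le_trans (ler_pM (cn_ge0 _) (cn_ge0 _) hyz s1) _.
  by rewrite le_eqVlt; apply/orP; left; apply/eqP; field; rewrite ?gt_eqF //; move: L0; lra.
have p2 : normc u * normc (S - S') <= normc u * (e + 2 * L * e).
  by rewrite ler_wpM2l ?cn_ge0.
have p3 : normc u * (8 + 8 * L) * e <= 1 * e by rewrite ler_wpM2r // ltW.
have p4 : 0 <= normc u * e by rewrite mulr_ge0 ?cn_ge0 // ltW.
have p5 : 0 <= normc u * L * e by rewrite !mulr_ge0 ?cn_ge0 // ltW.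
lra.
Qed.

Lemma rec_log_derivative_mean (e : R) : 0 < e -> exists N, forall n, (N <= n)%N ->
  D n n.+1 != 0 /\
  normc (n.+1%:R^-1 * (D' n n.+1 / D n n.+1) -
         n.+1%:R^-1 * \sum_(m < n.+1) lstar t (gridR n m)) <= e.
Proof.
move=> e0; have [N hN] := uapp_rec_log_ratio e0; have [N1 N01 h1] := D_growth.
exists (maxn N1 N) => n; rewrite geq_max => /andP[n1 nN].
split; first exact: (h1 n n1 n.+1 (leqnn _)).1.
have n0 := leq_trans N01 n1.
(* A telescoping sum starting at D' n 0 / D n 0 = 0. *)
have -> : D' n n.+1 / D n n.+1 = \sum_(m < n.+1) l n m.
  rewrite -(big_mkord xpredT (l n)) telescope_sumr // /g.
  by rewrite D'0 // mul0r subr0.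
rewrite -mulrBr -sumrB cnM cnV cn_nat ler_pdivrMl ?ltr0n //.
apply: le_trans (_ : \sum_(m < n.+1) e <= _); last first.
  by rewrite sumr_const card_ord -[_ *+ _]mulr_natl.
by apply: cn_sum_le => m _; apply: hN => //; rewrite -ltnS.
Qed.

End Recurrence.

(** * Riemann sums of Lipschitz functions *)

Section RiemannSums.
Variable R : realType.
Local Notation C := (Cnum R).
Local Notation leb := (@lebesgue_measure R).

Lemma lip_within_continuous (g : R -> R) (K : R) : 0 <= K ->
  (forall x y, 0 <= x <= 1 -> 0 <= y <= 1 -> `|g x - g y| <= K * `|x - y|) ->
  {within `[0, 1], continuous g}.
Proof.
(* Clamping to [0, 1] is 1-Lipschitz and extends g to a function continuous on the whole line. *)
move=> K0 hK; pose cl (x : R) := Num.min (Num.max x 0) 1.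
have cl01 x : 0 <= cl x <= 1.
  by rewrite /cl le_min ler01 andbT ge_min lexx orbT andbT le_max lexx orbT.
have clid x : 0 <= x <= 1 -> cl x = x.
  by move=> /andP[x0 x1]; rewrite /cl (max_idPl x0) (min_idPl x1).
have cll x y : `|cl x - cl y| <= `|x - y|.
  rewrite /cl; rewrite /Num.min /Num.max.
  have := ler_norm (x - y); have := ler_norm (y - x); rewrite (distrC y) => h1 h2.
  case: (ltP x 0) => ?; case: (ltP y 0) => ?; rewrite ?ltr01;
    case: (ltP x 1) => ?; case: (ltP y 1) => ?; rewrite ler_norml; lra.
apply: (@subspace_eq_continuous _ _ _ (g \o cl)).
  by move=> x; rewrite inE /= in_itv /= => /clid ->.
apply: continuous_subspaceT => x; apply/cvgrPdist_le => e e0.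
have K1 : 0 < K + 1 by rewrite ltr_wpDl.
near=> y; rewrite /=.
apply: le_trans (hK _ _ (cl01 x) (cl01 y)) _.
have : `|x - y| <= e / (K + 1).
  by near: y; apply: cvgr_dist_le; rewrite ?divr_gt0.
rewrite ler_pdivlMr // => h; apply: le_trans (ler_wpM2l K0 (cll x y)) _.
by have := normr_ge0 (x - y); lra.
Unshelve. all: by end_near.
Qed.

Lemma lip_integrable (g : R -> R) (K : R) : 0 <= K ->
  (forall x y, 0 <= x <= 1 -> 0 <= y <= 1 -> `|g x - g y| <= K * `|x - y|) ->
  leb.-integrable `[0, 1] (EFin \o g).
Proof.
move=> K0 hK; apply: continuous_compact_integrable; first exact: segment_compact.
exact: lip_within_continuous hK.
Qed.

Lemma riemann_step (g : R -> R) (K x y : R) : 0 <= K ->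
  (forall x y, 0 <= x <= 1 -> 0 <= y <= 1 -> `|g x - g y| <= K * `|x - y|) ->
  0 <= x -> x <= y -> y <= 1 ->
  `|(Rintegral leb `[0, y] g - Rintegral leb `[0, x] g) - g x * (y - x)| <= K * (y - x) ^+ 2.
Proof.
move=> K0 hK x0 xy y1; have hi := lip_integrable K0 hK.
have x01 : 0 <= x <= 1 by rewrite x0 (le_trans xy).
have hiy : leb.-integrable `[0, y] (EFin \o g).
  apply: integrableS hi => //; apply: subset_itvl; by rewrite bnd_simp.
rewrite Rintegral_itvB //; try by rewrite bnd_simp.
have hxy : leb.-integrable `]x, y] (EFin \o g).
  by apply: integrableS hiy => //; apply: subset_itvr; rewrite bnd_simp.
have muxy : fine (leb `]x, y]) = y - x.
  rewrite lebesgue_measure_itv /= lte_fin; case: ltP => // yx.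
  by rewrite (le_anti (introT andP (conj xy yx))) subrr.
have icst (c : R) : leb.-integrable `]x, y] (EFin \o (fun=> c)).
  have hc : leb.-integrable `[0, 1] (EFin \o (fun=> c)).
    by apply: (@lip_integrable _ 0) => // u v _ _; rewrite subrr normr0 mul0r.
  by apply: integrableS hc => //; apply: subset_itv; rewrite bnd_simp.
have up : Rintegral leb `]x, y] g <= (g x + K * (y - x)) * (y - x).
  rewrite -{2}muxy -Rintegral_cst //; apply: le_Rintegral => // t /=.
  rewrite in_itv /= => /andP[xt ty].
  have t01 : 0 <= t <= 1 by apply/andP; split; lra.
  have := hK _ _ t01 x01; rewrite ler_norml => /andP[_ h].
  have : K * `|t - x| <= K * (y - x) by rewrite ler_wpM2l // ger0_norm; lra.
  lra.
have lo : (g x - K * (y - x)) * (y - x) <= Rintegral leb `]x, y] g.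
  rewrite -{2}muxy -Rintegral_cst //; apply: le_Rintegral => // t /=.
  rewrite in_itv /= => /andP[xt ty].
  have t01 : 0 <= t <= 1 by apply/andP; split; lra.
  have := hK _ _ t01 x01; rewrite ler_norml => /andP[h _].
  have : K * `|t - x| <= K * (y - x) by rewrite ler_wpM2l // ger0_norm; lra.
  lra.
move: up lo; move: (Rintegral _ _ _) (g x) => I gx; clear => up lo.
rewrite ler_norml expr2; apply/andP; split; lra.
Qed.

(** The recurrence has n + 1 steps with nodes m / n, whereas a subdivision of [0, 1] into n + 1
    intervals has left endpoints m / (n + 1). *)
Lemma grid_shift n m : (m <= n)%N -> `|gridR R n m - m%:R / n.+1%:R| <= n.+1%:R^-1.
Proof.
rewrite /gridR; case: n => [|n'] mn.
  by move: mn; rewrite leqn0 => /eqP ->; rewrite !mul0r subrr normr0 invr_ge0.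
have n0 : 0 < n'.+1%:R :> R by rewrite ltr0n.
have N0 : 0 < n'.+2%:R :> R by rewrite ltr0n.
have -> : m%:R / n'.+1%:R - m%:R / n'.+2%:R = m%:R / n'.+1%:R * n'.+2%:R^-1 :> R.
  by rewrite -[n'.+2%:R]natr1; field; rewrite !gt_eqF // natr1.
rewrite ger0_norm ?mulr_ge0 ?invr_ge0 ?(ltW N0) ?(ltW n0) //.
by rewrite ler_piMl ?invr_ge0 ?(ltW N0) // ler_pdivrMr // mul1r ler_nat.
Qed.

(** One K comes from moving the nodes by [grid_shift], the other from the quadrature error of
    [riemann_step]. *)
Lemma riemann_sum_real (g : R -> R) (K : R) n : 0 <= K ->
  (forall x y, 0 <= x <= 1 -> 0 <= y <= 1 -> `|g x - g y| <= K * `|x - y|) ->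
  `|n.+1%:R^-1 * (\sum_(m < n.+1) g (gridR R n m)) - Rintegral leb `[0, 1] g| <= 2 * K / n.+1%:R.
Proof.
move=> K0 hK; pose N : R := n.+1%:R; have N0 : 0 < N by rewrite ltr0n.
pose x (m : nat) : R := m%:R / N.
pose G x := Rintegral leb `[0, x] g.
have xS m : x m.+1 - x m = N^-1 by rewrite /x -mulrBl -natr1 addrC addKr mul1r.
have x01 (m : nat) : (m <= n.+1)%N -> 0 <= x m <= 1.
  by move=> mn; rewrite divr_ge0 ?(ltW N0) //= ler_pdivrMr // mul1r ler_nat.
have tel : Rintegral leb `[0, 1] g = \sum_(m < n.+1) (G (x m.+1) - G (x m)).
  rewrite -(big_mkord xpredT (fun m => G (x m.+1) - G (x m))) telescope_sumr //.
  rewrite /x mul0r mulfV ?gt_eqF // /G set_itv1 Rintegral_set1 subr0 //.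
rewrite tel mulr_sumr -sumrB; apply: le_trans (ler_norm_sum _ _ _) _.
apply: (@le_trans _ _ (\sum_(m < n.+1) 2 * K / N ^+ 2)); last first.
  rewrite sumr_const card_ord -[_ *+ _]mulr_natl -/N le_eqVlt; apply/orP; left; apply/eqP.
  by field; rewrite gt_eqF.
apply: ler_sum => m _; have mn : (m <= n)%N by rewrite -ltnS.
have /andP[a0 a1] := x01 m (leqW mn); have /andP[b0 b1] := x01 m.+1 mn.
have xx : x m <= x m.+1 by rewrite -subr_ge0 xS invr_ge0 ltW.
have h1 := riemann_step K0 hK a0 xx b1; rewrite xS exprVn -/(G _) -/(G _) in h1.
have h2 : `|g (gridR R n m) - g (x m)| <= K * N^-1.
  apply: le_trans (hK _ _ (gridR01 R mn) (x01 m (leqW mn))) _.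
  by rewrite ler_wpM2l // grid_shift.
have -> : N^-1 * g (gridR R n m) - (G (x m.+1) - G (x m)) =
    (g (gridR R n m) - g (x m)) / N - (G (x m.+1) - G (x m) - g (x m) / N) by ring.
apply: le_trans (ler_normB _ _) _.
have : `|(g (gridR R n m) - g (x m)) / N| <= K * N^-1 * N^-1.
  by rewrite normrM [`|N^-1|]ger0_norm ?invr_ge0 ?(ltW N0) // ler_wpM2r // invr_ge0 ltW.
have -> : 2 * K / N ^+ 2 = K * N^-1 * N^-1 + K / N ^+ 2 by field; rewrite gt_eqF.
by move=> h3; apply: lerD.
Qed.

Lemma lip01_Re (f : R -> C) K : (forall x y, 0 <= x <= 1 -> 0 <= y <= 1 ->
    normc (f x - f y) <= K * `|x - y|) ->
  forall x y, 0 <= x <= 1 -> 0 <= y <= 1 -> `|complex.Re (f x) - complex.Re (f y)| <= K * `|x - y|.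
Proof.
by move=> h x y hx hy; apply: le_trans (h x y hx hy); rewrite -ReN -ReD Re_le_cn.
Qed.

Lemma lip01_Im (f : R -> C) K : (forall x y, 0 <= x <= 1 -> 0 <= y <= 1 ->
    normc (f x - f y) <= K * `|x - y|) ->
  forall x y, 0 <= x <= 1 -> 0 <= y <= 1 -> `|complex.Im (f x) - complex.Im (f y)| <= K * `|x - y|.
Proof.
by move=> h x y hx hy; apply: le_trans (h x y hx hy); rewrite -ImN -ImD Im_le_cn.
Qed.

Lemma lip01_cintegrable (f : R -> C) : lip01 f -> cintegrable leb `[0, 1] f.
Proof.
move=> [K K0 h]; split.
  exact: (lip_integrable K0 (lip01_Re h)).
exact: (lip_integrable K0 (lip01_Im h)).
Qed.

Lemma riemann_sum_cvg (f : R -> C) : lip01 f ->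
  cvgC (fun n => n.+1%:R^-1 * \sum_(m < n.+1) f (gridR R n m)) (cintegral leb `[0, 1] f).
Proof.
move=> [K K0 h] e e0.
have [N hN] : exists N, 4 * K / e < N%:R.
  by exists (Num.bound (4 * K / e)); apply: archi_boundP; rewrite divr_ge0 ?mulr_ge0 // ltW.
exists N => n Nn; apply: le_trans (cn_le_ReIm _) _.
have cR (x : R) (z : C) : complex.Re (x%:C * z) = x * complex.Re z by case: z => u v /=; ring.
have cI (x : R) (z : C) : complex.Im (x%:C * z) = x * complex.Im z by case: z => u v /=; ring.
have -> : (n.+1%:R^-1 : C) = (n.+1%:R^-1)%:C by rewrite natC -fmorphV.
rewrite ReD ImD ReN ImN cR cI Re_sum Im_sum.
have := riemann_sum_real n K0 (lip01_Re h); have := riemann_sum_real n K0 (lip01_Im h).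
have : 4 * K / n.+1%:R <= e.
  rewrite ler_pdivrMr ?ltr0n // [leRHS]mulrC -ler_pdivrMr // ltW // (lt_le_trans hN) //.
  by rewrite ler_nat ltnW.
rewrite /cintegral /= => h1 h2 h3; apply: le_trans (lerD h3 h2) _.
by move: h1; move: (n.+1%:R) => u; clear; lra.
Qed.

End RiemannSums.

(** * Limit of the Cauchy transforms near infinity *)

Section NearInfinity.
Variable R : realType.
Local Notation C := (Cnum R).
Variables (k : nat) (a : nat -> C) (Q : nat -> {poly C}).
Hypothesis k_gt0 : (0 < k)%N.
Hypothesis hQ : high_order_heun k Q.
Hypothesis Qk : Q k = monic_zero_at_origin k a.
Local Notation rho := (branch_radius k a).

(** The integral of g against the root-counting measure, as a finite sum. *)
Definition root_mean n (g : C -> C) : C :=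
  n.+1%:R^-1 * \sum_(z <- van_vleck_roots k Q n) g z.

Lemma coef_monic_zero_at_origin j : (monic_zero_at_origin k a)`_j =
  if j == k.+1 then 1 else if (1 <= j <= k)%N then a j else 0.
Proof.
rewrite /monic_zero_at_origin coefD coefXn coef_sum.
have -> : \sum_(1 <= i < k.+1) (a i *: 'X^i : {poly C})`_j =
    \sum_(1 <= i < k.+1) (if i == j then a j else 0).
  by apply: eq_bigr => i _; rewrite coefZ coefXn eq_sym; case: eqP => [->|]; rewrite ?mulr1 ?mulr0.
rewrite -big_mkcond big_nat1_eq /=; case: eqP => [->|_]; rewrite ?ltnn ?andbF ?addr0 //.
by rewrite add0r ltnS.
Qed.

Let Qk_lead : (Q k)`_k.+1 = 1.
Proof. by rewrite Qk coef_monic_zero_at_origin eqxx. Qed.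

(** For r > k no Q_i reaches that far down, and for r = k only the constant term of Q_k does. It is
    0 because Q_k vanishes at the origin: this makes the recurrence have length k. *)
Lemma pencil_weight_large n m r : (k <= r)%N -> pencil_weight k Q n m r = 0.
Proof.
move=> kr; rewrite /pencil_weight; suff -> : lower_coef k Q m r = 0 by rewrite mulr0 mul0r.
rewrite /lower_coef big_nat_cond big1 // => i /andP[/andP[i1 ik] _].
case: ltnP => [_|ri]; first by rewrite mul0r.
have ->: i = k by apply/eqP; rewrite eqn_leq -ltnS ik (leq_trans kr ri).
have -> : (k - r = 0)%N by apply/eqP; rewrite subn_eq0.
by rewrite Qk coef_monic_zero_at_origin /= mul0r.
Qed.

Lemma pencil_weight_small n m r : (m < r)%N -> pencil_weight k Q n m r = 0.
Proof. by move=> mr; rewrite /pencil_weight lower_coef_small // mulr0 mul0r. Qed.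

Lemma sum_widen (F : nat -> C) p q : (forall r, (p <= r)%N -> F r = 0) ->
  (forall r, (q <= r)%N -> F r = 0) -> \sum_(r < p) F r = \sum_(r < q) F r.
Proof.
have aux s u : (forall r, (s <= r)%N -> F r = 0) -> (s <= u)%N ->
    \sum_(r < s) F r = \sum_(r < u) F r.
  move=> h su; rewrite -!(big_mkord xpredT F) [RHS](@big_cat_nat _ _ _ s) //=.
  by rewrite [X in _ + X]big_nat_cond [X in _ + X]big1 ?addr0 // => r /andP[/andP[/h]].
by move=> hp hq; rewrite (aux p (maxn p q)) ?leq_maxl // -(aux q) ?leq_maxr.
Qed.

Lemma uapp_weight_symb r : (r < k)%N ->
  uapp (fun n m => pencil_weight k Q n m r) (fun n m => symb k a (gridR R n m) r).
Proof.
move=> rk; apply: uapp_eq2 (uapp_pencil_weight k_gt0 Qk_lead r) => // n m mn.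
rewrite /weight_limit /symb rk ltnW // Qk coef_monic_zero_at_origin.
rewrite ifF; last by apply/eqP; lia.
rewrite ifT; last by lia.
have -> : grid R n m ^+ k = (gridR R n m ^+ k)%:C.
  by rewrite /grid /gridR !natC -fmorphV -rmorphM -rmorphXn.
by rewrite mulrC mulrCA mulrA; ring.
Qed.

(** The abstract recurrence is applied to the minors evaluated at t and to their derivatives; at
    index n + 1 the quotient D' / D is the logarithmic derivative of the spectral polynomial. *)
Lemma root_mean_cauchy_cvg (t : C) : rho < normc t ->
  cvgC (fun n => root_mean n (fun z => (t - z)^-1))
       (cintegral (@lebesgue_measure R) `[0, 1] (lstar k a t)).
Proof.
move=> ht; have [N0 hN0] := heun_lambda_separated k_gt0 Qk_lead.
pose D n m := (pencil_minor k Q n m).[t].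
pose D' n m := (pencil_minor k Q n m)^`().[t].
have D0 n : D n 0 = 1 by rewrite /D /pencil_minor /leading_minor det_mx00 hornerC.
have D'0 n : D' n 0 = 0 by rewrite /D' /pencil_minor /leading_minor det_mx00 derivC horner0.
have red n m (E : nat -> C) : \sum_(r < m.+1) pencil_weight k Q n m r * E (m - r)%N =
    \sum_(r < k) pencil_weight k Q n m r * E (m - r)%N.
  apply: (sum_widen (F := fun r => pencil_weight k Q n m r * E (m - r)%N)) => r hr.
    by rewrite pencil_weight_small // mul0r.
  by rewrite pencil_weight_large // mul0r.
have DS n m : (N0 <= n)%N ->
    D n m.+1 = t * D n m + \sum_(r < k) pencil_weight k Q n m r * D n (m - r)%N.
  move=> /hN0[l0 _]; rewrite -(red n m (D n)) /D (pencil_minorS hQ) // hornerD hornerM hornerX.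
  by congr (_ + _); rewrite horner_sum; apply: eq_bigr => r _; rewrite hornerM hornerC.
have D'S n m : (N0 <= n)%N ->
    D' n m.+1 = D n m + t * D' n m + \sum_(r < k) pencil_weight k Q n m r * D' n (m - r)%N.
  move=> /hN0[l0 _]; rewrite -(red n m (D' n)) /D' (pencil_minorS hQ) // derivD derivM derivX mul1r.
  rewrite !hornerD hornerM hornerX.
  congr (_ + _); rewrite raddf_sum horner_sum; apply: eq_bigr => r _.
  by rewrite /= derivM derivC mul0r add0r hornerM hornerC.
have hl := riemann_sum_cvg (lip01_lstar ht).
move=> e e0; have e2 : 0 < e / 2 by rewrite divr_gt0.
have [N1 h1] := hl _ e2.
have [N2 h2] := rec_log_derivative_mean k_gt0 ht pencil_weight_small uapp_weight_symb
  (fun n _ => D0 n) (fun n _ => D'0 n) DS D'S e2.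
exists (maxn N0 (maxn N1 N2)) => n; rewrite !geq_max => /and3P[n0 n1 n2].
have [l0 linj] := hN0 n n0; have [dn hdn] := h2 n n2.
have spE : spectral_poly k Q n = pencil_minor k Q n n.+1.
  by rewrite (spectral_poly_char_poly hQ l0 linj) char_poly_pencil_minor.
have -> : root_mean n (fun z => (t - z)^-1) = n.+1%:R^-1 * (D' n n.+1 / D n n.+1).
  rewrite /root_mean /D' /D -spE /spectral_poly horner_deriv_prod_XsubC.
    rewrite mulrAC mulfV ?mul1r //; move: dn; rewrite /D -spE //.
  by rewrite -root_prod_XsubC -/(spectral_poly k Q n) spE.
apply: le_trans (cnDB _ (n.+1%:R^-1 * \sum_(m < n.+1) lstar k a t (gridR R n m)) _) _.
by have := h1 n n1; move: hdn; lra.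
Qed.

End NearInfinity.

(** * Moments and uniform limits outside a disc *)

Section LogSeries.
Variable R : realType.
Local Notation C := (Cnum R).
Implicit Types (w z t : C).

Lemma geometric_remainder w J : w != 1 ->
  (1 - w)^-1 - \sum_(i < J) w ^+ i = w ^+ J / (1 - w).
Proof.
move=> w1; have d0 : 1 - w != 0 by rewrite subr_eq0 eq_sym.
apply: (mulIf d0); rewrite divfK // mulrBl mulVf //.
by rewrite -[w ^+ J](subrK 1) subrX1; ring.
Qed.

Lemma Re_divc z t : complex.Re (z / t) =
  (complex.Re z * complex.Re t + complex.Im z * complex.Im t) / normc t ^+ 2.
Proof.
by rewrite normc_sqr; case: z => u v; case: t => x y /=; ring.
Qed.

Lemma normc_lt1_neq1 w : normc w < 1 -> w != 1.
Proof. by apply: contraTneq => ->; rewrite cn1 ltxx. Qed.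

Lemma geometric_estimate w (th : R) J : normc w <= th -> th < 1 ->
  normc ((1 - w)^-1 - \sum_(i < J) w ^+ i) <= th ^+ J / (1 - th).
Proof.
move=> wt t1; rewrite geometric_remainder ?normc_lt1_neq1 ?(le_lt_trans wt) //.
have d0 : 0 < 1 - th by rewrite subr_gt0.
have dw : 1 - th <= normc (1 - w) by have := cn_lowerB 1 w; rewrite cn1; lra.
rewrite cnM cnV cnX; apply: ler_pM; rewrite ?exprn_ge0 ?invr_ge0 ?cn_ge0 //.
  by rewrite lerXn2r // nnegrE ?cn_ge0 // (le_trans (cn_ge0 w)).
by rewrite lef_pV2 // posrE // (lt_le_trans d0).
Qed.

(** The mean value theorem along the segment r w, 0 <= r <= 1: the derivative in r of the left-hand
    expression is - Re (w times the remainder of order J - 1 of the geometric series at r w). *)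
Lemma log_estimate w (th : R) J : (0 < J)%N -> normc w <= th -> th < 1 ->
  `|ln (normc (1 - w)) + \sum_(1 <= i < J) complex.Re (w ^+ i) / i%:R| <= th ^+ J / (1 - th).
Proof.
move=> J0 wt t1.
have th0 : 0 <= th := le_trans (cn_ge0 w) wt.
(* q(r) = |1 - r w| ^ 2 and p(r) is the real part of the partial logarithm series at r w: real
   polynomials, so that real differentiation suffices. *)
pose q : {poly R} := 1%:P - (2 * complex.Re w)%:P * 'X + (normc w ^+ 2)%:P * 'X^2.
pose p : {poly R} := \sum_(1 <= i < J) (complex.Re (w ^+ i) / i%:R) *: 'X^i.
have qE (r : R) : q.[r] = normc (1 - r%:C * w) ^+ 2.
  rewrite [RHS]normc_sqr /q [normc w ^+ 2]normc_sqr !hornerE.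
  by case: (w) => u v /=; ring.
have qge (r : R) : 0 <= r <= 1 -> 0 < 1 - th /\ 1 - th <= normc (1 - r%:C * w).
  move=> /andP[r0 r1]; split; first by rewrite subr_gt0.
  have := cn_lowerB 1 (r%:C * w); rewrite cn1 cnM cn_real ger0_norm //.
  have : r * normc w <= 1 * normc w by rewrite ler_wpM2r ?cn_ge0.
  lra.
have q0 (r : R) : 0 <= r <= 1 -> 0 < q.[r].
  by move=> /qge[h1 h2]; rewrite qE exprn_gt0 // (lt_le_trans h1).
pose phi r : R := 2^-1 * ln q.[r] + p.[r].
pose dphi r : R := 2^-1 * (q^`().[r] / q.[r]) + p^`().[r].
have dphiP (r : R) : 0 <= r <= 1 -> is_derive r (1 : R) phi (dphi r).
  move=> r01; rewrite /phi /dphi.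
  have h1 : is_derive r (1 : R) (fun r => ln q.[r]) (q.[r]^-1 *: q^`().[r]).
    by apply: (@is_derive1_comp _ (@ln R) (horner q)); exact: is_derive1_ln (q0 r r01).
  have h2 := is_derive_poly p r.
  have := is_deriveD (is_deriveZ (2^-1 : R) h1) h2.
  rewrite (_ : 2^-1 *: (q.[r]^-1 *: q^`().[r]) + p^`().[r] = 2^-1 * (q^`().[r] / q.[r]) + p^`().[r]) //.
  by rewrite /GRing.scale /= [q^`().[r] / _]mulrC.
have dphi_oo (x : R) : x \in `]0, 1[%R -> is_derive x (1 : R) phi (dphi x).
  by rewrite in_itv /= => /andP[/ltW x0 /ltW x1]; apply: dphiP; rewrite x0 x1.
have cphi : {within `[0, 1], continuous phi}.
  apply: derivable_within_continuous => x; rewrite in_itv /= => hx.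
  exact: (@ex_derive _ _ _ _ _ _ _ (dphiP x hx)).
have [r r01 hr] := MVT ltr01 dphi_oo cphi.
move: r01; rewrite in_itv /= => /andP[/ltW r0 /ltW r1].
have phi1 : phi 1 - phi 0 = ln (normc (1 - w)) + \sum_(1 <= i < J) complex.Re (w ^+ i) / i%:R.
  have d0 : 0 < normc (1 - w).
    by have [h1 h2] := qge 1 (ltac:(by rewrite ler01 lexx)); rewrite mul1r in h2; lra.
  rewrite /phi !qE mul1r mul0r subr0 cn1 expr1n ln1 mulr0 add0r lnXn //.
  have half (x : R) : 2^-1 * (x *+ 2) = x by field.
  rewrite half -addrA; congr (_ + _).
  rewrite /p !horner_sum -sumrB big_nat_cond [RHS]big_nat_cond.
  apply: eq_bigr => i /andP[/andP[i1 _] _].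
  by rewrite !hornerZ !hornerXn expr1n mulr1 expr0n gtn_eqF // mulr0 subr0.
rewrite -phi1 hr subr0 mulr1.
have r01 : 0 <= r <= 1 by rewrite r0 r1.
have [h1 h2] := qge r r01; set d := 1 - r%:C * w in h2.
have -> : dphi r = complex.Re (- (w * (d^-1 - \sum_(i < J.-1) (r%:C * w) ^+ i))).
  rewrite ReN mulrBr ReD ReN opprB addrC /dphi; congr (_ + _).
    have dq : q^`().[r] = 2 * (r * normc w ^+ 2 - complex.Re w).
      rewrite /q !mul_polyC derivD derivB !derivZ derivC derivX derivXn alg_polyC.
      rewrite !(hornerD, hornerN, hornerZ, hornerMn, hornerC, hornerXn) /= expr1; ring.
    have num : complex.Re w * complex.Re d + complex.Im w * complex.Im d =
        complex.Re w - r * normc w ^+ 2.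
      by rewrite normc_sqr /d; case: (w) => u v /=; ring.
    rewrite dq Re_divc num -qE; field; exact: lt0r_neq0 (q0 r r01).
  rewrite /p raddf_sum horner_sum mulr_sumr Re_sum big_add1 /= big_mkord.
  apply: eq_bigr => i _; rewrite derivZ hornerZ derivXn hornerMn hornerXn /=.
  rewrite exprMn mulrCA -exprS -rmorphXn.
  have -> : complex.Re ((r ^+ i)%:C * w ^+ i.+1) = r ^+ i * complex.Re (w ^+ i.+1).
    by case: (w ^+ i.+1) => u v /=; ring.
  by rewrite mulrnAr -mulrnAl -[(_ / _) *+ _]mulr_natr divfK ?pnatr_eq0 // mulrC.
apply: le_trans (Re_le_cn _) _; rewrite cnN cnM.
rewrite -[J in X in _ <= X](prednK J0) exprS -mulrA.
apply: ler_pM; rewrite ?cn_ge0 //; apply: geometric_estimate => //.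
rewrite cnM cn_real ger0_norm //; apply: le_trans wt.
by rewrite ler_piMl ?cn_ge0.
Qed.

End LogSeries.

Section RootMeans.
Variable R : realType.
Local Notation C := (Cnum R).
Variables (k : nat) (a : nat -> C).
Hypothesis k_gt0 : (0 < k)%N.
Implicit Types (Q : nat -> {poly C}) (t z c s : C) (r : R).
Local Notation P0 := (monic_zero_at_origin k a).
Local Notation rm := (@root_mean R k).
Local Notation vv := (@van_vleck_roots R k).

Definition heun_data Q := high_order_heun k Q /\ Q k = P0.
Definition encl c r := 0 < r /\ forall z, root P0 z -> normc (z - c) < r.

Lemma roots_localized Q c r : heun_data Q -> encl c r -> exists N, forall n, (N <= n)%N ->
  size (vv Q n) = n.+1 /\ forall z, z \in vv Q n -> normc (z - c) < r.
Proof.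
move=> [hQ Qk] [r0 hr].
have Qk_lead : (Q k)`_k.+1 = 1 by rewrite Qk coef_monic_zero_at_origin eqxx.
have [N1 h1] := heun_lambda_separated k_gt0 Qk_lead.
have hr' z : root (Q k) z -> normc (z - c) < r by rewrite Qk; apply: hr.
have [N2 h2] := van_vleck_roots_localized k_gt0 hQ r0 hr'.
exists (maxn N1 N2) => n; rewrite geq_max => /andP[n1 n2]; have [l0 linj] := h1 n n1.
by split; [apply: size_van_vleck_roots | move=> z; apply: h2].
Qed.

Lemma P0_neq0 : P0 != 0.
Proof.
apply/eqP => /(congr1 (fun p : {poly C} => p`_k.+1)).
by rewrite coef_monic_zero_at_origin eqxx coef0 => /eqP; rewrite oner_eq0.
Qed.

Lemma encl0 : exists r, encl 0 r.
Proof.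
have [rs Prs] := poly_rootsE P0.
have l0 : lead_coef P0 != 0 by rewrite lead_coef_eq0 P0_neq0.
exists (1 + \sum_(z <- rs) normc z); split.
  by rewrite ltr_pwDl // sumr_ge0 // => z _; apply: cn_ge0.
move=> z; rewrite Prs rootZ // root_prod_XsubC subr0 => zrs.
rewrite (big_rem z) //= addrCA -[ltLHS]addr0 ltrD2l ltr_pwDl // sumr_ge0 // => w _.
exact: cn_ge0.
Qed.

Lemma rm_le Q n (g : C -> C) (M : R) : size (vv Q n) = n.+1 ->
  (forall z, z \in vv Q n -> normc (g z) <= M) -> normc (rm Q n g) <= M.
Proof.
move=> sz hg; rewrite /root_mean cnM cnV cn_nat ler_pdivrMl ?ltr0n //.
apply: le_trans (_ : \sum_(z <- vv Q n) M <= _); last first.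
  by rewrite big_const_seq count_predT sz iter_addr_0 -[_ *+ _]mulr_natl.
rewrite big_seq [leRHS]big_seq; apply: cn_sum_le => z; exact: hg.
Qed.

Lemma rm_cst Q n (x : C) : size (vv Q n) = n.+1 -> rm Q n (fun=> x) = x.
Proof.
move=> sz; rewrite /root_mean big_const_seq count_predT sz iter_addr_0 -[x *+ _]mulr_natl mulKf //.
Qed.

Lemma rmB Q n (g h : C -> C) : rm Q n (fun z => g z - h z) = rm Q n g - rm Q n h.
Proof. by rewrite /root_mean sumrB mulrBr. Qed.

Lemma rmZ Q n (x : C) (g : C -> C) : rm Q n (fun z => x * g z) = x * rm Q n g.
Proof. by rewrite /root_mean -mulr_sumr mulrCA. Qed.

Lemma rm_eq Q n (g h : C -> C) : (forall z, z \in vv Q n -> g z = h z) -> rm Q n g = rm Q n h.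
Proof.
by move=> gh; rewrite /root_mean big_seq [in RHS]big_seq; congr (_ * _); apply: eq_bigr => z /gh.
Qed.

Lemma rm_sum Q n J (F : nat -> C -> C) :
  rm Q n (fun z => \sum_(i < J) F i z) = \sum_(i < J) rm Q n (F i).
Proof. by rewrite /root_mean exchange_big mulr_sumr. Qed.

Definition moment Q n c i := rm Q n (fun z => (z - c) ^+ i).

Lemma geo_small (th K e : R) : 0 <= th -> th < 1 -> 0 <= K -> 0 < e ->
  exists2 J, (0 < J)%N & forall j, (J <= j)%N -> K * (th ^+ j / (1 - th)) <= e.
Proof.
move=> th0 th1 K0 e0; have d0 : 0 < 1 - th by rewrite subr_gt0.
have /cvgrPdist_le : (fun J : nat => K * (th ^+ J / (1 - th))) @ \oo --> K * (0 / (1 - th)).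
  by apply: cvgMr; apply: cvgMl; apply: cvg_expr; rewrite ger0_norm.
move=> /(_ e e0)[N _ hN]; exists N.+1 => // j Nj; have := hN j (ltnW Nj).
by rewrite /= mul0r mulr0 sub0r normrN; apply: le_trans; apply: ler_norm.
Qed.

(** With s = 1 / t, the generating polynomial of the moments at s approximates t times the Cauchy
    transform at t, whose limit near infinity depends on the a_j alone. [cauchy2_coef] then recovers
    the single moments. *)
Lemma moment0_cauchy2 Q Q' i : heun_data Q -> heun_data Q' ->
  cauchy2 (fun n => moment Q n 0 i) (fun n => moment Q' n 0 i).
Proof.
move=> hQ hQ'; have [r1 hr1] := encl0; have [r10 _] := hr1.
(* The truncation degree grows with n: the discarded geometric tail tends to 0, and the coefficient
   i is present once n >= i. *)
pose f Q n : {poly C} := \poly_(j < n.+1) moment Q n 0 j.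
have [N1 h1] := roots_localized hQ hr1; have [N2 h2] := roots_localized hQ' hr1.
have mb Q1 n j : size (vv Q1 n) = n.+1 -> (forall z, z \in vv Q1 n -> normc (z - 0) < r1) ->
    normc (moment Q1 n 0 j) <= r1 ^+ j.
  move=> sz hz; apply: (rm_le sz) => z /hz h; rewrite cnX lerXn2r ?nnegrE ?cn_ge0 ?ltW //.
have fb Q1 N : (forall n, (N <= n)%N -> size (vv Q1 n) = n.+1 /\
     forall z, z \in vv Q1 n -> normc (z - 0) < r1) ->
    forall n j, (N <= n)%N -> normc (f Q1 n)`_j <= 1 * r1 ^+ j.
  move=> h n j Nn; rewrite mul1r coef_poly; case: ltnP => _.
    by have [h3 h4] := h n Nn; apply: mb.
  by rewrite cn0 exprn_ge0 // ltW.
pose rho := branch_radius k a.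
have rho0 : 0 < rho by apply: lt_le_trans (far_ge8 k (symb_bound_ge0 k a)); rewrite ltr0n.
(* The first bound puts 1 / s beyond [branch_radius], the second gives |s z| < 1/2 for all the roots
   z. *)
pose r := Num.min rho^-1 (2 * r1)^-1.
have r0 : 0 < r by rewrite lt_min !invr_gt0 rho0 mulr_gt0.
have val Q1 N (s : C) : heun_data Q1 -> (forall n, (N <= n)%N -> size (vv Q1 n) = n.+1 /\
     forall z, z \in vv Q1 n -> normc (z - 0) < r1) -> s != 0 -> normc s < r ->
   cvgC (fun n => (f Q1 n).[s]) (s^-1 * cintegral (@lebesgue_measure R) `[0, 1] (lstar k a s^-1)).
  move=> [hQ1 Q1k] h s0; rewrite lt_min => /andP[s1 s2].
  have sV : rho < normc s^-1.
    by rewrite cnV -[rho]invrK ltf_pV2 ?posrE ?invr_gt0 // cn_gt0.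
  have lim := cvgCMl s^-1 (root_mean_cauchy_cvg k_gt0 hQ1 Q1k sV).
  have th : r1 * normc s < 2^-1.
    by move: s2; rewrite invfM ltr_pdivlMr // mulrC.
  set th0 := r1 * normc s in th.
  have th00 : 0 <= th0 by rewrite mulr_ge0 ?cn_ge0 ?ltW.
  move=> e e0; have e2 : 0 < e / 2 by rewrite divr_gt0.
  have [N3 h3] := lim _ e2.
  have th1 : th0 < 1 by lra.
  have [J J0 hJ] := geo_small th00 th1 ler01 e2.
  exists (maxn N (maxn N3 J)) => n; rewrite !geq_max => /and3P[nN n3 nJ].
  have [sz hz] := h n nN.
  apply: le_trans (cnDB _ (s^-1 * rm Q1 n (fun z => (s^-1 - z)^-1)) _) _.
  suff : normc ((f Q1 n).[s] - s^-1 * rm Q1 n (fun z => (s^-1 - z)^-1)) <= e / 2.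
    by have := h3 n n3; lra.
  have -> : (f Q1 n).[s] = rm Q1 n (fun z => \sum_(j < n.+1) (s * z) ^+ j).
    rewrite (rm_sum Q1 n n.+1 (fun j z => (s * z) ^+ j)) horner_poly; apply: eq_bigr => j _.
    rewrite mulrC -rmZ; apply: rm_eq => z _; by rewrite subr0 exprMn.
  rewrite -rmZ -rmB; apply: (rm_le sz) => z zn.
  have hw : normc (s * z) <= th0.
    by rewrite cnM mulrC ler_wpM2r ?cn_ge0 // ltW //; have := hz z zn; rewrite subr0.
  have -> : s^-1 * (s^-1 - z)^-1 = (1 - s * z)^-1.
    by rewrite -invfM mulrBr mulfV.
  rewrite cnBC; apply: le_trans (geometric_estimate n.+1 hw th1) _.
  by have := hJ n.+1 (leqW nJ); rewrite mul1r.
have key : cauchy2 (fun n => (f Q n)`_i) (fun n => (f Q' n)`_i).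
  apply: (@cauchy2_coef _ (f Q) (f Q') 1 r1 r (maxn N1 N2)) => //; first exact: ltW.
  - by move=> n j; rewrite geq_max => /andP[n1 _]; apply: fb n1.
  - by move=> n j; rewrite geq_max => /andP[_ n2]; apply: fb n2.
  move=> s s0 sr e e0; have e2 : 0 < e / 2 by rewrite divr_gt0.
  have [M1 g1] := val Q N1 s hQ h1 s0 sr _ e2; have [M2 g2] := val Q' N2 s hQ' h2 s0 sr _ e2.
  exists (maxn M1 M2) => n n'; rewrite !geq_max => /andP[n1 _] /andP[_ n2].
  apply: le_trans (cnDB _ (s^-1 * cintegral (@lebesgue_measure R) `[0, 1] (lstar k a s^-1)) _) _.
  have := g1 n n1; have := g2 n' n2; rewrite cnBC => hb ha.
  by apply: le_trans (lerD ha hb) _; rewrite -splitr.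
move=> e e0; have [N hN] := key e e0; exists (maxn N i) => n n'.
rewrite !geq_max => /andP[n1 ni] /andP[n2 ni'].
by have := hN n n' n1 n2; rewrite !coef_poly !ltnS ni ni'.
Qed.

Lemma moment_cauchy2 Q Q' c i : heun_data Q -> heun_data Q' ->
  cauchy2 (fun n => moment Q n c i) (fun n => moment Q' n c i).
Proof.
move=> hQ hQ'; pose p : {poly C} := ('X - c%:P) ^+ i.
have mE Q1 n : moment Q1 n c i = \sum_(j < size p) p`_j * moment Q1 n 0 j.
  rewrite (_ : \sum_(j < size p) _ = rm Q1 n (fun z => \sum_(j < size p) p`_j * (z - 0) ^+ j)).
    apply: rm_eq => z _; rewrite -[LHS](_ : p.[z] = _); last by rewrite horner_exp hornerXsubC.
    by rewrite horner_coef; apply: eq_bigr => j _; rewrite subr0.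
  rewrite (rm_sum Q1 n (size p) (fun j z => p`_j * (z - 0) ^+ j)).
  by apply: eq_bigr => j _; rewrite rmZ.
pose K := \sum_(j < size p) normc p`_j.
have K0 : 0 <= K by apply: sumr_ge0 => j _; apply: cn_ge0.
move=> e e0; have e1 : 0 < e / (K + 1) by rewrite divr_gt0 // ltr_wpDl.
have /choice[N hN] : forall j, exists N, forall n n', (N <= n)%N -> (N <= n')%N ->
    normc (moment Q n 0 j - moment Q' n' 0 j) <= e / (K + 1).
  by move=> j; apply: moment0_cauchy2.
exists (\max_(j < size p) N j)%N => n n' nN nN'; rewrite !mE -sumrB.
apply: le_trans (_ : \sum_(j < size p) normc p`_j * (e / (K + 1)) <= _).
  apply: cn_sum_le => j _; rewrite -mulrBr cnM ler_wpM2l ?cn_ge0 //.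
  have Nj : (N j <= \max_(j < size p) N j)%N by apply: (leq_bigmax j).
  by apply: hN; [apply: leq_trans nN | apply: leq_trans nN'].
rewrite -mulr_suml -/K mulrA ler_pdivrMr ?ltr_wpDl // mulrC ler_wpM2l ?ltW //; lra.
Qed.

(* [h] is the identity for Cauchy transforms and the real part for logarithmic
   potentials. *)
Lemma uniform_cauchy2 (h : C -> C) (T : C -> Prop) c r (Phi : C -> C -> C)
    (A : nat -> C -> C) (K : nat -> R) Q Q' :
  (forall x y, h (x + y) = h x + h y) -> (forall (x : R) y, h (x%:C * y) = x%:C * h y) ->
  (forall x, normc (h x) <= normc x) ->
  encl c r -> heun_data Q -> heun_data Q' ->
  (forall i t, T t -> normc (A i t) <= K i) ->
  (forall e : R, 0 < e -> exists J, forall t z, T t -> normc (z - c) < r ->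
     normc (Phi t z - h (\sum_(i < J) A i t * (z - c) ^+ i)) <= e) ->
  forall e : R, 0 < e -> exists N, forall n n', (N <= n)%N -> (N <= n')%N -> forall t, T t ->
    normc (rm Q n (Phi t) - rm Q' n' (Phi t)) <= e.
Proof.
move=> hD hZ h1 hc hQ hQ' hA hPhi e e0; have e4 : 0 < e / 4 by rewrite divr_gt0.
have h0 : h 0 = 0 by apply: (addrI (h 0)); rewrite -hD !addr0.
have hS (s : seq C) (F : C -> C) : h (\sum_(z <- s) F z) = \sum_(z <- s) h (F z).
  by elim: s => [|x s IH]; rewrite ?big_nil // !big_cons hD IH.
have hrm Q1 n (F : C -> C) : rm Q1 n (fun z => h (F z)) = h (rm Q1 n F).
  by rewrite /root_mean -hS natC -fmorphV hZ.
have [J hJ] := hPhi _ e4.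
pose S t z := \sum_(i < J) A i t * (z - c) ^+ i.
have rmS Q1 n t : rm Q1 n (S t) = \sum_(i < J) A i t * moment Q1 n c i.
  rewrite /S (rm_sum Q1 n J (fun i z => A i t * (z - c) ^+ i)).
  by apply: eq_bigr => i _; rewrite rmZ.
pose K1 := \sum_(i < J) `|K i|.
have K10 : 0 <= K1 by apply: sumr_ge0.
have e1 : 0 < e / 2 / (K1 + 1) by rewrite !divr_gt0 // ltr_wpDl.
have /choice[N hN] : forall i, exists N, forall n n', (N <= n)%N -> (N <= n')%N ->
    normc (moment Q n c i - moment Q' n' c i) <= e / 2 / (K1 + 1).
  by move=> i; apply: moment_cauchy2.
have [N1 hN1] := roots_localized hQ hc; have [N2 hN2] := roots_localized hQ' hc.
exists (maxn (\max_(i < J) N i) (maxn N1 N2))%N => n n'.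
rewrite !geq_max => /and3P[n0 n1 _] /and3P[n0' _ n2] t Tt.
have app Q1 m : size (vv Q1 m) = m.+1 /\ (forall z, z \in vv Q1 m -> normc (z - c) < r) ->
    normc (rm Q1 m (Phi t) - h (rm Q1 m (S t))) <= e / 4.
  by move=> [sz hz]; rewrite -hrm -rmB; apply: (rm_le sz) => z /hz; apply: hJ.
have a1 := app Q n (hN1 n n1); have a2 := app Q' n' (hN2 n' n2).
have mid : normc (h (rm Q n (S t)) - h (rm Q' n' (S t))) <= e / 2.
  have -> : h (rm Q n (S t)) - h (rm Q' n' (S t)) = h (rm Q n (S t) - rm Q' n' (S t)).
    apply: (addIr (h (rm Q' n' (S t)))); rewrite -hD !subrK //.
  apply: le_trans (h1 _) _; rewrite !rmS -sumrB.
  apply: le_trans (_ : \sum_(i < J) `|K i| * (e / 2 / (K1 + 1)) <= _).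
    apply: cn_sum_le => i _; rewrite -mulrBr cnM.
    apply: ler_pM; rewrite ?cn_ge0 //; first by apply: le_trans (hA i t Tt) (ler_norm _).
    have Ni : (N i <= \max_(i < J) N i)%N by apply: (leq_bigmax i).
    by apply: hN; [apply: leq_trans n0 | apply: leq_trans n0'].
  rewrite -mulr_suml -/K1 mulrA ler_pdivrMr ?ltr_wpDl // mulrC ler_wpM2l ?divr_ge0 ?ltW //; lra.
have := cnDB (rm Q n (Phi t)) (h (rm Q n (S t))) (rm Q' n' (Phi t)).
have := cnDB (h (rm Q n (S t))) (h (rm Q' n' (S t))) (rm Q' n' (Phi t)).
rewrite [normc (h (rm Q' n' (S t)) - rm Q' n' (Phi t))]cnBC; lra.
Qed.

End RootMeans.

(** * Limit functions outside enclosing discs *)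

Section ExteriorLimits.
Variable R : realType.
Local Notation C := (Cnum R).
Variables (k : nat) (a : nat -> C).
Hypothesis k_gt0 : (0 < k)%N.
Implicit Types (Q : nat -> {poly C}) (t z c s : C) (r : R).
Local Notation P0 := (monic_zero_at_origin k a).
Local Notation rm := (@root_mean R k).
Local Notation vv := (@van_vleck_roots R k).
Local Notation heun_data := (heun_data k a).
Local Notation encl := (encl k a).

(** Embedded in the complex numbers so that [root_mean] and [uniform_cauchy2] serve both kernels. *)
Definition logC z : C := (ln (normc z))%:C.

Lemma real_complexB (x y : R) : (x - y)%:C = (x%:C : C) - y%:C.
Proof. exact: rmorphB. Qed.

Lemma factor_sub t z c : t != c -> t - z = (t - c) * (1 - (z - c) / (t - c)).
Proof. by move=> tc; field; rewrite subr_eq0. Qed.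

(** 1 / (t - z) expands in powers of (z - c) / (t - c), of modulus at most r / r', with coefficients
    bounded uniformly in t. *)
Lemma cauchy_uniform c r r' Q Q' : encl c r -> r < r' -> heun_data Q -> heun_data Q' ->
  forall e : R, 0 < e -> exists N, forall n n', (N <= n)%N -> (N <= n')%N ->
  forall t, r' <= normc (t - c) ->
    normc (rm Q n (fun z => (t - z)^-1) - rm Q' n' (fun z => (t - z)^-1)) <= e.
Proof.
move=> hc rr hQ hQ'; have r0 : 0 < r by case: hc.
have r'0 : 0 < r' by lra.
have th0 : 0 <= r / r' by rewrite divr_ge0 // ltW.
have th1 : r / r' < 1 by rewrite ltr_pdivrMr // mul1r.
apply: (@uniform_cauchy2 R k a k_gt0 id (fun t => r' <= normc (t - c)) c r
  (fun t z => (t - z)^-1) (fun i t => (t - c) ^- i.+1) (fun i => r' ^- i.+1)) => //.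
  move=> i t tr; rewrite cnV cnX lef_pV2 ?posrE ?exprn_gt0 ?(lt_le_trans r'0) //.
  by rewrite lerXn2r // nnegrE ?cn_ge0 ?ltW.
move=> e e0; have r'i : 0 <= r'^-1 by rewrite invr_ge0 ltW.
have [J J0 hJ] := geo_small th0 th1 r'i e0; exists J => t z tr zr.
have tc : t != c by rewrite -subr_eq0 -cn_gt0 (lt_le_trans r'0).
have tc0 : t - c != 0 by rewrite subr_eq0.
have wle : normc ((z - c) / (t - c)) <= r / r'.
  rewrite cnM cnV; apply: ler_pM; rewrite ?invr_ge0 ?cn_ge0 ?(ltW zr) //.
  by rewrite lef_pV2 ?posrE // (lt_le_trans r'0).
have -> : (t - z)^-1 - \sum_(i < J) (t - c) ^- i.+1 * (z - c) ^+ i =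
    (t - c)^-1 * ((1 - (z - c) / (t - c))^-1 - \sum_(i < J) ((z - c) / (t - c)) ^+ i).
  rewrite (factor_sub z tc) invfM mulrBr; congr (_ - _).
  rewrite mulr_sumr; apply: eq_bigr => i _; rewrite exprSr invfM expr_div_n; ring.
rewrite cnM cnV; apply: le_trans (hJ J (leqnn J)).
apply: ler_pM; rewrite ?invr_ge0 ?cn_ge0 //.
  by rewrite lef_pV2 ?posrE // (lt_le_trans r'0).
exact: geometric_estimate.
Qed.

Lemma log_uniform c r r' Q Q' : encl c r -> r < r' -> heun_data Q -> heun_data Q' ->
  forall e : R, 0 < e -> exists N, forall n n', (N <= n)%N -> (N <= n')%N ->
  forall t, r' <= normc (t - c) ->
    normc (rm Q n (fun z => logC (t - z)) - rm Q' n' (fun z => logC (t - z))) <= e.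
Proof.
move=> hc rr hQ hQ' e e0; have r0 : 0 < r by case: hc.
have r'0 : 0 < r' by lra.
have th0 : 0 <= r / r' by rewrite divr_ge0 // ltW.
have th1 : r / r' < 1 by rewrite ltr_pdivrMr // mul1r.
pose h (x : C) : C := (complex.Re x)%:C.
have hD x y : h (x + y) = h x + h y by rewrite /h ReD rmorphD.
have hZ (x : R) y : h (x%:C * y) = x%:C * h y.
  by rewrite /h -rmorphM Re_mul /= mul0r subr0.
have h1 x : normc (h x) <= normc x by rewrite /h cn_real Re_le_cn.
(* Coefficients of log (1 - (z - c) / (t - c)) in powers of z - c; its real part is taken by h. *)
pose A i t : C := if i == 0%N then 0 else - (i%:R * (t - c) ^+ i)^-1.
have hA i t : r' <= normc (t - c) -> normc (A i t) <= r' ^- i.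
  move=> tr; rewrite /A; case: eqP => [->|/eqP i0]; first by rewrite cn0 expr0 invr1.
  rewrite cnN cnV cnM cn_nat cnX invfM -[leRHS]mul1r.
  apply: ler_pM; rewrite ?invr_ge0 ?exprn_ge0 ?cn_ge0 //.
    by rewrite invf_le1 ?ltr0n ?lt0n // ler1n lt0n.
  rewrite lef_pV2 ?posrE ?exprn_gt0 ?(lt_le_trans r'0) //.
  by rewrite lerXn2r // nnegrE ?cn_ge0 ?ltW.
(* The term log |t - c|, unbounded in t, is subtracted first. It does not depend on z, so it cancels
   in the difference of the two means. *)
have hPhi (e' : R) : 0 < e' -> exists J, forall t z, r' <= normc (t - c) -> normc (z - c) < r ->
   normc (logC (t - z) - logC (t - c) - h (\sum_(i < J) A i t * (z - c) ^+ i)) <= e'.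
  move=> e'0; have [J J0 hJ] := geo_small th0 th1 ler01 e'0; exists J => t z tr zr.
  have tc : t != c by rewrite -subr_eq0 -cn_gt0 (lt_le_trans r'0).
  have tc0 : t - c != 0 by rewrite subr_eq0.
  set w := (z - c) / (t - c).
  have wle : normc w <= r / r'.
    rewrite cnM cnV; apply: ler_pM; rewrite ?invr_ge0 ?cn_ge0 ?(ltW zr) //.
    by rewrite lef_pV2 ?posrE // (lt_le_trans r'0).
  have w1 : 0 < normc (1 - w).
    by have := cn_lowerB 1 w; rewrite cn1; lra.
  have -> : h (\sum_(i < J) A i t * (z - c) ^+ i) =
      (- \sum_(1 <= i < J) complex.Re (w ^+ i) / i%:R)%:C.
    rewrite /h Re_sum; congr (_%:C).
    rewrite -(big_mkord xpredT (fun i => complex.Re (A i t * (z - c) ^+ i))) big_ltn //.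
    rewrite {1}/A eqxx mul0r {1}/complex.Re /= add0r -sumrN big_nat_cond [RHS]big_nat_cond /A.
    apply: eq_bigr => i /andP[/andP[i1 _] _]; rewrite gtn_eqF // mulNr ReN; congr (- _).
    rewrite invfM -mulrA [_^-1 * _ ^+ _]mulrC -expr_div_n -/w natC -fmorphV.
    by rewrite Re_mul /= mul0r subr0 mulrC.
  rewrite /logC (factor_sub z tc) -/w cnM lnM ?posrE ?(cn_gt0 (t - c)) // -!real_complexB cn_real.
  rewrite [X in X - _]addrAC subrr add0r opprK.
  by apply: le_trans (log_estimate J0 wle th1) _; have := hJ J (leqnn J); rewrite mul1r.
have [N hN] := @uniform_cauchy2 R k a k_gt0 h (fun t => r' <= normc (t - c)) c r
  (fun t z => logC (t - z) - logC (t - c)) A (fun i => r' ^- i) Q Q' hD hZ h1 hc hQ hQ'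
  hA hPhi e e0.
have [N1 hN1] := roots_localized k_gt0 hQ hc; have [N2 hN2] := roots_localized k_gt0 hQ' hc.
exists (maxn N (maxn N1 N2)) => n n'; rewrite !geq_max => /and3P[a0 a1 _] /and3P[b0 _ b2] t tr.
have := hN n n' a0 b0 t tr; rewrite !rmB (rm_cst _ (hN1 n a1).1) (rm_cst _ (hN2 n' b2).1).
by rewrite opprB addrA subrK.
Qed.

(* Any operator with leading coefficient P0 would do, as the limits do not depend on
   it; for this one they are taken with respect to a fixed sequence. *)
Definition model i : {poly C} := if i == k then P0 else 0.

Lemma size_P0 : size P0 = k.+2.
Proof.
apply/eqP; rewrite eqn_leq; apply/andP; split.
  apply/leq_sizeP => j kj; rewrite coef_monic_zero_at_origin gtn_eqF //.
  by rewrite ifF //; lia.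
rewrite ltnNge; apply/negP => /leq_sizeP /(_ k.+1 (leqnn _)).
by rewrite coef_monic_zero_at_origin eqxx => /eqP; rewrite oner_eq0.
Qed.

Lemma heun_model : heun_data model.
Proof.
split; last by rewrite /model eqxx.
split; last by rewrite /model eqxx size_P0.
by move=> i _; rewrite /model; case: eqP => [->|_]; rewrite ?size_P0 ?size_poly0.
Qed.

Definition CQ t : C := xget 0 [set l | cvgC (fun n => rm model n (fun z => (t - z)^-1)) l].
Definition UQC t : C := xget 0 [set l | cvgC (fun n => rm model n (fun z => logC (t - z))) l].
Definition UQ t : R := complex.Re (UQC t).

(** In the comparison of Q with [model], the index of [model] is sent to infinity; the comparison of
    [model] with itself shows that its limit exists. *)
Lemma uniform_limit (T : C -> Prop) (Phi : C -> C -> C) (lim : C -> C) Q :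
  (forall t, lim t = xget 0 [set l | cvgC (fun n => rm model n (Phi t)) l]) ->
  (forall Q, heun_data Q -> forall e : R, 0 < e -> exists N, forall n n', (N <= n)%N -> (N <= n')%N ->
    forall t, T t -> normc (rm Q n (Phi t) - rm model n' (Phi t)) <= e) ->
  heun_data Q -> forall e : R, 0 < e -> exists N, forall n, (N <= n)%N ->
    forall t, T t -> normc (rm Q n (Phi t) - lim t) <= e.
Proof.
move=> hlim hcau hQ e e0; have [N hN] := hcau Q hQ e e0; exists N => n Nn t Tt.
have hc : cvgC (fun n => rm model n (Phi t)) (lim t).
  rewrite hlim; case: xgetP => [l _ //|no].
  have [l hl] : exists l, cvgC (fun n => rm model n (Phi t)) l.
    apply: cauchyC_cvg => e1 /(hcau model heun_model)[N1 h1]; exists N1 => m m' a1 a2.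
    exact: h1.
  by have := no l.
apply: cvgC_lim_le (cvgC_cst _) hc _; exists N => m Nm; exact: hN.
Qed.

Lemma CQ_uniform c r r' Q : encl c r -> r < r' -> heun_data Q ->
  forall e : R, 0 < e -> exists N, forall n, (N <= n)%N -> forall t, r' <= normc (t - c) ->
    normc (rm Q n (fun z => (t - z)^-1) - CQ t) <= e.
Proof.
move=> hc rr; apply: (uniform_limit (T := fun t => r' <= normc (t - c)) (Phi := fun t z => (t - z)^-1)) => //.
by move=> Q1 hQ1; apply: (cauchy_uniform hc rr hQ1 heun_model).
Qed.

Lemma UQC_uniform c r r' Q : encl c r -> r < r' -> heun_data Q ->
  forall e : R, 0 < e -> exists N, forall n, (N <= n)%N -> forall t, r' <= normc (t - c) ->
    normc (rm Q n (fun z => logC (t - z)) - UQC t) <= e.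
Proof.
move=> hc rr; apply: (uniform_limit (T := fun t => r' <= normc (t - c)) (Phi := fun t z => logC (t - z))) => //.
by move=> Q1 hQ1; apply: (log_uniform hc rr hQ1 heun_model).
Qed.

(** The form in which the complement of the hull enters all estimates; [exterior_zero_hull] makes
    the link. *)
Definition exterior t := exists c r, encl c r /\ r < normc (t - c).

Lemma CQ_cvg t Q : exterior t -> heun_data Q ->
  cvgC (fun n => rm Q n (fun z => (t - z)^-1)) (CQ t).
Proof.
move=> [c [r [hc rt]]] hQ e e0; have [N hN] := CQ_uniform hc rt hQ e0.
by exists N => n Nn; apply: hN.
Qed.

Lemma UQC_cvg t Q : exterior t -> heun_data Q ->
  cvgC (fun n => rm Q n (fun z => logC (t - z))) (UQC t).
Proof.
move=> [c [r [hc rt]]] hQ e e0; have [N hN] := UQC_uniform hc rt hQ e0.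
by exists N => n Nn; apply: hN.
Qed.

Lemma CQ_branch t : branch_radius k a < normc t ->
  (exists r, encl 0 r /\ r < normc t) ->
  CQ t = cintegral (@lebesgue_measure R) `[0, 1] (lstar k a t).
Proof.
move=> ht [r [hr rt]]; have hext : exterior t by exists 0, r; rewrite subr0.
have [h1 h2] := heun_model.
exact: cvgC_unique (CQ_cvg hext heun_model) (root_mean_cauchy_cvg k_gt0 h1 h2 ht).
Qed.

Lemma exterior_dist t : exterior t -> exists2 delta : R, 0 < delta & exists N, forall n, (N <= n)%N ->
  size (vv model n) = n.+1 /\ forall z, z \in vv model n -> delta <= normc (t - z).
Proof.
move=> [c [r [hc rt]]]; exists (normc (t - c) - r); first by rewrite subr_gt0.
have [N hN] := roots_localized k_gt0 heun_model hc; exists N => n /hN[sz hz]; split=> // z /hz.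
by have := cn_lowerB (t - c) (z - c); rewrite opprB addrA subrK; lra.
Qed.

Lemma exterior_open t : exterior t -> exists2 d : R, 0 < d & forall s, normc s < d -> exterior (t + s).
Proof.
move=> [c [r [hc rt]]]; exists (normc (t - c) - r); first by rewrite subr_gt0.
move=> s hs; exists c, r; split=> //.
by have := cn_lower (t - c) s; rewrite addrAC; lra.
Qed.

End ExteriorLimits.

(** * Analyticity and harmonicity *)

Section ExteriorAnalytic.
Variable R : realType.
Local Notation C := (Cnum R).
Variables (k : nat) (a : nat -> C).
Hypothesis k_gt0 : (0 < k)%N.
Implicit Types (t z c s : C) (r d K : R).
Local Notation rm := (@root_mean R k).
Local Notation vv := (@van_vleck_roots R k).
Local Notation model := (model k a).
Local Notation exterior := (exterior k a).
Local Notation CQ := (CQ k a).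
Local Notation UQ := (UQ k a).
Local Notation UQC := (UQC k a).

(** The complex derivative of [CQ], as the limit of the means of the differentiated kernel. *)
Definition DQ t : C := xget 0 [set l | cvgC (fun n => rm model n (fun z => - (t - z) ^- 2)) l].

Lemma sub_nearP t z s : z != t -> t + s - z = (t - z) * (1 - - s / (t - z)).
Proof. by move=> zt; field; rewrite subr_eq0 eq_sym. Qed.

(** The roots stay at distance delta from t, so the means of the Taylor coefficients of 1 / (t + s -
    z) in s are bounded geometrically, uniformly in n, and [poly_limit_series] applies. *)
Lemma CQ_expansion t : exterior t -> exists (c : nat -> C) r, [/\ 0 < r,
  forall j, cvgC (fun n => rm model n (fun z => (-1) ^+ j * (t - z) ^- j.+1)) (c j) &
  forall s, normc s < r -> cvgC (fun J => \sum_(i < J) c i * s ^+ i) (CQ (t + s))].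
Proof.
move=> ht; have [delta d0 [N hN]] := exterior_dist k_gt0 ht.
have [d d1 hd] := exterior_open ht.
pose r := Num.min d (delta / 2).
have r0 : 0 < r by rewrite lt_min d1 divr_gt0.
pose g j z : C := (-1) ^+ j * (t - z) ^- j.+1.
pose f n : {poly C} := \poly_(j < n.+1) rm model n (g j).
have gb n z j : (N <= n)%N -> z \in vv model n -> normc (g j z) <= delta ^- j.+1.
  move=> /hN[_ hz] /hz h; rewrite /g cnM cnX cnN cn1 expr1n mul1r cnV cnX.
  by rewrite lef_pV2 ?posrE ?exprn_gt0 ?(lt_le_trans d0) // lerXn2r // nnegrE ?cn_ge0 ?ltW.
have db : delta^-1 <= r^-1.
  rewrite lef_pV2 ?posrE //; apply: le_trans (_ : delta / 2 <= _); first by rewrite ge_min lexx orbT.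
  lra.
have fb n j : (N <= n)%N -> normc (f n)`_j <= delta^-1 * r^-1 ^+ j.
  move=> Nn; rewrite coef_poly; case: ltnP => _; last first.
    by rewrite cn0 mulr_ge0 ?exprn_ge0 // invr_ge0 ltW.
  apply: le_trans (_ : delta ^- j.+1 <= _).
    by have [sz _] := hN n Nn; apply: (rm_le sz) => z; apply: gb.
  by rewrite exprS invfM -exprVn ler_wpM2l ?invr_ge0 ?(ltW d0) // lerXn2r // nnegrE invr_ge0 ltW.
have fs s : normc s < r^-1^-1 -> cvgC (fun n => (f n).[s]) (CQ (t + s)).
  rewrite invrK lt_min => /andP[s1 s2] e e0; have e2 : 0 < e / 2 by rewrite divr_gt0.
  have [N1 h1] := CQ_cvg k_gt0 (hd s s1) (heun_model a k_gt0) e2.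
  have th0 : 0 <= normc s / delta by rewrite divr_ge0 ?cn_ge0 ?ltW.
  have th1 : normc s / delta < 1 by rewrite ltr_pdivrMr //; lra.
  have dV : 0 <= delta^-1 by rewrite invr_ge0 ltW.
  have [J J0 hJ] := geo_small th0 th1 dV e2.
  exists (maxn N (maxn N1 J)) => n; rewrite !geq_max => /and3P[n1 n2 n3].
  have [sz hz] := hN n n1.
  apply: le_trans (cnDB _ (rm model n (fun z => (t + s - z)^-1)) _) _.
  suff : normc ((f n).[s] - rm model n (fun z => (t + s - z)^-1)) <= e / 2.
    by have := h1 n n2; lra.
  have -> : (f n).[s] = rm model n (fun z => \sum_(j < n.+1) g j z * s ^+ j).
    rewrite (rm_sum k model n n.+1 (fun j z => g j z * s ^+ j)) horner_poly.
    by apply: eq_bigr => j _; rewrite mulrC -rmZ; apply: rm_eq => z _; rewrite mulrC.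
  rewrite cnBC -rmB; apply: (rm_le sz) => z zn; have zd := hz z zn.
  have tz : z != t.
    by rewrite eq_sym -subr_eq0 -cn_gt0 (lt_le_trans d0).
  have tz0 : t - z != 0 by rewrite subr_eq0 eq_sym.
  have -> : (t + s - z)^-1 - \sum_(j < n.+1) g j z * s ^+ j =
     (t - z)^-1 * ((1 - - s / (t - z))^-1 - \sum_(j < n.+1) (- s / (t - z)) ^+ j).
    rewrite (sub_nearP s tz) invfM mulrBr; congr (_ - _).
    rewrite mulr_sumr; apply: eq_bigr => j _; rewrite /g exprSr invfM expr_div_n.
    by rewrite [(- s) ^+ j]exprNn; ring.
  rewrite cnM cnV; apply: le_trans (hJ n.+1 (leqW n3)).
  have inv : (normc (t - z))^-1 <= delta^-1 by rewrite lef_pV2 ?posrE // (lt_le_trans d0).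
  apply: ler_pM; rewrite ?invr_ge0 ?cn_ge0 //.
  apply: geometric_estimate th1; rewrite cnM cnN cnV.
  by rewrite ler_wpM2l ?cn_ge0.
have dV0 : 0 <= delta^-1 by rewrite invr_ge0 ltW.
have rV0 : 0 < r^-1 by rewrite invr_gt0.
have [c [hc1 hc2]] := poly_limit_series dV0 rV0 fb fs.
exists c, r; split=> // [j|s hs]; last by apply: hc2; rewrite invrK.
move=> e e0; have [N1 h1] := hc1 j e e0; exists (maxn N1 j) => n.
by rewrite geq_max => /andP[n1 nj]; have := h1 n n1; rewrite coef_poly ltnS nj.
Qed.

Lemma analytic_CQ : analytic_on exterior CQ.
Proof.
move=> t0 /CQ_expansion[c [r [r0 _ hc]]]; exists c, r; split=> // t tr.
by have := hc _ tr; rewrite [t0 + _]addrC subrK => /series_cvgC.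
Qed.

Lemma DQ_cvg t : exterior t -> cvgC (fun n => rm model n (fun z => - (t - z) ^- 2)) (DQ t).
Proof.
move=> /CQ_expansion[c [r [_ hc _]]]; rewrite /DQ; case: xgetP => [l _ //|no].
have := no (c 1%N); case=> e e0; have [N hN] := hc 1%N e e0; exists N => n /hN.
by rewrite (rm_eq (h := fun z => - (t - z) ^- 2)) // => z _; rewrite expr1 mulN1r.
Qed.

Lemma cvgC_ReC (u : nat -> C) l : cvgC u l -> cvgC (fun n => (complex.Re (u n))%:C) (complex.Re l)%:C.
Proof.
move=> h e e0; have [N hN] := h e e0; exists N => n /hN; apply: le_trans.
by rewrite -real_complexB cn_real -ReN -ReD Re_le_cn.
Qed.

Lemma rm_Re Q n (g : C -> C) : (complex.Re (rm Q n g))%:C = rm Q n (fun z => (complex.Re (g z))%:C).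
Proof.
rewrite /root_mean natC -fmorphV Re_mul /= mul0r subr0 rmorphM /=; congr (_ * _).
by rewrite Re_sum rmorph_sum.
Qed.

(* Each bound holds for the means over the roots, uniformly in n, and passes to the
   limit. *)
Lemma local_bounds t : exterior t -> exists K d, [/\ 0 <= K, 0 < d & forall s, normc s < d ->
  [/\ exterior (t + s), normc (CQ (t + s) - CQ t - s * DQ t) <= K * normc s ^+ 2,
     `|UQ (t + s) - UQ t - complex.Re (s * CQ t)| <= K * normc s ^+ 2 &
     normc (DQ (t + s) - DQ t) <= K * normc s]].
Proof.
move=> ht; have [delta d0 [N hN]] := exterior_dist k_gt0 ht.
have [d d1 hd] := exterior_open ht.
pose q := delta^-1; have q0 : 0 < q by rewrite invr_gt0.
(* One constant for each estimate: 2 q ^ 3 and 2 q ^ 2 from second-order geometric and logarithmic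
   remainders, 6 q ^ 3 = q * 2 q * (q + 2 q) from the difference of two inverse squares. The radius
   delta / 2 gives |t + s - z| >= delta / 2. *)
exists (Num.max (2 * q ^+ 3) (Num.max (2 * q ^+ 2) (6 * q ^+ 3))), (Num.min d (delta / 2)); split.
  by rewrite le_max mulr_ge0 // exprn_ge0 // ltW.
  by rewrite lt_min d1 divr_gt0.
move=> s; rewrite lt_min => /andP[/hd ts s2].
have cvgB (u v : nat -> C) l m : cvgC u l -> cvgC v m -> cvgC (fun n => u n - v n) (l - m).
  exact: cvgCB.
have hmod := heun_model a k_gt0.
have c1 := CQ_cvg k_gt0 ts hmod; have c0 := CQ_cvg k_gt0 ht hmod.
have u1 := UQC_cvg k_gt0 ts hmod; have u0 := UQC_cvg k_gt0 ht hmod.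
have e1 := DQ_cvg ts; have e0 := DQ_cvg ht.
pose th := normc s * q.
have th0 : 0 <= th by rewrite mulr_ge0 ?cn_ge0 ?ltW.
have thh : th <= 2^-1 by rewrite ler_pdivrMr //; lra.
have th1 : th < 1 by lra.
have thV : (1 - th)^-1 <= 2.
  by rewrite -[2]invrK lef_pV2 ?posrE ?invr_gt0 //; lra.
have near n z : (N <= n)%N -> z \in vv model n -> [/\ t - z != 0, t + s - z != 0,
   normc (t - z)^-1 <= q, normc (t + s - z)^-1 <= 2 * q & normc (- s / (t - z)) <= th].
  move=> /hN[_ hz] /hz h.
  have h1 : 0 < normc (t - z) by rewrite (lt_le_trans d0).
  have h2 : delta / 2 <= normc (t + s - z).
    by have := cn_lower (t - z) s; rewrite addrAC; lra.
  have d2 : 0 < delta / 2 by rewrite divr_gt0.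
  split; rewrite -?cn_gt0 // ?(lt_le_trans d2) //.
  - by rewrite cnV lef_pV2 ?posrE.
  - have -> : 2 * q = (delta / 2)^-1 by rewrite invf_div mulrC /q; field; exact: lt0r_neq0.
    by rewrite cnV lef_pV2 ?posrE // (lt_le_trans d2).
  by rewrite cnM cnN cnV ler_wpM2l ?cn_ge0 // lef_pV2 ?posrE.
have lim (g : C -> C) l M : cvgC (fun n => rm model n g) l ->
    (forall n z, (N <= n)%N -> z \in vv model n -> normc (g z) <= M) -> normc l <= M.
  move=> hl hM; apply: cvgC_le hl _; exists N => n Nn; have [sz _] := hN n Nn.
  by apply: (rm_le sz) => z; apply: hM.
have mx1 : 2 * q ^+ 3 <= Num.max (2 * q ^+ 3) (Num.max (2 * q ^+ 2) (6 * q ^+ 3)).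
  by rewrite le_max lexx.
have mx2 : 2 * q ^+ 2 <= Num.max (2 * q ^+ 3) (Num.max (2 * q ^+ 2) (6 * q ^+ 3)).
  by rewrite !le_max lexx orbT.
have mx3 : 6 * q ^+ 3 <= Num.max (2 * q ^+ 3) (Num.max (2 * q ^+ 2) (6 * q ^+ 3)).
  by rewrite !le_max lexx !orbT.
have tail : th ^+ 2 / (1 - th) <= 2 * q ^+ 2 * normc s ^+ 2.
  have -> : 2 * q ^+ 2 * normc s ^+ 2 = th ^+ 2 * 2 by rewrite /th; ring.
  by rewrite ler_wpM2l ?exprn_ge0.
split=> //.
- apply: le_trans (ler_wpM2r (exprn_ge0 2 (cn_ge0 s)) mx1).
  have := cvgB _ _ _ _ (cvgB _ _ _ _ c1 c0) (cvgCMl s e0).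
  have -> : (fun n => rm model n (fun z => (t + s - z)^-1) - rm model n (fun z => (t - z)^-1) -
      s * rm model n (fun z => - (t - z) ^- 2)) = (fun n => rm model n (fun z =>
      (t + s - z)^-1 - (t - z)^-1 - s * - (t - z) ^- 2)).
    by apply/funext => n; rewrite !rmB rmZ.
  move=> /lim; apply => n z Nn zn; have [tz tsz h1 h2 h3] := near n z Nn zn.
  have zt : z != t by rewrite eq_sym -subr_eq0.
  have -> : (t + s - z)^-1 - (t - z)^-1 - s * - (t - z) ^- 2 =
     (t - z)^-1 * ((1 - - s / (t - z))^-1 - \sum_(j < 2) (- s / (t - z)) ^+ j).
    rewrite (sub_nearP s zt) invfM mulrBr !big_ord_recl big_ord0 /= expr0 expr1 addr0.
    rewrite mulrDr mulr1 expr2 invfM; ring.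
  rewrite cnM; have := geometric_estimate 2 h3 th1 => h4.
  apply: le_trans (ler_pM (cn_ge0 _) (cn_ge0 _) h1 (le_trans h4 tail)) _.
  by rewrite le_eqVlt; apply/orP; left; apply/eqP; ring.
- apply: le_trans (ler_wpM2r (exprn_ge0 2 (cn_ge0 s)) mx2).
  have := cvgC_ReC (cvgB _ _ _ _ (cvgB _ _ _ _ u1 u0) (cvgCMl s c0)).
  have -> : (fun n => (complex.Re (rm model n (fun z => logC (t + s - z)) - rm model n (fun z => logC (t - z)) -
      s * rm model n (fun z => (t - z)^-1)))%:C) = (fun n => rm model n (fun z =>
      (complex.Re (logC (t + s - z) - logC (t - z) - s * (t - z)^-1))%:C)).
    by apply/funext => n; rewrite -rm_Re !rmB rmZ.
  have -> : UQ (t + s) - UQ t - complex.Re (s * CQ t) = complex.Re (UQC (t + s) - UQC t - s * CQ t).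
    by rewrite !ReD !ReN.
  rewrite -cn_real => /lim; apply => n z Nn zn; have [tz tsz h1 h2 h3] := near n z Nn zn.
  have zt : z != t by rewrite eq_sym -subr_eq0.
  have w1 : 0 < normc (1 - - s / (t - z)).
    rewrite cn_gt0; apply: contra_neq tsz => w0; by rewrite (sub_nearP s zt) w0 mulr0.
  rewrite cn_real /logC (sub_nearP s zt) cnM lnM ?posrE ?(cn_gt0 (t - z)) //.
  have := log_estimate (ltn0Sn 1) h3 th1; rewrite big_nat1 expr1 divr1 => h4.
  apply: le_trans tail; apply: le_trans h4.
  rewrite le_eqVlt; apply/orP; left; apply/eqP; congr (`|_|).
  by rewrite !ReD !ReN /= mulNr ReN; ring.
- apply: le_trans (ler_wpM2r (cn_ge0 s) mx3).
  have := cvgB _ _ _ _ e1 e0.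
  have -> : (fun n => rm model n (fun z => - (t + s - z) ^- 2) - rm model n (fun z => - (t - z) ^- 2)) =
      (fun n => rm model n (fun z => - (t + s - z) ^- 2 - - (t - z) ^- 2)).
    by apply/funext => n; rewrite !rmB.
  move=> /lim; apply => n z Nn zn; have [tz tsz h1 h2 h3] := near n z Nn zn.
  have -> : - (t + s - z) ^- 2 - - (t - z) ^- 2 =
     s * ((t - z)^-1 * (t + s - z)^-1 * ((t - z)^-1 + (t + s - z)^-1)).
    by field; rewrite tz tsz.
  rewrite cnM mulrC ler_wpM2r ?cn_ge0 // !cnM.
  have -> : 6 * q ^+ 3 = (q * (2 * q)) * (q + 2 * q) by ring.
  apply: ler_pM; rewrite ?mulr_ge0 ?cn_ge0 //; first by apply: ler_pM; rewrite ?cn_ge0.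
  by apply: le_trans (cnD _ _) _; apply: lerD.
Qed.

End ExteriorAnalytic.

(** * Harmonicity from first-order expansions *)

Section Harmonic.
Variable R : realType.
Local Notation C := (Cnum R).
Implicit Types (t z s : C) (u : C -> R) (D : C -> C).

Lemma derive_estimate (F : R -> R) (l K d : R) : 0 <= K -> 0 < d ->
  (forall h : R, `|h| < d -> `|F h - F 0 - h * l| <= K * `|h| ^+ 2) ->
  derivable F 0 1 /\ derive1 F 0 = l.
Proof.
move=> K0 d0 hF.
have K1 : 0 < K + 1 by rewrite ltr_wpDl.
have key : (fun h => h^-1 *: (F (h + 0) - F 0)) @ 0^' --> l.
  apply/cvgrPdist_le => e e0.
  rewrite near_withinE; apply/nbhs_ballP; exists (Num.min d (e / (K + 1))).
    by rewrite /= lt_min d0 divr_gt0.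
  move=> h /=; rewrite /ball /= sub0r normrN lt_min => /andP[hd he] h0; rewrite addr0.
  rewrite distrC (_ : h^-1 *: (F h - F 0) - l = h^-1 * (F h - F 0 - h * l)); last first.
    by rewrite mulrBr mulKf.
  rewrite normrM normfV ler_pdivrMl ?normr_gt0 //.
  apply: le_trans (hF h hd) _; rewrite expr2 mulrCA ler_wpM2l //.
  move: he; rewrite ltr_pdivlMr //; have := normr_ge0 h; lra.
split; last by rewrite /derive1; apply: cvg_lim key.
rewrite /derivable; apply/cvg_ex; exists l.
rewrite [X in X @ _](_ : _ = fun h => h^-1 *: (F (h + 0) - F 0)) //.
by apply/funext => h /=; rewrite [h *: 1]mulr1.
Qed.

(** l encodes the gradient as u_x - i u_y, that is, twice the Wirtinger derivative; the quadratic
    error is explicit. *)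
Definition first_order u t (l : C) := exists K d : R, [/\ 0 <= K, 0 < d &
  forall s, normc s < d -> `|u (t + s) - u t - complex.Re (s * l)| <= K * normc s ^+ 2].

Lemma normc_line (h : R) : normc (h +i* 0 : C) = `|h|.
Proof. by rewrite /= expr0n /= addr0 sqrtr_sqr. Qed.

Lemma normc_iline (h : R) : normc (0 +i* h : C) = `|h|.
Proof. by rewrite /= expr0n /= add0r sqrtr_sqr. Qed.

Lemma first_order_partials u t l : first_order u t l ->
  [/\ derivable (xline u t) 0 1, derivable (yline u t) 0 1,
     dx u t = complex.Re l & dy u t = - complex.Im l].
Proof.
move=> [K [d [K0 d0 hu]]].
have x0 : xline u t 0 = u t by rewrite /xline (_ : 0 +i* 0 = 0) ?addr0.
have y0 : yline u t 0 = u t by rewrite /yline (_ : 0 +i* 0 = 0) ?addr0.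
have [X1 X2] : derivable (xline u t) 0 1 /\ derive1 (xline u t) 0 = complex.Re l.
  apply: (derive_estimate K0 d0) => h hd; have := hu (h +i* 0).
  by rewrite normc_line x0 Re_mul /= mul0r subr0; apply.
have [Y1 Y2] : derivable (yline u t) 0 1 /\ derive1 (yline u t) 0 = - complex.Im l.
  apply: (derive_estimate K0 d0) => h hd; have := hu (0 +i* h).
  by rewrite normc_iline y0 Re_mul /= mul0r sub0r mulrN; apply.
by split.
Qed.

Definition lipschitz_at D t := exists K d : R, [/\ 0 <= K, 0 < d &
  forall s, normc s < d -> normc (D (t + s) - D t) <= K * normc s].

Lemma lipschitz_at_cvg (v : C -> R) D t (r : R) : lipschitz_at D t -> 0 < r ->
  (forall s, normc s < r -> `|v (t + s) - v t| <= normc (D (t + s) - D t)) ->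
  {for t, continuous v}.
Proof.
move=> [K [d [K0 d0 hK]]] r0 hv.
suff : v s @[s --> t] --> v t by [].
apply/(@cvgrPdist_le _ _ _ _ (nbhs_filter t)) => e e0.
have K1 : 0 < K + 1 by rewrite ltr_wpDl.
apply/nbhsC_P; exists (Num.min r (Num.min d (e / (K + 1)))).
  by rewrite !lt_min r0 d0 divr_gt0.
move=> s; rewrite !lt_min => /and3P[h1 h2 h3]; rewrite distrC.
have := hv _ h1; have := hK _ h2; rewrite [t + _]addrC subrK => a1 a2.
apply: le_trans a2 _; apply: le_trans a1 _.
move: h3; rewrite ltr_pdivlMr //; have := cn_ge0 (s - t); lra.
Qed.

Definition opened (O : set C) := forall t, O t ->
  exists2 d : R, 0 < d & forall s, normc s < d -> O (t + s).

Lemma C1_first_order (O : set C) u D : opened O -> (forall t, O t -> first_order u t (D t)) ->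
  (forall t, O t -> lipschitz_at D t) ->
  C1_on O u /\ forall t, O t -> dx u t = complex.Re (D t) /\ dy u t = - complex.Im (D t).
Proof.
move=> hO hu hD.
have hxy t : O t -> dx u t = complex.Re (D t) /\ dy u t = - complex.Im (D t).
  by move=> /hu/first_order_partials[_ _ -> ->].
split; last exact: hxy.
move=> t Ot; have [h1 h2 _ _] := first_order_partials (hu t Ot).
split; [exact: h1 | exact: h2 | |].
  have [d d0 hd] := hO t Ot; apply: (lipschitz_at_cvg (hD t Ot) d0) => s /hd Os.
  by have [-> _] := hxy _ Os; have [-> _] := hxy _ Ot; rewrite -ReN -ReD Re_le_cn.
have [d d0 hd] := hO t Ot; apply: (lipschitz_at_cvg (hD t Ot) d0) => s /hd Os.
have [_ ->] := hxy _ Os; have [_ ->] := hxy _ Ot.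
by rewrite -opprD normrN -ImN -ImD Im_le_cn.
Qed.

Lemma first_order_eq (O : set C) u v t l : opened O -> O t -> (forall s, O s -> u s = v s) ->
  first_order v t l -> first_order u t l.
Proof.
move=> hO Ot uv [K [d [K0 d0 hv]]]; have [e e0 he] := hO t Ot.
exists K, (Num.min d e); split=> //; first by rewrite lt_min d0.
by move=> s; rewrite lt_min => /andP[/hv h /he Os]; rewrite !uv.
Qed.

(** u_x = Re D and u_y = - Im D, with D complex differentiable of derivative D'. Hence u_xx = Re D'
    and u_yy = - Im (i D') = - Re D'. *)
Lemma harmonic_first_order (O : set C) u D D' : opened O ->
  (forall t, O t -> first_order u t (D t)) ->
  (forall t, O t -> exists K d : R, [/\ 0 <= K, 0 < d & forall s, normc s < d ->
     normc (D (t + s) - D t - s * D' t) <= K * normc s ^+ 2]) ->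
  (forall t, O t -> lipschitz_at D' t) ->
  harmonic_on O u /\ forall t, O t -> 2 * wirtinger u t = D t.
Proof.
move=> hO hu hD hD'.
have lD t : O t -> lipschitz_at D t.
  move=> /hD[K [d [K0 d0 h]]]; exists (K * d + normc (D' t)), d; split=> //.
    by rewrite addr_ge0 ?mulr_ge0 ?cn_ge0 ?(ltW d0).
  move=> s sd; have := h s sd => h1.
  have := cnD (D (t + s) - D t - s * D' t) (s * D' t); rewrite subrK cnM.
  have : K * normc s ^+ 2 <= K * d * normc s.
    by rewrite expr2 mulrA ler_wpM2r ?cn_ge0 // ler_wpM2l // ltW.
  by rewrite mulrDl; lra.
have [c1 xy] := C1_first_order hO hu lD.
have hx t : O t -> first_order (dx u) t (D' t).
  move=> Ot; apply: (first_order_eq (v := fun s => complex.Re (D s)) hO Ot) => [s /xy[]//|].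
  have [K [d [K0 d0 h]]] := hD t Ot; exists K, d; split=> // s /h; apply: le_trans.
  by rewrite -!ReN -!ReD Re_le_cn.
(* - Im D = Re (i D), whence the factor i. *)
have hy t : O t -> first_order (dy u) t ('i * D' t).
  move=> Ot; apply: (first_order_eq (v := fun s => - complex.Im (D s)) hO Ot) => [s /xy[]//|].
  have [K [d [K0 d0 h]]] := hD t Ot; exists K, d; split=> // s /h; apply: le_trans.
  have -> : complex.Re (s * ('i * D' t)) = - complex.Im (s * D' t).
    by rewrite Re_mul Im_mul Re_mul Im_mul /=; ring.
  by rewrite -!opprD normrN -!ImN -!ImD Im_le_cn.
have lD2 t : O t -> lipschitz_at (fun t => 'i * D' t) t.
  move=> /hD'[K [d [K0 d0 h]]]; exists K, d; split=> // s /h; apply: le_trans.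
  by rewrite -mulrBr cnM -[X in _ <= X]mul1r ler_wpM2r ?cn_ge0 // normc_iline normr1.
have [c2 xy2] := C1_first_order hO hx hD'.
have [c3 xy3] := C1_first_order hO hy lD2.
split; first split; [exact: c1 | exact: c2 | exact: c3 | |].
  move=> t Ot; have [-> _] := xy2 t Ot; have [_ ->] := xy3 t Ot.
  by rewrite Im_mul /=; ring.
move=> t /xy[xt yt]; rewrite /wirtinger xt yt mulrA mulfV ?mul1r; last first.
  by rewrite pnatr_eq0.
apply: complex_eq.
  rewrite ReD ReN Re_mul /=; ring.
by rewrite ImD ImN Im_mul /=; ring.
Qed.

End Harmonic.

Section ExteriorHarmonic.
Variable R : realType.
Local Notation C := (Cnum R).
Variables (k : nat) (a : nat -> C).
Hypothesis k_gt0 : (0 < k)%N.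
Local Notation UQ := (UQ k a).
Local Notation CQ := (CQ k a).
Local Notation exterior := (exterior k a).

Lemma harmonic_UQ : harmonic_on exterior UQ /\ forall t, exterior t -> 2 * wirtinger UQ t = CQ t.
Proof.
apply: (harmonic_first_order (D' := DQ k a)) => [t /exterior_open//|t ht|t ht|t ht];
  have [K [d [K0 d0 h]]] := local_bounds k_gt0 ht; exists K, d; split=> // s /h[] //.
Qed.

Lemma UQ_at_infinity : exists M r : R, 0 < r /\ forall t : C, r < normc t ->
  `|UQ t - ln (normc t)| <= M / normc t.
Proof.
have [r1 hr1] := encl0 k a; have r10 : 0 < r1 by case: hr1.
exists (2 * r1), (2 * r1); split=> [|t ht]; first by rewrite mulr_gt0.
have t0 : 0 < normc t by apply: lt_trans ht; rewrite mulr_gt0.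
have hext : exterior t by exists 0, r1; rewrite subr0; split=> //; lra.
have hmod := heun_model a k_gt0.
have -> : UQ t - ln (normc t) = complex.Re (UQC k a t - logC t) by rewrite ReD ReN.
apply: le_trans (Re_le_cn _) _.
apply: cvgC_lim_le (UQC_cvg k_gt0 hext hmod) (cvgC_cst _) _.
have [N hN] := roots_localized k_gt0 hmod hr1; exists N => n /hN[sz hz].
rewrite -(rm_cst (logC t) sz) -rmB; apply: (rm_le sz) => z /hz; rewrite subr0 => zr.
have th1 : r1 / normc t < 2^-1 by rewrite ltr_pdivrMr //; lra.
have wle : normc (z / t) <= r1 / normc t.
  by rewrite cnM cnV ler_wpM2r ?invr_ge0 ?cn_ge0 // ltW.
have tn : t != 0 by rewrite -cn_gt0.
have w1 : 0 < normc (1 - z / t) by have := cn_lowerB 1 (z / t); rewrite cn1; lra.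
have -> : t - z = t * (1 - z / t) by field.
rewrite /logC cnM lnM ?posrE // -real_complexB cn_real addrAC subrr add0r.
(* Order 1 of the estimate bounds |log |1 - z / t|| by x / (1 - x) with x = r1 / |t| < 1/2, hence by
   2 x. *)
have := log_estimate (ltnSn 0) wle (ltac:(lra)); rewrite big_geq // addr0 expr1 => h.
apply: le_trans h _; have i0 : 0 < 1 - r1 / normc t by lra.
rewrite ler_pdivrMr // -[2 * _ / _]mulrA; set x := r1 / normc t in th1 i0 *.
have : 0 <= x by rewrite divr_ge0 ?cn_ge0 ?ltW.
nra.
Qed.

End ExteriorHarmonic.

(** * Root-counting measures and weak limits *)

Section BorelC.
Variable R : realType.
Local Notation C := (Cnum R).
Implicit Types (t z c s : C) (u : C -> R).

Lemma normc_continuity u : (forall t (e : R), 0 < e -> exists2 d : R, 0 < d &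
  forall s, normc (s - t) < d -> `|u s - u t| <= e) -> continuous u.
Proof.
move=> hu t; suff : u s @[s --> t] --> u t by [].
apply/(@cvgrPdist_le _ _ _ _ (nbhs_filter t)) => e e0; have [d d0 hd] := hu t e e0.
by apply/nbhsC_P; exists d => // s /hd; rewrite distrC.
Qed.

Lemma continuous_lipschitz u (K : R) : (forall s t, `|u s - u t| <= K * normc (s - t)) ->
  continuous u.
Proof.
move=> hu; apply: normc_continuity => t e e0.
have K1 : 0 < `|K| + 1 by rewrite ltr_wpDl.
exists (e / (`|K| + 1)); first by rewrite divr_gt0.
move=> s; rewrite ltr_pdivlMr // => hs; apply: le_trans (hu s t) _.
have : K * normc (s - t) <= `|K| * normc (s - t) by rewrite ler_wpM2r ?cn_ge0 ?ler_norm.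
have := cn_ge0 (s - t); lra.
Qed.

Lemma continuous_dist c : continuous (fun z => normc (z - c)).
Proof.
apply: (@continuous_lipschitz _ 1) => s t; rewrite mul1r ler_norml.
have := cnDB s t c; have := cnDB t s c; rewrite (cnBC t s); lra.
Qed.

Lemma continuous_distr t : continuous (fun z => normc (t - z)).
Proof.
rewrite (_ : (fun z => _) = fun z => normc (z - t)); first exact: continuous_dist.
by apply/funext => z; rewrite cnBC.
Qed.

Lemma continuous_Re_sub t : continuous (fun z => complex.Re (t - z)).
Proof.
apply: (@continuous_lipschitz _ 1) => s z; rewrite mul1r.
have -> : complex.Re (t - s) - complex.Re (t - z) = - complex.Re (s - z).
  by rewrite !ReD !ReN; ring.
by rewrite normrN Re_le_cn.
Qed.

Lemma continuous_Im_sub t : continuous (fun z => complex.Im (t - z)).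
Proof.
apply: (@continuous_lipschitz _ 1) => s z; rewrite mul1r.
have -> : complex.Im (t - s) - complex.Im (t - z) = - complex.Im (s - z).
  by rewrite !ImD !ImN; ring.
by rewrite normrN Im_le_cn.
Qed.

Lemma continuous_measurableC u : continuous u -> measurable_fun setT (u : borelC R -> R).
Proof.
move=> cu; apply: (measurability _ (RGenOInfty.measurableE R)) => _ [_ [x ->] <-].
rewrite setTI; apply: sub_sigma_algebra.
by move/continuousP: cu => /(_ `]x, +oo[%classic); apply; exact: rray_open.
Qed.

Lemma Re_inv z : complex.Re z^-1 = complex.Re z * (normc z ^+ 2)^-1.
Proof. by rewrite normc_sqr; case: z. Qed.

Lemma Im_inv z : complex.Im z^-1 = - complex.Im z * (normc z ^+ 2)^-1.
Proof. by rewrite normc_sqr; case: z => x y /=; rewrite mulNr. Qed.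

Lemma measurable_inv_normc t :
  measurable_fun setT (fun z : borelC R => (normc (t - z) ^+ 2)^-1).
Proof.
rewrite (_ : (fun z => _) = fun z : borelC R => powR (normc (t - z) ^+ 2) (-1)).
  apply: (measurableT_comp (measurable_powR (-1 : R))).
  apply: measurable_funX; apply: continuous_measurableC; exact: continuous_distr.
by apply/funext => z; rewrite powR_inv1 // exprn_ge0 // cn_ge0.
Qed.

Lemma measurable_Re_cauchy t : measurable_fun setT (fun z : borelC R => complex.Re (t - z)^-1).
Proof.
rewrite (_ : (fun z => _) = fun z : borelC R => complex.Re (t - z) * (normc (t - z) ^+ 2)^-1).
  apply: measurable_funM (measurable_inv_normc t).
  apply: continuous_measurableC; exact: continuous_Re_sub.
by apply/funext => z; rewrite Re_inv.
Qed.

Lemma measurable_Im_cauchy t : measurable_fun setT (fun z : borelC R => complex.Im (t - z)^-1).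
Proof.
rewrite (_ : (fun z => _) = fun z : borelC R => - (complex.Im (t - z) * (normc (t - z) ^+ 2)^-1)).
  apply: measurable_funN; apply: measurable_funM (measurable_inv_normc t).
  apply: continuous_measurableC; exact: continuous_Im_sub.
by apply/funext => z; rewrite Im_inv mulNr.
Qed.

Lemma measurable_log t : measurable_fun setT (fun z : borelC R => ln (normc (t - z))).
Proof.
apply: (measurableT_comp (@measurable_ln R)).
apply: continuous_measurableC; exact: continuous_distr.
Qed.

End BorelC.

Section RootCountingMeasure.
Variable R : realType.
Local Notation C := (Cnum R).
Variables (k : nat) (Q : nat -> {poly C}) (n : nat).
Local Notation mu := (root_counting_measure k Q n).
Local Notation vv := (van_vleck_roots k Q n).

Definition real_mean (g : C -> R) : R := n.+1%:R^-1 * \sum_(z <- vv) g z.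

Lemma integral_root_counting_ge0 (g : borelC R -> R) : measurable_fun setT g -> (forall z, 0 <= g z) ->
  (\int[mu]_x (g x)%:E)%E = (real_mean g)%:E.
Proof.
move=> mg g0; rewrite /root_counting_measure ge0_integral_mscale //=; last 2 first.
- by apply/measurable_EFinP.
- by move=> x _; rewrite lee_fin.
rewrite ge0_integral_measure_sum //=; last 2 first.
- by move=> x _; rewrite lee_fin.
- by apply/measurable_EFinP.
rewrite (eq_bigr (fun j : 'I_(size vv) => (g (vv`_j))%:E)); last first.
  move=> j _; rewrite integral_dirac //; last by apply/measurable_EFinP.
  by rewrite diracT mul1e.
rewrite sumEFin -EFinM /real_mean (big_nth 0) big_mkord //.
Qed.

Lemma Rintegral_root_counting (g : borelC R -> R) : measurable_fun setT g ->
  Rintegral mu setT g = real_mean g.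
Proof.
move=> mg; rewrite /Rintegral integralE.
under eq_integral do rewrite -/((EFin \o g) _).
have -> : (\int[mu]_x (EFin \o g)^\+ x)%E = (real_mean g^\+)%:E.
  rewrite funerpos; apply: integral_root_counting_ge0; first exact: measurable_funrpos.
  by move=> z; rewrite funrpos_ge0.
have -> : (\int[mu]_x (EFin \o g)^\- x)%E = (real_mean g^\-)%:E.
  rewrite funerneg; apply: integral_root_counting_ge0; first exact: measurable_funrneg.
  by move=> z; rewrite funrneg_ge0.
rewrite -EFinB /= /real_mean -mulrBr -sumrB; congr (_ * _); apply: eq_bigr => z _.
by have /(congr1 (@^~ z)) := funrposBneg g.
Qed.

Lemma Re_root_mean (h : C -> C) : complex.Re (root_mean k Q n h) = real_mean (fun z => complex.Re (h z)).
Proof.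
by rewrite /root_mean natC -fmorphV Re_mul /= mul0r subr0 Re_sum.
Qed.

Lemma Im_root_mean (h : C -> C) : complex.Im (root_mean k Q n h) = real_mean (fun z => complex.Im (h z)).
Proof.
by rewrite /root_mean natC -fmorphV Im_mul /= mul0r addr0 Im_sum.
Qed.

Lemma cauchy_transform_root_counting t :
  cauchy_transform mu t = root_mean k Q n (fun z => (t - z)^-1).
Proof.
apply: complex_eq.
  rewrite Re_root_mean /=; apply: Rintegral_root_counting; exact: measurable_Re_cauchy.
rewrite Im_root_mean /=; apply: Rintegral_root_counting; exact: measurable_Im_cauchy.
Qed.

Lemma log_potential_root_counting t :
  log_potential mu t = complex.Re (root_mean k Q n (fun z => logC (t - z))).
Proof. by rewrite Re_root_mean; apply: Rintegral_root_counting; exact: measurable_log. Qed.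

Lemma cauchy_transform_spectral t : ~~ root (spectral_poly k Q n) t ->
  cauchy_transform mu t = (n.+1%:R)^-1 * ((spectral_poly k Q n)^`().[t] / (spectral_poly k Q n).[t]).
Proof.
move=> nr; rewrite cauchy_transform_root_counting /root_mean; congr (_ * _).
move: nr; rewrite /root /spectral_poly => nr.
rewrite horner_deriv_prod_XsubC; first by rewrite mulrAC mulfV // mul1r.
by move: nr; apply: contra => tv; rewrite -/(root _ _) root_prod_XsubC.
Qed.

Lemma log_potential_spectral t : ~~ root (spectral_poly k Q n) t ->
  log_potential mu t = (n.+1%:R)^-1 * ln (normc (spectral_poly k Q n).[t]).
Proof.
move=> nr; rewrite log_potential_root_counting Re_root_mean; congr (_ * _).
move: nr; rewrite /spectral_poly root_prod_XsubC horner_prod_XsubC.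
elim: vv => [|z s IH]; first by rewrite !big_nil cn1 ln1.
rewrite !big_cons inE negb_or => /andP[tz ts]; rewrite cnM lnM ?IH // posrE cn_gt0 ?subr_eq0 //.
by rewrite prodf_seq_neq0; apply/allP => w ws; rewrite subr_eq0; apply: contraNneq ts => ->.
Qed.

End RootCountingMeasure.

Lemma continuous_mulC (R : realType) (u v : Cnum R -> R) :
  continuous u -> continuous v -> continuous (fun z => u z * v z).
Proof.
move=> cu cv z; suff : u s * v s @[s --> z] --> u z * v z by [].
exact: (@cvgM _ _ (nbhs z) (nbhs_filter z) u v (u z) (v z) (cu z) (cv z)).
Qed.

Lemma continuous_oppC (R : realType) (u : Cnum R -> R) : continuous u -> continuous (fun z => - u z).
Proof.
move=> cu; rewrite (_ : (fun z => - u z) = fun z => (-1) * u z).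
  by apply: continuous_mulC => //; exact: cst_continuous.
by apply/funext => z; rewrite mulN1r.
Qed.

Lemma dist_max (R : realType) (x y d : R) : `|Num.max x d - Num.max y d| <= `|x - y|.
Proof.
have h1 := ler_norm (x - y); have h2 := ler_norm (y - x); rewrite [`|y - x|]distrC in h2.
move: h1 h2; set e := `|x - y| => h1 h2; rewrite ler_norml; apply/andP.
by split; case: (lerP x d) => ?; case: (lerP y d) => ?; lra.
Qed.

Lemma dist_min (R : realType) (x y d : R) : `|Num.min x d - Num.min y d| <= `|x - y|.
Proof.
have h1 := ler_norm (x - y); have h2 := ler_norm (y - x); rewrite [`|y - x|]distrC in h2.
move: h1 h2; set e := `|x - y| => h1 h2; rewrite ler_norml; apply/andP.
by split; case: (lerP x d) => ?; case: (lerP y d) => ?; lra.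
Qed.

Lemma dist_normc (R : realType) (x y : Cnum R) : `|normc x - normc y| <= normc (x - y).
Proof.
have h1 := cnD (x - y) y; have h2 := cnD (y - x) x.
by rewrite ler_norml; move: h1 h2; rewrite !subrK (cnBC y x) => h1 h2; apply/andP; split; lra.
Qed.


(** * Weak limits of the root-counting measures *)

Section WeakLimits.
Variable R : realType.
Local Notation C := (Cnum R).
Variables (k : nat) (a : nat -> C).
Hypothesis k_gt0 : (0 < k)%N.
Implicit Types (t z c s : C) (u f g : C -> R).

Lemma continuous_cut c (r : R) : continuous (fun z => Num.min (Num.max (normc (z - c) - r) 0) 1 : R).
Proof.
apply: (@continuous_lipschitz _ _ 1) => s t; rewrite mul1r.
apply: le_trans (dist_min _ _ _) _; apply: le_trans (dist_max _ _ _) _.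
have -> : normc (s - c) - r - (normc (t - c) - r) = normc (s - c) - normc (t - c) by ring.
by apply: le_trans (dist_normc _ _) _; rewrite [s - c - _](_ : _ = s - t) //; ring.
Qed.

Lemma dist_clip t s z (d : R) :
  `|Num.max (normc (t - s)) d - Num.max (normc (t - z)) d| <= normc (s - z).
Proof.
apply: le_trans (dist_max _ _ _) _; apply: le_trans (dist_normc _ _) _.
by rewrite cnBC [t - z - _](_ : _ = s - z) //; ring.
Qed.

(* Clipping gives bounded continuous functions which agree with the two kernels on
   the disc carrying a limit measure. *)
Lemma continuous_clip_inv t (d : R) : 0 < d -> continuous (fun z => (Num.max (normc (t - z)) d ^+ 2)^-1).
Proof.
move=> d0; suff h (s z : C) : `|(Num.max (normc (t - s)) d ^+ 2)^-1 - (Num.max (normc (t - z)) d ^+ 2)^-1|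
    <= 2 / d ^+ 3 * normc (s - z).
  exact: continuous_lipschitz h.
have := dist_clip t s z d; set x := Num.max (normc (t - s)) d; set y := Num.max (normc (t - z)) d.
move=> xy; have xd : d <= x by rewrite le_max lexx orbT.
have yd : d <= y by rewrite le_max lexx orbT.
have x0 : 0 < x := lt_le_trans d0 xd; have y0 : 0 < y := lt_le_trans d0 yd.
clearbody x y.
have -> : (x ^+ 2)^-1 - (y ^+ 2)^-1 = (y - x) * (x^-1 * y^-1 * (x^-1 + y^-1)).
  by field; rewrite !lt0r_neq0.
have xi : x^-1 <= d^-1 by rewrite lef_pV2 ?posrE.
have yi : y^-1 <= d^-1 by rewrite lef_pV2 ?posrE.
have xi0 : 0 <= x^-1 by rewrite invr_ge0 ltW.
have yi0 : 0 <= y^-1 by rewrite invr_ge0 ltW.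
have di0 : 0 <= d^-1 by rewrite invr_ge0 ltW.
rewrite normrM mulrC distrC; apply: ler_pM => //; rewrite ger0_norm ?mulr_ge0 ?addr_ge0 //.
have -> : 2 / d ^+ 3 = d^-1 * d^-1 * (d^-1 + d^-1) by field; exact: lt0r_neq0.
by apply: ler_pM; rewrite ?mulr_ge0 ?addr_ge0 ?lerD //; apply: ler_pM.
Qed.

Lemma continuous_clip_log t (d D : R) : 0 < d -> d <= D ->
  continuous (fun z => ln (Num.min (Num.max (normc (t - z)) d) D)).
Proof.
move=> d0 dD z.
apply: (@continuous_comp _ _ _ (fun z => Num.min (Num.max (normc (t - z)) d) D) (@ln R)).
  have : continuous (fun z => Num.min (Num.max (normc (t - z)) d) D : R); last by apply.
  apply: (@continuous_lipschitz _ _ 1) => s {}z; rewrite mul1r.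
  exact: le_trans (dist_min _ _ _) (dist_clip _ _ _ _).
by apply: continuous_ln; rewrite lt_min lt_max d0 orbT (lt_le_trans d0).
Qed.

Lemma homo_ltn_ge (phi : nat -> nat) : {homo phi : m n / (m < n)%N} -> forall m, (m <= phi m)%N.
Proof.
by move=> hphi; elim=> // m IH; apply: leq_ltn_trans IH _; apply: hphi.
Qed.

Variables (Q : nat -> {poly C}) (phi : nat -> nat).
Variable nu : {finite_measure set (borelC R) -> \bar R}.
Hypothesis hQ : heun_data k a Q.
Hypothesis hphi : {homo phi : m n / (m < n)%N}.
Hypothesis hnu : weak_cvg (fun m => root_counting_measure k Q (phi m)) nu.
Local Notation real_mean := (real_mean k Q).

Lemma bounded_integrable (g : borelC R -> R) : continuous (g : C -> R) -> (exists M : R, forall z, `|g z| <= M) ->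
  nu.-integrable setT (EFin \o g).
Proof.
move=> cg [M hM]; apply: measurable_bounded_integrable => //.
- by rewrite -ge0_fin_numE // fin_num_measure.
- exact: continuous_measurableC.
by exists M; split; [exact: num_real | move=> x /ltW Mx z _; apply: le_trans (hM z) Mx].
Qed.

Lemma weak_mean g : continuous g -> (exists M : R, forall z, `|g z| <= M) ->
  (fun m => real_mean (phi m) g) @ \oo --> Rintegral nu setT (g : borelC R -> R).
Proof.
move=> cg bg; have := hnu cg bg.
rewrite (_ : (fun n => _) = fun m => real_mean (phi m) g) //.
by apply/funext => m; rewrite Rintegral_root_counting //; apply: continuous_measurableC.
Qed.

(** The test function min (max (|z - c| - r, 0), 1) is bounded, continuous and 0 at all roots from
    some n on. Its nu-integral is therefore 0, and a nonnegative function of integral 0 vanishes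
    almost everywhere. *)
Lemma weak_limit_support c (r : R) : encl k a c r -> {ae nu, forall z : borelC R, normc (z - c) <= r}.
Proof.
move=> hc; pose u (z : borelC R) : R := Num.min (Num.max (normc (z - c) - r) 0) 1.
have cu : continuous (u : C -> R) by apply: continuous_cut.
have u0 z : 0 <= u z by rewrite le_min ler01 le_max lexx orbT.
have bu : exists M : R, forall z, `|u z| <= M.
  by exists 1 => z; rewrite ger0_norm // ge_min lexx orbT.
have iu := bounded_integrable cu bu.
have [N hN] := roots_localized k_gt0 hQ hc.
have int0 : Rintegral nu setT u = 0.
  have h := weak_mean cu bu.
  have h0 : (fun m => real_mean (phi m) u) @ \oo --> (0 : R).
    apply/cvgrPdist_le => e e0; exists N => // m /= Nm.
    have [_ hz] := hN (phi m) (leq_trans Nm (homo_ltn_ge hphi m)).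
    rewrite /real_mean big_seq big1 ?mulr0 ?subrr ?normr0 ?ltW // => z /hz zr.
    have h1 : Num.max (normc (z - c) - r) 0 = 0 by apply/max_idPr; rewrite subr_le0 ltW.
    by rewrite /u h1; apply/min_idPl; exact: ler01.
  exact: cvg_unique h h0.
have ae0 : ae_eq nu setT (EFin \o u) (cst 0%E).
  apply/ae_eq_integral_abs => //; first exact: measurable_int iu.
  rewrite (eq_integral (EFin \o u)); last by move=> z _; rewrite /= ger0_norm.
  rewrite -[LHS]fineK; last by apply: integrable_fin_num.
  by rewrite -/(Rintegral nu setT u) int0.
apply: filterS ae0 => z /(_ I) [/= uz].
rewrite leNgt; apply/negP => rz; move: uz; apply/eqP; rewrite gt_eqF //.
by rewrite /u lt_min ltr01 lt_max subr_gt0 rz.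
Qed.

(** Extends weak convergence to an unbounded kernel f: both nu and, eventually, the roots live in
    the disc, where f coincides with a bounded continuous g. *)
Lemma weak_limit_mean c (r : R) (f : borelC R -> R) g : encl k a c r ->
  measurable_fun setT f -> continuous g -> (exists M : R, forall z, `|g z| <= M) ->
  (forall z, normc (z - c) <= r -> f z = g z) ->
  nu.-integrable setT (EFin \o f) /\
  (fun m => real_mean (phi m) f) @ \oo --> Rintegral nu setT f.
Proof.
move=> hc mf cg bg fg; have ig := bounded_integrable cg bg.
have ae : ae_eq nu setT (EFin \o f) (EFin \o (g : borelC R -> R)).
  by apply: filterS (weak_limit_support hc) => z zr _; rewrite /= fg.
have mg : measurable_fun setT (EFin \o (g : borelC R -> R)).
  exact: measurable_int ig.
have mf' : measurable_fun setT (EFin \o f) by apply/measurable_EFinP.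
have fi : Rintegral nu setT f = Rintegral nu setT (g : borelC R -> R).
  by rewrite /Rintegral; congr fine; apply: ae_eq_integral.
split.
  apply/integrableP; split=> //; have /integrableP[_] := ig.
  suff -> : (\int[nu]_x `|(EFin \o (g : borelC R -> R)) x| = \int[nu]_x `|(EFin \o f) x|)%E by [].
  apply: ae_eq_integral => //; [exact: measurableT_comp | exact: measurableT_comp |].
  by apply: ae_eq_sym; apply: ae_eq_abse ae.
have := weak_mean cg bg; rewrite fi.
have [N hN] := roots_localized k_gt0 hQ hc.
move=> /cvgrPdist_le h; apply/cvgrPdist_le => e /h[N' _ h'].
exists (maxn N N') => // m /=; rewrite geq_max => /andP[Nm N'm].
have [_ hz] := hN (phi m) (leq_trans Nm (homo_ltn_ge hphi m)).
rewrite (_ : real_mean (phi m) f = real_mean (phi m) g); first exact: h'.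
rewrite /real_mean big_seq [in RHS]big_seq; congr (_ * _); apply: eq_bigr => z /hz zr.
by rewrite fg // ltW.
Qed.

Lemma cvgC_Re_cvg (v : nat -> C) l : cvgC v l -> (fun n => complex.Re (v n)) @ \oo --> complex.Re l.
Proof.
move=> h; apply/cvgrPdist_le => e /h[N hN]; exists N => // n /= /hN; apply: le_trans.
by rewrite -ReN -ReD cnBC Re_le_cn.
Qed.

Lemma cvgC_Im_cvg (v : nat -> C) l : cvgC v l -> (fun n => complex.Im (v n)) @ \oo --> complex.Im l.
Proof.
move=> h; apply/cvgrPdist_le => e /h[N hN]; exists N => // n /= /hN; apply: le_trans.
by rewrite -ImN -ImD cnBC Im_le_cn.
Qed.

Lemma cvgC_sub (v : nat -> C) l : cvgC v l -> cvgC (fun m => v (phi m)) l.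
Proof.
move=> h e /h[N hN]; exists N => m Nm; apply: hN; apply: leq_trans Nm (homo_ltn_ge hphi m).
Qed.

Lemma weak_limit_cauchy t : exterior k a t ->
  cintegrable nu setT (fun z : borelC R => (t - z)^-1) /\ cauchy_transform nu t = CQ k a t.
Proof.
move=> ht; have [c [r [hc rt]]] := ht.
(* The distance from t to the disc: clipping |t - z| from below at d changes nothing for z in the
   disc. *)
set d := normc (t - c) - r; have d0 : 0 < d by rewrite subr_gt0.
have lim := cvgC_sub (CQ_cvg k_gt0 ht hQ).
have far z : normc (z - c) <= r -> d <= normc (t - z).
  by have := cn_lowerB (t - c) (z - c); rewrite opprB addrA subrK /d; lra.
have clipE z : normc (z - c) <= r -> Num.max (normc (t - z)) d = normc (t - z).
  by move=> /far h; apply/max_idPl.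
have bnd (x : R) z : `|x| <= normc (t - z) -> `|x * (Num.max (normc (t - z)) d ^+ 2)^-1| <= d^-1.
  move=> xz; set y := Num.max _ _.
  have dy : d <= y by rewrite le_max lexx orbT.
  have xy : `|x| <= y by rewrite (le_trans xz) // le_max lexx.
  have y0 : 0 < y := lt_le_trans d0 dy.
  rewrite normrM normfV (ger0_norm (exprn_ge0 2 (ltW y0))) expr2 invfM mulrA.
  apply: le_trans (_ : 1 * y^-1 <= _); last by rewrite mul1r lef_pV2 ?posrE.
  by rewrite ler_wpM2r ?invr_ge0 ?(ltW y0) // ler_pdivrMr // mul1r.
have [i1 l1] : nu.-integrable setT (EFin \o (fun z : borelC R => complex.Re (t - z)^-1)) /\
  (fun m => real_mean (phi m) (fun z => complex.Re (t - z)^-1)) @ \oo -->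
  Rintegral nu setT (fun z : borelC R => complex.Re (t - z)^-1).
  apply: (@weak_limit_mean c r _ (fun z => complex.Re (t - z) * (Num.max (normc (t - z)) d ^+ 2)^-1) hc).
  - exact: measurable_Re_cauchy.
  - by apply: continuous_mulC; [exact: continuous_Re_sub | exact: continuous_clip_inv].
  - by exists d^-1 => z; apply: bnd; exact: Re_le_cn.
  by move=> z /clipE ->; rewrite Re_inv.
have [i2 l2] : nu.-integrable setT (EFin \o (fun z : borelC R => complex.Im (t - z)^-1)) /\
  (fun m => real_mean (phi m) (fun z => complex.Im (t - z)^-1)) @ \oo -->
  Rintegral nu setT (fun z : borelC R => complex.Im (t - z)^-1).
  apply: (@weak_limit_mean c r _ (fun z => - complex.Im (t - z) * (Num.max (normc (t - z)) d ^+ 2)^-1) hc).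
  - exact: measurable_Im_cauchy.
  - apply: continuous_mulC; last exact: continuous_clip_inv.
    by apply: continuous_oppC; exact: continuous_Im_sub.
  - by exists d^-1 => z; apply: bnd; rewrite normrN Im_le_cn.
  by move=> z /clipE ->; rewrite Im_inv.
split; first by split.
apply: complex_eq.
  have h : (fun m => real_mean (phi m) (fun z => complex.Re (t - z)^-1)) @ \oo --> complex.Re (CQ k a t).
    by have := cvgC_Re_cvg lim; under eq_fun do rewrite Re_root_mean.
  exact: cvg_unique l1 h.
have h : (fun m => real_mean (phi m) (fun z => complex.Im (t - z)^-1)) @ \oo --> complex.Im (CQ k a t).
  by have := cvgC_Im_cvg lim; under eq_fun do rewrite Im_root_mean.
exact: cvg_unique l2 h.
Qed.

Lemma weak_limit_log t : exterior k a t ->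
  nu.-integrable setT (fun z : borelC R => (ln (normc (t - z)))%:E) /\
  log_potential nu t = UQ k a t.
Proof.
move=> ht; have [c [r [hc rt]]] := ht; have r0 : 0 < r by case: hc.
set d := normc (t - c) - r; have d0 : 0 < d by rewrite subr_gt0.
(* The logarithm also needs an upper clip, at the largest distance from t to a point of the disc. *)
set D := normc (t - c) + r; have dD : d <= D by rewrite /d /D; lra.
have lim := cvgC_sub (UQC_cvg k_gt0 ht hQ).
have clipE z : normc (z - c) <= r -> Num.min (Num.max (normc (t - z)) d) D = normc (t - z).
  move=> zr; have h1 := cn_lowerB (t - c) (z - c); have h2 := cnB (t - c) (z - c).
  move: h1 h2; rewrite opprB addrA subrK => h1 h2.
  rewrite (_ : Num.max _ _ = normc (t - z)); first by apply/min_idPl; rewrite /D; lra.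
  by apply/max_idPl; rewrite /d; lra.
have [i1 l1] : nu.-integrable setT (EFin \o (fun z : borelC R => ln (normc (t - z)))) /\
  (fun m => real_mean (phi m) (fun z => ln (normc (t - z)))) @ \oo -->
  Rintegral nu setT (fun z : borelC R => ln (normc (t - z))).
  apply: (@weak_limit_mean c r _ (fun z => ln (Num.min (Num.max (normc (t - z)) d) D)) hc).
  - exact: measurable_log.
  - exact: continuous_clip_log.
  - exists (`|ln d| + `|ln D|) => z; set y := Num.min _ _.
    have dy : d <= y by rewrite le_min dD andbT le_max lexx orbT.
    have yD : y <= D by rewrite ge_min lexx orbT.
    have l1 : ln d <= ln y by rewrite ler_ln ?posrE // (lt_le_trans d0).
    have l2 : ln y <= ln D by rewrite ler_ln ?posrE // (lt_le_trans d0).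
    have := ler_norm (ln D); have := ler_norm (- ln d); rewrite normrN => h1 h2.
    have := normr_ge0 (ln D); have := normr_ge0 (ln d) => h3 h4.
    by rewrite ler_norml; apply/andP; split; lra.
  by move=> z /clipE ->.
split=> //.
have h : (fun m => real_mean (phi m) (fun z => ln (normc (t - z)))) @ \oo --> UQ k a t.
  by have := cvgC_Re_cvg lim; under eq_fun do rewrite Re_root_mean.
exact: cvg_unique l1 h.
Qed.

End WeakLimits.

(** * Locally uniform convergence *)

Section LocallyUniform.
Variable R : realType.
Local Notation C := (Cnum R).

Lemma uniform_cvgC (U : set C) (F : nat -> C -> C) (f : C -> C) :
  (forall e : R, 0 < e -> exists N, forall n, (N <= n)%N -> forall s, U s -> normc (F n s - f s) <= e) ->
  {uniform U, F @ \oo --> f}.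
Proof.
move=> h P /uniform_nbhs[E [entE EP]]; move: entE.
rewrite -entourage_ballE => -[e /= e0 eE].
have re : e = (complex.Re e)%:C by rewrite RRe_real // gtr0_real.
have e0' : 0 < complex.Re e by move: e0; rewrite re ltcR.
have [N hN] := h _ (divr_gt0 e0' (ltr0n R 2)); exists N => // n /= Nn.
apply: EP => s Us; apply: eE => /=; suff h1 : `|f s - F n s| < e by [].
rewrite distrC.
rewrite re -[X in X < _]/((normc _)%:C) ltcR; apply: le_lt_trans (hN n Nn s Us) _; lra.
Qed.

Lemma uniform_cvgR (U : set C) (F : nat -> C -> R) (f : C -> R) :
  (forall e : R, 0 < e -> exists N, forall n, (N <= n)%N -> forall s, U s -> `|F n s - f s| <= e) ->
  {uniform U, F @ \oo --> f}.
Proof.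
move=> h P /uniform_nbhs[E [entE EP]]; move: entE.
rewrite -entourage_ballE => -[e /= e0 eE].
have [N hN] := h _ (divr_gt0 e0 (ltr0n R 2)); exists N => // n /= Nn.
apply: EP => s Us; apply: eE => /=; suff h1 : `|f s - F n s| < e by [].
rewrite distrC.
by apply: le_lt_trans (hN n Nn s Us) _; lra.
Qed.

Variables (k : nat) (a : nat -> C).
Hypothesis k_gt0 : (0 < k)%N.
Variable Q : nat -> {poly C}.
Hypothesis hQ : heun_data k a Q.
Local Notation mu := (root_counting_measure k Q).

Lemma exterior_nbhs (c t : C) (r : R) : r < normc (t - c) ->
  exists r', r < r' /\ nbhs t [set s : C | r' <= normc (s - c)].
Proof.
move=> rt; exists ((r + normc (t - c)) / 2); split; first lra.
apply/nbhsC_P; exists ((normc (t - c) - r) / 2); first by rewrite divr_gt0 // subr_gt0.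
move=> s /= hs; have := cn_lowerB (t - c) (t - s); rewrite (cnBC s t) in hs.
have -> : t - c - (t - s) = s - c by ring.
lra.
Qed.

Lemma locally_uniform_cauchy :
  locally_uniform_cvg (exterior k a) (fun n => cauchy_transform (mu n)) (CQ k a).
Proof.
move=> t [c [r [hc /exterior_nbhs[r' [rr ht]]]]]; exists [set s : C | r' <= normc (s - c)] => //.
apply: uniform_cvgC => e e0; have [N hN] := CQ_uniform k_gt0 hc rr hQ e0.
by exists N => n Nn s hs; rewrite cauchy_transform_root_counting; apply: hN.
Qed.

Lemma locally_uniform_log :
  locally_uniform_cvg (exterior k a) (fun n => log_potential (mu n)) (UQ k a).
Proof.
move=> t [c [r [hc /exterior_nbhs[r' [rr ht]]]]]; exists [set s : C | r' <= normc (s - c)] => //.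
apply: uniform_cvgR => e e0; have [N hN] := UQC_uniform k_gt0 hc rr hQ e0.
exists N => n Nn s hs; rewrite log_potential_root_counting /UQ -ReN -ReD.
by apply: le_trans (Re_le_cn _) _; apply: hN.
Qed.

End LocallyUniform.

(** * Separation of a point from the convex hull *)

Section Separation.
Variable R : realType.
Local Notation C := (Cnum R).
Implicit Types (t z c s v w : C).

Definition dotC w v : R := complex.Re w * complex.Re v + complex.Im w * complex.Im v.
Definition crossC w v : R := complex.Re w * complex.Im v - complex.Im w * complex.Re v.

Lemma small_perturbation (T : eqType) (s : seq T) (f g : T -> R) :
  (forall x, x \in s -> 0 < f x) ->
  exists2 e : R, 0 < e & forall x, x \in s -> 0 < f x + e * g x.
Proof.
elim: s => [|x s IH] hf; first by exists 1.
have [e e0 he] : exists2 e : R, 0 < e & forall x, x \in s -> 0 < f x + e * g x.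
  by apply: IH => y ys; apply: hf; rewrite inE ys orbT.
have fx : 0 < f x by apply: hf; rewrite inE eqxx.
pose d := f x / (`|g x| + 1).
have g1 : 0 < `|g x| + 1 by rewrite ltr_wpDl.
have d0 : 0 < d by rewrite divr_gt0.
exists (Num.min e d); first by rewrite lt_min e0.
have m0 : 0 <= Num.min e d by rewrite le_min !ltW.
move=> y; rewrite inE => /orP[/eqP->|ys].
  have : Num.min e d * (`|g x| + 1) <= f x.
    by rewrite -ler_pdivlMr // ge_min lexx orbT.
  have : - `|g x| <= g x by rewrite lerNl -normrN ler_norm.
  have : 0 < Num.min e d by rewrite lt_min e0.
  move: (Num.min e d) (`|g x|) (g x) (f x) => p q r u; nra.
have := he y ys; have fy : 0 < f y by apply: hf; rewrite inE ys orbT.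
have : Num.min e d <= e by rewrite ge_min lexx.
move: m0; move: (Num.min e d) (g y) (f y) fy => p q u u0 p0 pe eq0.
have [q0|q0] := lerP 0 q; first by rewrite ltr_pwDl ?mulr_ge0.
by apply: lt_le_trans eq0 _; rewrite lerD2l ler_wnM2r // ltW.
Qed.

(** Triangles, possibly degenerate, suffice in the plane: this is the Caratheodory form of 0 lying
    outside the convex hull of s. *)
Definition no_triangle (s : seq C) := forall p q w, p \in s -> q \in s -> w \in s ->
  forall x y z : R, 0 <= x -> 0 <= y -> 0 <= z -> x + y + z = 1 ->
  x%:C * p + y%:C * q + z%:C * w != 0.

Lemma no_triangle_cone (s : seq C) p q w (x y z : R) : no_triangle s ->
  p \in s -> q \in s -> w \in s ->
  0 <= x -> 0 <= y -> 0 <= z -> 0 < x + y + z -> x%:C * p + y%:C * q + z%:C * w != 0.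
Proof.
move=> hs ps qs ws x0 y0 z0 l0; set l := x + y + z in l0.
have ln : l != 0 by rewrite lt0r_neq0.
have := hs p q w ps qs ws (x / l) (y / l) (z / l); rewrite !divr_ge0 ?(ltW l0) // -!mulrDl divff //.
move=> /(_ isT isT isT erefl); apply: contraNneq => h.
have -> : (x / l)%:C * p + (y / l)%:C * q + (z / l)%:C * w = l^-1%:C * (x%:C * p + y%:C * q + z%:C * w).
  by apply: complex_eq; rewrite ?(ReD, ImD, Re_mul, Im_mul) /=; ring.
by rewrite h mulr0.
Qed.

(* If the direction v found for s fails on w0, then s lies strictly on one side of
   the line through 0 and w0, since otherwise 0 would belong to a triangle with
   vertex w0. The normal of that line is then tilted slightly towards w0. *)
Lemma planar_gordan (s : seq C) : no_triangle s -> exists v, forall w, w \in s -> 0 < dotC w v.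
Proof.
elim: s => [|w0 s IH] hs; first by exists 0.
have [v hv] : exists v, forall w, w \in s -> 0 < dotC w v.
  by apply: IH => p q w ps qs ws; apply: hs; rewrite inE ?ps ?qs ?ws orbT.
have w0s : w0 \in w0 :: s by rewrite inE eqxx.
have inS w : w \in s -> w \in w0 :: s by rewrite inE => ->; rewrite orbT.
have [pos|neg] := ltrP 0 (dotC w0 v).
  by exists v => w; rewrite inE => /orP[/eqP->|/hv].
have w0n : w0 != 0.
  have := hs w0 w0 w0 w0s w0s w0s 1 0 0 ler01 (lexx _) (lexx _); rewrite !addr0 mul1r.
  by rewrite !mul0r !addr0; apply.
have n0 : 0 < dotC w0 w0 by rewrite /dotC -!expr2 -normc_sqr exprn_gt0 // cn_gt0.
(* Points on both sides of the line through w0 have a nonnegative combination on it. As v is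
   positive on s and not on w0, this combination is a negative multiple of w0, which puts 0 in a
   triangle. *)
have opp w w' : w \in s -> w' \in s -> 0 <= crossC w0 w -> crossC w0 w' <= 0 -> False.
  move=> ws ws' A0 B0.
  have [b [b' [b0 b0' bb cr]]] : exists b b' : R, [/\ 0 <= b, 0 <= b', 0 < b + b' &
      b * crossC w0 w + b' * crossC w0 w' = 0].
    have [A1|A1] := eqVneq (crossC w0 w) 0.
      by exists 1, 0; rewrite A1 ler01 lexx addr0 ltr01 mulr0 mul0r addr0.
    exists (- crossC w0 w'), (crossC w0 w); split=> //; first by rewrite oppr_ge0.
      by rewrite ltr_wpDl ?oppr_ge0 // lt_neqAle eq_sym A1.
    by ring.
  have dx : 0 < b * dotC w v + b' * dotC w' v.
    have h1 := hv w ws; have h2 := hv w' ws'.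
    have [b1|b1] := ltrP 0 b; first by rewrite ltr_pwDl ?mulr_gt0 // mulr_ge0 // ltW.
    by rewrite ltr_wpDl ?mulr_gt0 ?mulr_ge0 ?(ltW h1) //; lra.
  pose l := (b * dotC w w0 + b' * dotC w' w0) / dotC w0 w0.
  have xl : b%:C * w + b'%:C * w' = l%:C * w0.
    have nn : dotC w0 w0 != 0 by rewrite lt0r_neq0.
    apply: complex_eq; rewrite ?ReD ?ImD ?Re_mul ?Im_mul /= /l; apply: (mulIf nn).
      rewrite mulrBl [X in _ = X - _]mulrAC divfK //; apply/eqP; rewrite -subr_eq0; apply/eqP.
      transitivity (- complex.Im w0 * (b * crossC w0 w + b' * crossC w0 w')); last by rewrite cr mulr0.
      by rewrite /dotC /crossC; ring.
    rewrite [RHS]mulrDl [X in _ = X + _]mulrAC divfK //; apply/eqP; rewrite -subr_eq0; apply/eqP.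
    transitivity (complex.Re w0 * (b * crossC w0 w + b' * crossC w0 w')); last by rewrite cr mulr0.
    by rewrite /dotC /crossC; ring.
  have dl : b * dotC w v + b' * dotC w' v = l * dotC w0 v.
    have := congr1 (fun x => dotC x v) xl; rewrite /dotC ?ReD ?ImD ?Re_mul ?Im_mul /= => e.
    by apply: etrans (etrans e _); ring.
  have l0 : l < 0 by move: dx neg; rewrite dl; nra.
  have := @no_triangle_cone _ w w' w0 b b' (- l) hs (inS _ ws) (inS _ ws') w0s b0 b0'.
  rewrite xl => /(_ _ _)/negP; apply; first by lra.
    by lra.
  by rewrite rmorphN mulNr subrr.
have [sg hsg] : exists sg : R, forall w, w \in s -> 0 < sg * crossC w0 w.
  have [h|] := pselect (forall w, w \in s -> 0 < crossC w0 w); first by exists 1 => w /h; rewrite mul1r.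
  move=> /existsNP[w /not_implyP[ws /negP]]; rewrite -leNgt => hw.
  exists (-1) => w' ws'; rewrite mulN1r oppr_gt0 ltNge; apply/negP => h.
  exact: opp ws' ws h hw.
have [e e0 he] := small_perturbation (fun w => dotC w w0) hsg.
(* The vector (e + i sg) w0: its product with w is sg * [crossC w0 w] + e * [dotC w w0], and on w0
   itself it is e |w0| ^ 2. *)
exists ((e * complex.Re w0 - sg * complex.Im w0) +i* (sg * complex.Re w0 + e * complex.Im w0)) => w.
rewrite inE => /orP[/eqP->|/he].
  by rewrite [X in 0 < X](_ : _ = e * dotC w0 w0) ?mulr_gt0 // /dotC /=; ring.
by congr (_ < _); rewrite /dotC /crossC /=; ring.
Qed.

Variables (k : nat) (a : nat -> C).
Hypothesis k_gt0 : (0 < k)%N.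

(** A half-plane that has t on its boundary and the zeros inside is approximated by a disc with t on
    its circle and centre far away along the inner normal v; shrinking it slightly leaves t
    outside. *)
Lemma exterior_zero_hull t : ~ zero_hull k a t -> exterior k a t.
Proof.
move=> ht; have [rs Prs] := poly_rootsE (monic_zero_at_origin k a).
have l0 : lead_coef (monic_zero_at_origin k a) != 0 by rewrite lead_coef_eq0 P0_neq0.
have rootE z : root (monic_zero_at_origin k a) z = (z \in rs).
  by rewrite Prs rootZ // root_prod_XsubC.
have rs0 : 0 \in rs.
  by rewrite -rootE /root horner_coef0 coef_monic_zero_at_origin.
have [v hv] : exists v, forall w, w \in [seq z - t | z <- rs] -> 0 < dotC w v.
  apply: planar_gordan => _ _ _ /mapP[p ps ->] /mapP[q qs ->] /mapP[w ws ->] x y z x0 y0 z0 xyz.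
  apply/eqP => h; apply: ht.
  exists 3%N, (fun i => [:: x; y; z]`_i), (fun i => [:: p; q; w]`_i); split.
  - by case=> -[|[|[|//]]].
  - by rewrite !big_ord_recl big_ord0 /= addr0 addrA.
  - by case=> -[|[|[|//]]] /= _; rewrite rootE.
  rewrite !big_ord_recl big_ord0 /= addr0.
  have zE : z = 1 - x - y by lra.
  have := congr1 (@complex.Im R) h; have := congr1 (@complex.Re R) h.
  rewrite !ReD !ImD !Re_mul !Im_mul /= !ReD !ImD !ReN !ImN zE => h1 h2.
  by apply: complex_eq; rewrite ?(ReD, ImD, Re_mul, Im_mul) /=; lra.
(* For the centre c = t + v / e, |t - c| ^ 2 - |z - c| ^ 2 is 1 / e times this quantity, so its
   positivity puts z strictly inside the circle through t. *)
have [e e0 he] : exists2 e : R, 0 < e & forall z, z \in rs ->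
    0 < 2 * dotC (z - t) v + e * - normc (z - t) ^+ 2.
  apply: small_perturbation => z zs; rewrite mulr_gt0 // hv //; exact: map_f.
pose c : C := t + e^-1%:C * v; pose D := normc (t - c).
have inD z : z \in rs -> 0 < D - normc (z - c).
  move=> /he hz; rewrite subr_gt0 -(ltr_pXn2r (ltn0Sn 1)) ?nnegrE ?cn_ge0 // /D !normc_sqr /c.
  have ee : e^-1 * e = 1 by rewrite mulVf // lt0r_neq0.
  have ei : 0 < e^-1 by rewrite invr_gt0.
  move: hz; rewrite normc_sqr /dotC !ReD !ImD !ReN !ImN !ReD !ImD Re_mul Im_mul /=.
  set x := complex.Re z - complex.Re t; set y := complex.Im z - complex.Im t.
  move: (complex.Re v) (complex.Im v) => p q hz.
  rewrite -subr_gt0; have := mulr_gt0 ei hz; congr (_ < _).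
  by rewrite mulrDr [e^-1 * (e * _)]mulrA ee mul1r /x /y; ring.
have [d d0 hd] := small_perturbation (fun=> -1) inD.
have D0 : 0 < D by have := inD 0 rs0; have := cn_ge0 (0 - c); lra.
(* D - d still encloses the finitely many zeros and is below D; D / 2 only ensures a positive
   radius. *)
exists c, (Num.max (D - d) (D / 2)); split.
  split; first by rewrite lt_max divr_gt0 // orbT.
  by move=> z; rewrite rootE => /hd; rewrite lt_max => h; apply/orP; left; lra.
by rewrite gt_max -/D; apply/andP; split; lra.
Qed.

End Separation.

(** * The integral formula near infinity *)

Section BranchIntegral.
Variable R : realType.
Local Notation C := (Cnum R).
Variables (k : nat) (a : nat -> C).
Hypothesis k_gt0 : (0 < k)%N.

(** Cauchy's bound: a zero of modulus at least 1 has modulus at most the sum of the |a_j|. *)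
Lemma encl_symb_bound : encl k a 0 (symb_bound k a).
Proof.
set B := symb_bound k a; have B1 : 1 <= B by rewrite lerDr sumr_ge0 // => j _; exact: cn_ge0.
split; first lra; move=> z; rewrite subr0 ltNge => hz; apply/negP => Bz.
have z1 : 1 <= normc z by lra.
have eqz : z ^+ k.+1 = - \sum_(1 <= j < k.+1) a j * z ^+ j.
  apply/eqP; rewrite -addr_eq0; move: hz; rewrite /root /monic_zero_at_origin hornerD hornerXn.
  rewrite horner_sum; congr (_ + _ == 0).
  by apply: eq_bigr => j _; rewrite hornerZ hornerXn.
have : normc z ^+ k.+1 <= (B - 1) * normc z ^+ k.
  rewrite -cnX eqz cnN big_add1 /= big_mkord.
  apply: le_trans (_ : \sum_(j < k) normc (a j.+1) * normc z ^+ k <= _).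
    apply: cn_sum_le => j _; rewrite cnM cnX ler_wpM2l ?cn_ge0 //.
    by rewrite ler_weXn2l.
  rewrite -mulr_suml ler_wpM2r ?exprn_ge0 ?cn_ge0 // /B /symb_bound addrK big_ord_recl.
  by rewrite lerDr cn_ge0.
have zk : 0 < normc z ^+ k by rewrite exprn_gt0 //; lra.
rewrite exprS ler_pM2r //; lra.
Qed.

Lemma symb_bound_lt_radius : symb_bound k a < branch_radius k a.
Proof.
have := symb_bound_ge0 k a; rewrite /branch_radius /far; set B := symb_bound k a => B0.
have k1 : (1 : R) <= k%:R by rewrite ler1n.
have : B <= k%:R * B by rewrite ler_peMl.
have : 0 <= k%:R * (k%:R * B) by rewrite !mulr_ge0.
lra.
Qed.

(** By [branch_unique] any admissible Psi is 1 / [ystar], so the integrand is [lstar], which is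
    Lipschitz in tau. *)
Lemma branch_integral Psi (t : C) : branch_at_infinity k a (branch_radius k a) Psi ->
  branch_radius k a < normc t ->
  let f := fun tau : R => log_derivative (fun s => Psi s tau) t in
  [/\ forall tau : R, 0 <= tau <= 1 -> Psi t tau != 0,
      cintegrable lebesgue_measure `[0, 1] f
    & CQ k a t = cintegral lebesgue_measure `[0, 1] f].
Proof.
move=> hPsi ht f; have uniq := branch_unique k_gt0 hPsi.
have fE tau : 0 <= tau <= 1 -> f tau = lstar k a t tau.
  move=> h; rewrite /f; apply: (log_derivative_branch h ht) => s hs.
  by have [_ ->] := uniq s tau h hs.
have lf : lip01 f.
  have [K K0 hK] := lip01_lstar ht.
  by exists K => // x y hx hy; rewrite !fE //; apply: hK.
split; [by move=> tau h; have [] := uniq t tau h ht | exact: lip01_cintegrable |].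
rewrite CQ_branch //; last first.
  exists (symb_bound k a); split; first exact: encl_symb_bound.
  exact: lt_trans symb_bound_lt_radius ht.
have inE01 tau : tau \in (`[0, 1]%classic : set R) -> f tau = lstar k a t tau.
  by rewrite inE /= in_itv /= => /fE.
by apply: complex_eq; rewrite /cintegral /=; apply: eq_Rintegral => tau /inE01 ->.
Qed.

End BranchIntegral.

Theorem theorem3 (R : realType) (k : nat) (k_ge1 : (1 <= k)%N)
    (a : nat -> Cnum R) :
  let Omega := ~` zero_hull k a in
  exists (CQ : Cnum R -> Cnum R) (UQ : Cnum R -> R),
  [/\ analytic_on Omega CQ,
      exists rho : R,
        (exists Psi, branch_at_infinity k a rho Psi) /\
        forall Psi, branch_at_infinity k a rho Psi ->
        forall t : Cnum R, rho < normc t ->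
        let f := fun tau : R => log_derivative (fun s => Psi s tau) t in
        [/\ forall tau : R, 0 <= tau <= 1 -> Psi t tau != 0,
            cintegrable lebesgue_measure `[0, 1] f
          & CQ t = cintegral lebesgue_measure `[0, 1] f],
      [/\ harmonic_on Omega UQ,
          exists M r : R, 0 < r /\ forall t : Cnum R, r < normc t ->
            `|UQ t - ln (normc t)| <= M / normc t
        & forall t : Cnum R, Omega t -> 2 * wirtinger UQ t = CQ t]
    & forall Q : nat -> {poly Cnum R},
      high_order_heun k Q -> Q k = monic_zero_at_origin k a ->
      let mu := root_counting_measure k Q in
      let Sp := spectral_poly k Q in
      [/\ forall n (t : Cnum R), ~~ root (Sp n) t ->
            cauchy_transform (mu n) t
              = (n.+1%:R)^-1 * ((Sp n)^`().[t] / (Sp n).[t]) /\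
            log_potential (mu n) t
              = (n.+1%:R)^-1 * ln (normc (Sp n).[t]),
          locally_uniform_cvg Omega (fun n => cauchy_transform (mu n)) CQ,
          locally_uniform_cvg Omega (fun n => log_potential (mu n)) UQ
        & forall (phi : nat -> nat)
            (nu : {finite_measure set (borelC R) -> \bar R}),
          {homo phi : m n / (m < n)%N} ->
          weak_cvg (fun m => mu (phi m)) nu ->
          forall t : Cnum R, Omega t ->
          [/\ cintegrable nu setT (fun z : borelC R => (t - z)^-1),
              cauchy_transform nu t = CQ t,
              nu.-integrable setT
                (fun z : borelC R => (ln (normc (t - z)))%:E)
            & log_potential nu t = UQ t]]].
Proof.
move=> Omega; have ext t : Omega t -> exterior k a t by apply: exterior_zero_hull.
have [[c1 c2 c3 c4] wirt] := harmonic_UQ a k_ge1.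
exists (CQ k a), (UQ k a); split.
- by move=> t /ext; apply: analytic_CQ.
- exists (branch_radius k a); split.
    by eexists; exact: branch_at_infinity_ystar.
  by move=> Psi hPsi t ht; apply: branch_integral.
- split; [split | exact: UQ_at_infinity | by move=> t /ext/wirt].
  + by move=> t /ext/c1.
  + by move=> t /ext/c2.
  + by move=> t /ext/c3.
  by move=> t /ext/c4.
move=> Q hQ Qk mu Sp; have hd : heun_data k a Q by [].
split.
- by move=> n t nr; split; [apply: cauchy_transform_spectral | apply: log_potential_spectral].
- by move=> t /ext; apply: locally_uniform_cauchy.
- by move=> t /ext; apply: locally_uniform_log.
move=> phi nu hphi hnu t /ext ht.
have [h1 h2] := weak_limit_cauchy k_ge1 hd hphi hnu ht.
by have [h3 h4] := weak_limit_log k_ge1 hd hphi hnu ht.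
Qed.
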